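(* Let $\delta,\epsilon\in(0,1)$. Suppose that the manifold assumption (M), the retraction assumption (R), the Lipschitz assumption (L) and the stochastic oracle assumption (O) stated in the context hold. Run the algorithm RO2NC described in the context, in its projection version, for $N=KT$ rounds in total, with $T=(\delta N)^{2/3}$, $D=\delta/T$ and $\eta=D/(G\sqrt T)$. Then its output $w_{out}$ satisfies $$\mathbb{E}\big[\|\mathrm{grad} f(w_{out})\|_\delta\big]\le C_3(\delta N)^{-\frac13}+C_4\,\delta^{\frac13}N^{-\frac23}+\delta LC,$$ where $C_3=\theta+\sigma+G+4mGC$, $C_4=2mGC+GC'+2m^2GC^2$, $m=n-d$, and $\theta=f(x_{1,0})-\mathbb{E}[f(x_{K,T})]$.
   Context: **Setting.** $\mathcal{M}$ is a complete $d$-dimensional embedded submanifold of $\mathbb{R}^n$ with the metric induced by the Euclidean metric; $\langle\cdot,\cdot\rangle$, $\|\cdot\|$ are the Euclidean inner product and norm; $T_x\mathcal{M}$ is the tangent space at $x$; $m=n-d$ is the dimension of the normal space; $\mathrm{Proj}_{T_x\mathcal{M}}$ is the orthogonal projection of $\mathbb{R}^n$ onto $T_x\mathcal{M}$; $\mathrm{dist}$ is the geodesic distance; $B(x,\delta)=\{y\in\mathcal{M}:\mathrm{dist}(x,y)\le\delta\}$; $\mathbb{B}_{T_x\mathcal{M}}(r)$ is the ball of radius $r$ centered at $0$ in $T_x\mathcal{M}$. $P^g_{x,y}:T_x\mathcal{M}\to T_y\mathcal{M}$ is parallel transport along the minimizing geodesic from $x$ to $y$ (the notation presupposes that this geodesic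 is well defined). The objective is $f:\mathcal{M}\to\mathbb{R}$, $f(x)=\mathbb{E}_\nu[F(x,\nu)]$, where $\nu$ is a random index. **Goldstein stationarity.** $\mathrm{grad} f(x)$ is the Riemannian gradient. For Lipschitz $f$, the Riemannian subdifferential is $\partial f(x)=\mathrm{conv}\{\lim_{l\to\infty}\mathrm{grad} f(x_l): x_l\to x,\ x_l\in\Omega_f\}\subset T_x\mathcal{M}$, where $\Omega_f$ is the set of points where $f$ is differentiable. (The limit is the vector $\xi\in T_x\mathcal M$ with $\langle \mathrm{grad} f(x_l),X(x_l)\rangle\to\langle \xi,X(x)\rangle$ for every smooth vector field $X$ on $\mathcal{M}$.) The $\delta$-subdifferential is $\partial_\delta f(x)=\mathrm{cl\,conv}\{P^g_{y,x}(\partial f(y)): y\in\mathrm{cl}\,B(x,\delta)\}$, and $\|\mathrm{grad} f(x)\|_\delta:=\min\{\|g\|:g\in\partial_\delta f(x)\}$. A point $x$ is $(\delta,\epsilon)$-stationary if $\|\mathrm{grad} f(x)\|_\delta\le\epsilon$. **Assumptions.** - (M) The second fundamental form $\mathrm{II}$ of $\mathcal{M}\subset\mathbb{R}^n$ (i.e. $\mathrm{II}(X,Y)$ is the normal component of the ambient covariant derivative $\tilde\nabla_XY$) satisfies $\|\mathrm{II}(\xi,\eta)\|\le C$ for all unit tangent vectors $\xi,\eta$ at a common point. (This implies bounds $\|R(X,Y)Z\|\le K_c\|X\|\|Y\|\|Z\|$ on the curvature tensor and $K_s$ on the absolute value of the sectional curvature.) - (R) $\mathrm{Retr}$ is a retraction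 on $\mathcal{M}$ such that, along retraction curves $t\mapsto\mathrm{Retr}_x(t\xi)$, $\xi\in T_x\mathcal{M}$: $\|\frac{d}{dt}\mathrm{Retr}_x(t\xi)\|\le\|\xi\|$ and $\|\frac{d^2}{dt^2}\mathrm{Retr}_x(t\xi)\|\le C'\|\xi\|^2$ (derivatives taken in $\mathbb{R}^n$), where $C'$ is a constant depending on the manifold. - (L) For every $\nu$, $|F(x,\nu)-F(y,\nu)|\le L(\nu)\,\mathrm{dist}(x,y)$ for all $x,y\in\mathcal{M}$, with $\mathbb{E}_\nu[L(\nu)^2]\le L^2$; and $\inf_{\mathcal{M}}f>-\infty$. - (O) The stochastic Riemannian gradient oracle is unbiased, $\mathbb{E}_\nu[\mathrm{grad}F(x,\nu)]=\mathrm{grad}f(x)$, has bounded second moment $\mathbb{E}_\nu[\|\mathrm{grad}F(x,\nu)\|^2]\le G^2$, and its variance is denoted by $\sigma^2$. **Algorithm RO2NC, projection version.** Input: $K,T\in\mathbb{N}$, initial point $x_{0,T}\in\mathcal{M}$, clipping parameter $D$, step size $\eta$. For $k=1,\dots,K$: set $x_{k,0}=x_{k-1,T}$, $\Delta_{k,0}=0$. For $t=0,\dots,T-1$: 1. $x_{k,t+1}=\mathrm{Retr}_{x_{k,t}}(\Delta_{k,t})$; 2. draw $s_{k,t}\sim\mathrm{unif}[0,1]$ and set $w_{k,t}=\mathrm{Retr}_{x_{k,t}}(s_{k,t}\Delta_{k,t})$; 3. obtain $g_{k,t}=\mathrm{grad}F(w_{k,t},\nu_{k,t})$ with $\nu_{k,t}$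 a fresh independent random index; 4. $\Delta_{k,t+1}=\mathrm{Proj}_{T_{x_{k,t+1}}\mathcal{M}}(\Delta_{k,t}-\eta g_{k,t})$ (the difference being taken in $\mathbb{R}^n$); 5. replace $\Delta_{k,t+1}$ by its projection onto (clip it to) the convex set $\mathbb{B}_{T_{x_{k,t+1}}\mathcal{M}}(D)$. At the end of epoch $k$ set $\bar w_k=w_{k,\lfloor T/2\rfloor}$. Output: $w_{out}\sim\mathrm{unif}\{\bar w_1,\dots,\bar w_K\}$. The expectation in the claim is over all the randomness of the algorithm. *)

(* Defs.v *)
From HB Require Import structures.
From mathcomp Require Import all_boot all_order all_algebra.
From mathcomp Require Import all_classical all_reals all_analysis.

Set Implicit Arguments.
Unset Strict Implicit.
Unset Printing Implicit Defensive.
Import Order.TTheory GRing.Theory Num.Theory.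
Import numFieldNormedType.Exports.

Local Open Scope classical_set_scope.
Local Open Scope ring_scope.

(* The library norm `|_| of 'rV[R]_n is the sup norm: it is only used for the
   topology and for derivatives.  The Euclidean norm is [enorm]. *)
Definition dotp (R : realType) (n : nat) (u v : 'rV[R]_n) : R :=
  \sum_(i < n) u ord0 i * v ord0 i.

Definition enorm (R : realType) (n : nat) (u : 'rV[R]_n) : R :=
  Num.sqrt (dotp u u).

Definition oproj (R : realType) (n : nat) (S : set 'rV[R]_n) (v : 'rV[R]_n) :
    'rV[R]_n :=
  xget 0 [set p | S p /\ forall q, S q -> dotp (v - p) q = 0].

Definition nearest (R : realType) (n : nat) (S : set 'rV[R]_n) (v : 'rV[R]_n) :
    'rV[R]_n :=
  xget 0 [set p | S p /\ forall q, S q -> enorm (v - p) <= enorm (v - q)].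

Definition conv (R : realType) (n : nat) (S : set 'rV[R]_n) : set 'rV[R]_n :=
  [set v | exists (k : nat) (a : 'I_k -> R) (p : 'I_k -> 'rV[R]_n),
    [/\ forall i, 0 <= a i, \sum_(i < k) a i = 1, forall i, S (p i)
      & v = \sum_(i < k) a i *: p i]].

(* C^k on an open set U of a finite-dimensional space. *)
Fixpoint Ck (R : realType) (V W : normedModType R) (k : nat) (U : set V)
    (f : V -> W) : Prop :=
  if k is k'.+1 then
    (forall x, U x -> differentiable f x) /\
    (forall v : V, Ck k' U ('D_v f))
  else forall x, U x -> {for x, continuous f}.

(* Smoothness on an arbitrary subset: local extension to smooth maps defined on
   open sets of the ambient space. *)
Definition smooth_on (R : realType) (V W : normedModType R) (S : set V)
    (f : V -> W) : Prop :=
  forall x, S x -> exists (U : set V) (g : V -> W),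
    [/\ open U, U x, forall k, Ck k U g & forall y, U y -> S y -> g y = f y].

(* Local defining functions: near each point, M is the zero set of a smooth
   submersion to R^(n-d). *)
Definition embedded_submanifold (R : realType) (n d : nat)
    (M : set 'rV[R]_n) : Prop :=
  [/\ (d <= n)%N, M !=set0 &
    forall x, M x -> exists (U : set 'rV[R]_n) (h : 'rV[R]_n -> 'rV[R]_(n - d)),
      [/\ open U, U x, smooth_on U h,
          forall y, U y -> (M y <-> h y = 0)
        & forall z, exists v, 'd h x v = z]].

Definition curve_through (R : realType) (n : nat) (M : set 'rV[R]_n)
    (x v : 'rV[R]_n) (c : R -> 'rV[R]_n) : Prop :=
  exists e : R,
    [/\ 0 < e, smooth_on (`]- e, e[ : set R) c, forall t, t \in `]- e, e[ -> M (c t),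
        c 0 = x & derive1 c 0 = v].

Definition tangent (R : realType) (n : nat) (M : set 'rV[R]_n)
    (x : 'rV[R]_n) : set 'rV[R]_n :=
  [set v | exists c, curve_through M x v c].

Definition tangent_bundle (R : realType) (n : nat) (M : set 'rV[R]_n) :
    set ('rV[R]_n * 'rV[R]_n) :=
  [set p | M p.1 /\ tangent M p.1 p.2].

Definition vector_field (R : realType) (n : nat) (M A : set 'rV[R]_n)
    (X : 'rV[R]_n -> 'rV[R]_n) : Prop :=
  smooth_on (M `&` A) X /\ forall y, M y -> A y -> tangent M y (X y).

(* [second_ff M x xi eta b]: b is the value II(xi, eta) at x, i.e. the normal
   component at x of the ambient derivative in the direction xi of a (local)
   tangent vector field Y with Y x = eta. *)
Definition second_ff (R : realType) (n : nat) (M : set 'rV[R]_n)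
    (x xi eta b : 'rV[R]_n) : Prop :=
  exists (A : set 'rV[R]_n) (Y : 'rV[R]_n -> 'rV[R]_n) (c : R -> 'rV[R]_n),
    [/\ open A /\ A x, vector_field M A Y, Y x = eta, curve_through M x xi c
      & let w := derive1 (Y \o c) 0 in b = w - oproj (tangent M x) w].

(* [path_length M x y l]: x and y are joined by a piecewise smooth curve in M
   of length l, given as a finite concatenation of smooth pieces, each
   parametrized by [0, 1]. *)
Inductive path_length (R : realType) (n : nat) (M : set 'rV[R]_n) :
    'rV[R]_n -> 'rV[R]_n -> R -> Prop :=
| path_length_nil x : M x -> path_length M x x 0
| path_length_cons y l (c : R -> 'rV[R]_n) :
    smooth_on (`[0, 1] : set R) c -> (forall t, t \in `[0, 1] -> M (c t)) ->
    path_length M (c 1) y l ->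
    path_length M (c 0) y
      (\int[lebesgue_measure]_(t in `[0, 1]) enorm (derive1 c t) + l).

(* Equal to +oo for points in distinct components. *)
Definition gdist (R : realType) (n : nat) (M : set 'rV[R]_n)
    (x y : 'rV[R]_n) : \bar R :=
  ereal_inf [set l%:E | l in path_length M x y].

Definition gball (R : realType) (n : nat) (M : set 'rV[R]_n) (x : 'rV[R]_n)
    (r : R) : set 'rV[R]_n :=
  [set y | M y /\ (gdist M x y <= r%:E)%E].

Definition complete_submanifold (R : realType) (n : nat) (M : set 'rV[R]_n) :
    Prop :=
  forall u : nat -> 'rV[R]_n, (forall i, M (u i)) ->
    (forall e : R, 0 < e -> exists N0 : nat, forall i j,
       (N0 <= i)%N -> (N0 <= j)%N -> (gdist M (u i) (u j) < e%:E)%E) ->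
    exists2 x, M x & forall e : R, 0 < e -> exists N0 : nat, forall i,
       (N0 <= i)%N -> (gdist M (u i) x < e%:E)%E.

(* The covariant derivative along a curve of M is the tangential component of
   the derivative in R^n. *)
Definition min_geodesic (R : realType) (n : nat) (M : set 'rV[R]_n)
    (x y : 'rV[R]_n) (c : R -> 'rV[R]_n) : Prop :=
  [/\ smooth_on (`[0, 1] : set R) c /\ (forall t, t \in `[0, 1] -> M (c t)),
      c 0 = x, c 1 = y,
      forall t, t \in `]0, 1[ -> oproj (tangent M (c t)) (derive1n 2 c t) = 0
    & (\int[lebesgue_measure]_(t in `[0, 1]) enorm (derive1 c t))%:E
        = gdist M x y].

(* Curves are compared on their parameter domain [0, 1] only. *)
Definition unique_min_geodesic (R : realType) (n : nat) (M : set 'rV[R]_n)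
    (x y : 'rV[R]_n) : Prop :=
  (exists c, min_geodesic M x y c) /\
  forall c c', min_geodesic M x y c -> min_geodesic M x y c' ->
    forall t, t \in `[0, 1] -> c t = c' t.

Definition parallel_along (R : realType) (n : nat) (M : set 'rV[R]_n)
    (c V : R -> 'rV[R]_n) : Prop :=
  [/\ {within `[0, 1], continuous V},
      forall t, t \in `[0, 1] -> tangent M (c t) (V t)
    & forall t, t \in `]0, 1[ ->
        derivable V t 1 /\ oproj (tangent M (c t)) (derive1 V t) = 0].

(* [ptransport M x y v w]: w = P^g_{x,y}(v).  This relation is functional in v
   as soon as the minimizing geodesic from x to y is unique. *)
Definition ptransport (R : realType) (n : nat) (M : set 'rV[R]_n)
    (x y v w : 'rV[R]_n) : Prop :=
  exists c V, [/\ min_geodesic M x y c, parallel_along M c V, V 0 = v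
                & V 1 = w].

Definition rdifferentiable (R : realType) (n : nat) (M : set 'rV[R]_n)
    (f : 'rV[R]_n -> R) (x : 'rV[R]_n) : Prop :=
  M x /\ exists2 g : 'rV[R]_n -> R,
    (\forall y \near x, M y -> g y = f y) & differentiable g x.

Definition is_rgrad (R : realType) (n : nat) (M : set 'rV[R]_n)
    (f : 'rV[R]_n -> R) (x v : 'rV[R]_n) : Prop :=
  [/\ rdifferentiable M f x, tangent M x v
    & forall xi c, curve_through M x xi c -> derive1 (f \o c) 0 = dotp v xi].

(* Junk value 0 where f is not differentiable. *)
Definition rgrad (R : realType) (n : nat) (M : set 'rV[R]_n)
    (f : 'rV[R]_n -> R) (x : 'rV[R]_n) : 'rV[R]_n :=
  xget 0 [set v | is_rgrad M f x v].

Definition rsubdiff (R : realType) (n : nat) (M : set 'rV[R]_n)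
    (f : 'rV[R]_n -> R) (x : 'rV[R]_n) : set 'rV[R]_n :=
  conv [set xi | tangent M x xi /\
    exists u : nat -> 'rV[R]_n,
      [/\ forall l, rdifferentiable M f (u l), u @ \oo --> x
        & forall X, vector_field M setT X ->
            dotp (rgrad M f (u l)) (X (u l)) @[l --> \oo] --> dotp xi (X x)]].

Definition goldstein_subdiff (R : realType) (n : nat) (M : set 'rV[R]_n)
    (delta : R) (f : 'rV[R]_n -> R) (x : 'rV[R]_n) : set 'rV[R]_n :=
  closure (conv [set w | exists y v,
    [/\ M y, closure (gball M x delta) y, rsubdiff M f y v
      & ptransport M y x v w]]).

(* The minimum of the norm over a closed set, written as an infimum in the
   extended reals so that an empty set gives +oo. *)
Definition goldstein_norm (R : realType) (n : nat) (M : set 'rV[R]_n)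
    (delta : R) (f : 'rV[R]_n -> R) (x : 'rV[R]_n) : \bar R :=
  ereal_inf [set (enorm g)%:E | g in goldstein_subdiff M delta f x].

Definition second_ff_bounded (R : realType) (n : nat) (M : set 'rV[R]_n)
    (C : R) : Prop :=
  forall x xi eta b, M x -> tangent M x xi -> tangent M x eta ->
    enorm xi = 1 -> enorm eta = 1 -> second_ff M x xi eta b -> enorm b <= C.

Definition is_retraction (R : realType) (n : nat) (M : set 'rV[R]_n)
    (Retr : 'rV[R]_n -> 'rV[R]_n -> 'rV[R]_n) : Prop :=
  [/\ smooth_on (tangent_bundle M) (fun p => Retr p.1 p.2),
      forall x xi, M x -> tangent M x xi -> M (Retr x xi),
      forall x, M x -> Retr x 0 = x
    & forall x xi, M x -> tangent M x xi ->
        derive1 (fun t : R => Retr x (t *: xi)) 0 = xi].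

Definition retraction_bounded (R : realType) (n : nat) (M : set 'rV[R]_n)
    (Retr : 'rV[R]_n -> 'rV[R]_n -> 'rV[R]_n) (C' : R) : Prop :=
  forall x xi (t : R), M x -> tangent M x xi ->
    enorm (derive1 (fun r : R => Retr x (r *: xi)) t) <= enorm xi /\
    enorm (derive1n 2 (fun r : R => Retr x (r *: xi)) t) <= C' * enorm xi ^+ 2.

Definition objective (R : realType) (n : nat) (dV : measure_display)
    (V : measurableType dV) (mu : probability V R) (F : 'rV[R]_n -> V -> R)
    (x : 'rV[R]_n) : R :=
  \int[mu]_v F x v.

Definition sgrad (R : realType) (n : nat) (M : set 'rV[R]_n) (V : Type)
    (F : 'rV[R]_n -> V -> R) (x : 'rV[R]_n) (v : V) : 'rV[R]_n :=
  rgrad M (fun y => F y v) x.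

(* The distance is only compared when it is finite, since 0 * +oo = 0. *)
Definition lipschitz_assumption (R : realType) (n : nat) (dV : measure_display)
    (V : measurableType dV) (mu : probability V R) (M : set 'rV[R]_n)
    (F : 'rV[R]_n -> V -> R) (L : R) : Prop :=
  exists Lnu : V -> R,
    [/\ measurable_fun setT Lnu,
        forall v x y, M x -> M y -> gdist M x y \is a fin_num ->
          `|F x v - F y v| <= Lnu v * fine (gdist M x y)
      & (\int[mu]_v (Lnu v ^+ 2)%:E <= (L ^+ 2)%:E)%E].

(* For each x, the gradient of F(., v) at x is required to exist for almost
   every v only.  Measurability of the oracle is joint in (x, v), with respect
   to the Borel sigma-algebra of R^n. *)
Definition oracle_assumption (R : realType) (n : nat) (dV : measure_display)
    (V : measurableType dV) (mu : probability V R) (M : set 'rV[R]_n)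
    (F : 'rV[R]_n -> V -> R) (G sigma : R) : Prop :=
  (forall i : 'I_n, measurable_fun
     (M `*` setT : set (g_sigma_algebraType (@open 'rV[R]_n) * V))
     (fun p => sgrad M F p.1 p.2 ord0 i)) /\
  forall x, M x ->
    [/\ {ae mu, forall v, rdifferentiable M (fun y => F y v) x},
        rdifferentiable M (objective mu F) x,
        forall i : 'I_n, (\int[mu]_v (sgrad M F x v ord0 i)%:E
                          = (rgrad M (objective mu F) x ord0 i)%:E)%E,
        (\int[mu]_v (enorm (sgrad M F x v) ^+ 2)%:E <= (G ^+ 2)%:E)%E
      & (\int[mu]_v
           (enorm (sgrad M F x v - rgrad M (objective mu F) x) ^+ 2)%:E
         <= (sigma ^+ 2)%:E)%E].

Definition clip (R : realType) (n : nat) (M : set 'rV[R]_n) (D : R)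
    (x v : 'rV[R]_n) : 'rV[R]_n :=
  nearest [set u | tangent M x u /\ enorm u <= D] v.

Definition query (R : realType) (n : nat)
    (Retr : 'rV[R]_n -> 'rV[R]_n -> 'rV[R]_n) (st : 'rV[R]_n * 'rV[R]_n)
    (s : R) : 'rV[R]_n :=
  Retr st.1 (s *: st.2).

(* The pair (x_{k,t}, Delta_{k,t}) of an epoch started at x0 and using the
   draws s and nu. *)
Fixpoint epoch_state (R : realType) (n : nat) (V : Type) (M : set 'rV[R]_n)
    (Retr : 'rV[R]_n -> 'rV[R]_n -> 'rV[R]_n) (F : 'rV[R]_n -> V -> R)
    (D eta : R) (x0 : 'rV[R]_n) (s : nat -> R) (nu : nat -> V) (t : nat) :
    'rV[R]_n * 'rV[R]_n :=
  if t is t'.+1 then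
    let st := epoch_state M Retr F D eta x0 s nu t' in
    let x := Retr st.1 st.2 in
    let g := sgrad M F (query Retr st (s t')) (nu t') in
    (x, clip M D x (oproj (tangent M x) (st.2 - eta *: g)))
  else (x0, 0).

(* Epochs are numbered from 0: epoch k here is epoch k+1 of the usual
   description, and [epoch_start k] is both its initial point and the last
   point x_{k,T} of the preceding epoch. *)
Fixpoint epoch_start (R : realType) (n : nat) (V : Type) (M : set 'rV[R]_n)
    (Retr : 'rV[R]_n -> 'rV[R]_n -> 'rV[R]_n) (F : 'rV[R]_n -> V -> R)
    (D eta : R) (T : nat) (x0 : 'rV[R]_n) (s : nat -> nat -> R)
    (nu : nat -> nat -> V) (k : nat) : 'rV[R]_n :=
  if k is k'.+1 then
    (epoch_state M Retr F D eta
       (epoch_start M Retr F D eta T x0 s nu k') (s k') (nu k') T).1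
  else x0.

Definition epoch_output (R : realType) (n : nat) (V : Type) (M : set 'rV[R]_n)
    (Retr : 'rV[R]_n -> 'rV[R]_n -> 'rV[R]_n) (F : 'rV[R]_n -> V -> R)
    (D eta : R) (T : nat) (x0 : 'rV[R]_n) (s : nat -> nat -> R)
    (nu : nat -> nat -> V) (k : nat) : 'rV[R]_n :=
  query Retr
    (epoch_state M Retr F D eta (epoch_start M Retr F D eta T x0 s nu k)
       (s k) (nu k) T./2)
    (s k T./2).

Definition mutually_independent (R : realType) (dO : measure_display)
    (Omega : measurableType dO) (P : probability Omega R) (I : finType)
    (E : I -> set (set Omega)) : Prop :=
  forall (S : {set I}) (A : I -> set Omega),
    (forall i, i \in S -> E i (A i)) ->
    (P (\bigcap_(i in [set` S]) A i) = \prod_(i in S) P (A i))%E.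

(* The sigma-algebras generated by the draws s_{k,t}, nu_{k,t} and by the
   index J of the output. *)
Definition draw_sigma (R : realType) (dO dV : measure_display)
    (Omega : measurableType dO) (V : measurableType dV) (K T : nat)
    (s : nat -> nat -> Omega -> R) (nu : nat -> nat -> Omega -> V)
    (J : Omega -> nat) (i : ('I_K * 'I_T) + ('I_K * 'I_T) + unit) :
    set (set Omega) :=
  match i with
  | inl (inl (k, t)) => preimage_set_system setT (s k t) measurable
  | inl (inr (k, t)) => preimage_set_system setT (nu k t) measurable
  | inr _ => preimage_set_system setT J measurable
  end.

Definition algorithm_randomness (R : realType) (dO dV : measure_display)
    (Omega : measurableType dO) (P : probability Omega R)
    (V : measurableType dV) (mu : probability V R) (K T : nat)
    (s : nat -> nat -> {RV P >-> R}) (nu : nat -> nat -> {RV P >-> V})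
    (J : {RV P >-> nat}) : Prop :=
  [/\ forall k t, (k < K)%N -> (t < T)%N -> forall A, measurable A ->
        distribution P (s k t) A = uniform_prob (@ltr01 R) A,
      forall k t, (k < K)%N -> (t < T)%N -> forall A, measurable A ->
        distribution P (nu k t) A = mu A,
      forall k, (k < K)%N -> P (J @^-1` [set k]) = (K%:R^-1)%:E
    & mutually_independent P
        (@draw_sigma R dO dV Omega V K T (fun k t => s k t)
           (fun k t => nu k t) J)].

(* Main.v *)
(* Write [P_x] for the orthogonal projection onto the tangent space at [x].
   Tangent spaces are kernels of differentials of local equations, so [P] is
   smooth along [M], and the bound on the second fundamental form says that the
   derivative of [P] in a direction [xi] is bounded by [C |xi|] (the cruder
   bound [kappa = (n - d) C] is the one that enters the rate).  Hence:

   - parallel transport, which solves the linear equation [V' = P' V], moves a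
     vector [v] of R^n by at most [C |v|] times the length of the geodesic;
     comparing all gradients of an epoch in R^n rather than in one tangent space
     therefore costs [delta L C];
   - online gradient descent, projected on the moving tangent spaces and compared
     with [P_x u] for a fixed vector [u] of R^n, has the usual regret up to errors
     controlled by [kappa];
   - the objective decreases along a retraction curve by the integral of
     [<grad f, gamma'>], where [gamma'] is [C' |Delta|^2]-close to the step
     [Delta]; as the query point is uniform on that curve, the integral is the
     expectation of [<grad f(w), Delta>].

   Taking [u = - D S / |S|], where [S] is the sum of the gradients of an epoch,
   turns regret and descent into a bound on the expectation of [|S|].  The noise
   contributes [sigma sqrt T] because its increments are orthogonal in L^2: each
   draw is independent of the sigma-algebra of the preceding ones, so Tonelli's
   theorem integrates it out first. *)
Require Import Defs.
From HB Require Import structures.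
From mathcomp Require Import all_boot all_order all_algebra.
From mathcomp Require Import all_classical all_reals all_analysis.
From mathcomp Require Import measurable_realfun zify ring lra.

Set Implicit Arguments.
Unset Strict Implicit.
Unset Printing Implicit Defensive.
Import Order.TTheory GRing.Theory Num.Theory.
Import numFieldNormedType.Exports.

Local Open Scope classical_set_scope.
Local Open Scope ring_scope.

(** * Euclidean projections *)

(** Three obstacles shape the proof. The gradient of the objective exists everywhere on [M] but may
    be discontinuous: the fundamental theorem of calculus along a retraction curve therefore rests
    on dominated convergence, and measurability of the gradient on Fubini, since it is the mean of
    the oracle. The comparator [u] depends on the noise of the whole epoch, so conditioning on it is
    impossible: the regret inequality is proved path by path, and the noise enters only through the
    norm of its sum. The Goldstein norm is never shown measurable: it is bounded almost surely by a
    measurable function, and integrals of nonnegative functions, being suprema over simple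
    functions, are monotone in any case. All powers in the rate come from one number
    [c = (delta N)^(1/3)]. The choice of [T] gives [c^2 = T], and then [N = K T] gives
    [delta K = c], so the last inequality is rational in [c]. *)

Section euclid.
Context {R : realType} {n : nat}.
Implicit Types u v w : 'rV[R]_n.

Lemma dotpC u v : dotp u v = dotp v u.
Proof. by apply: eq_bigr => i _; rewrite mulrC. Qed.

Lemma dotpDl u v w : dotp (u + v) w = dotp u w + dotp v w.
Proof. by rewrite -big_split/=; apply: eq_bigr => i _; rewrite mxE mulrDl. Qed.

Lemma dotpZl a u v : dotp (a *: u) v = a * dotp u v.
Proof. by rewrite mulr_sumr; apply: eq_bigr => i _; rewrite mxE mulrA. Qed.

Lemma dotpDr u v w : dotp u (v + w) = dotp u v + dotp u w.
Proof. by rewrite dotpC dotpDl !(dotpC u). Qed.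

Lemma dotpZr a u v : dotp u (a *: v) = a * dotp u v.
Proof. by rewrite dotpC dotpZl dotpC. Qed.

Lemma dotpNl u v : dotp (- u) v = - dotp u v.
Proof. by rewrite -scaleN1r dotpZl mulN1r. Qed.

Lemma dotpNr u v : dotp u (- v) = - dotp u v.
Proof. by rewrite dotpC dotpNl dotpC. Qed.

Lemma dotpBl u v w : dotp (u - v) w = dotp u w - dotp v w.
Proof. by rewrite dotpDl dotpNl. Qed.

Lemma dotpBr u v w : dotp u (v - w) = dotp u v - dotp u w.
Proof. by rewrite dotpDr dotpNr. Qed.

Lemma dotp0l u : dotp 0 u = 0.
Proof. by rewrite -(scale0r 0) dotpZl mul0r. Qed.

Lemma dotp0r u : dotp u 0 = 0.
Proof. by rewrite dotpC dotp0l. Qed.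

Lemma dotp_suml (I : Type) (r : seq I) (Q : pred I) (f : I -> 'rV[R]_n) v :
  dotp (\sum_(i <- r | Q i) f i) v = \sum_(i <- r | Q i) dotp (f i) v.
Proof.
by elim/big_rec2 : _ => [|i x y _ <-]; rewrite ?dotp0l// dotpDl.
Qed.

Lemma dotp_ge0 u : 0 <= dotp u u.
Proof. by apply: sumr_ge0 => i _; rewrite -expr2 sqr_ge0. Qed.

Lemma dotp_eq0 u : dotp u u = 0 -> u = 0.
Proof.
move=> u0; apply/rowP => i; rewrite mxE.
have /psumr_eq0P h : forall i : 'I_n, true -> 0 <= u ord0 i * u ord0 i.
  by move=> j _; rewrite -expr2 sqr_ge0.
by have /eqP := h u0 i isT; rewrite -expr2 sqrf_eq0 => /eqP.
Qed.

Lemma enorm_ge0 u : 0 <= enorm u.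
Proof. exact: sqrtr_ge0. Qed.
Hint Resolve enorm_ge0 : core.

Lemma enorm_sqr u : enorm u ^+ 2 = dotp u u.
Proof. by rewrite sqr_sqrtr// dotp_ge0. Qed.

Lemma enorm0 : enorm (0 : 'rV[R]_n) = 0.
Proof. by rewrite /enorm dotp0l sqrtr0. Qed.

Lemma enorm_eq0 u : enorm u = 0 -> u = 0.
Proof. by move=> u0; apply: dotp_eq0; rewrite -enorm_sqr u0 expr0n. Qed.

Lemma enormZ a u : enorm (a *: u) = `|a| * enorm u.
Proof.
by rewrite /enorm dotpZl dotpZr mulrA -expr2 sqrtrM ?sqr_ge0// sqrtr_sqr.
Qed.

Lemma enormN u : enorm (- u) = enorm u.
Proof. by rewrite -scaleN1r enormZ normrN1 mul1r. Qed.

Lemma enorm_le_sqr u a : 0 <= a -> dotp u u <= a ^+ 2 -> enorm u <= a.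
Proof.
by move=> a0 h; rewrite -(ger0_norm a0) -sqrtr_sqr ler_wsqrtr.
Qed.

Lemma dotp_le u v : dotp u v <= enorm u * enorm v.
Proof.
have [v0|v0] := eqVneq (enorm v) 0.
  by rewrite (enorm_eq0 v0) dotp0r enorm0 mulr0.
have [u0|u0] := eqVneq (enorm u) 0.
  by rewrite (enorm_eq0 u0) dotp0l enorm0 mul0r.
have vp : 0 < enorm v by rewrite lt_neqAle eq_sym v0/=.
have up : 0 < enorm u by rewrite lt_neqAle eq_sym u0/=.
have := dotp_ge0 (enorm v *: u - enorm u *: v).
rewrite !(dotpBl, dotpBr, dotpZl, dotpZr) -!enorm_sqr (dotpC v u).
set a := enorm u in up *; set b := enorm v in vp *; set c := dotp u v => h.
have : 0 <= 2 * (a * b) * (a * b - c) by nra.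
by rewrite pmulr_rge0 ?subr_ge0// mulr_gt0// mulr_gt0.
Qed.

Lemma normr_dotp u v : `|dotp u v| <= enorm u * enorm v.
Proof.
by rewrite ler_norml dotp_le andbT lerNl -dotpNl -(enormN u) dotp_le.
Qed.

Lemma enormD u v : enorm (u + v) <= enorm u + enorm v.
Proof.
apply: enorm_le_sqr; first exact: addr_ge0.
rewrite dotpDl !dotpDr (dotpC v u) sqrrD !enorm_sqr.
have := dotp_le u v; lra.
Qed.

Lemma enormB u v : enorm (u - v) <= enorm u + enorm v.
Proof. by rewrite -(enormN v) enormD. Qed.

Lemma enorm_sum (I : Type) (r : seq I) (Q : pred I) (f : I -> 'rV[R]_n) :
  enorm (\sum_(i <- r | Q i) f i) <= \sum_(i <- r | Q i) enorm (f i).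
Proof.
elim/big_rec2 : _ => [|i x y _ h]; first by rewrite enorm0.
by rewrite (le_trans (enormD _ _))// lerD2l.
Qed.

Lemma normr_coord u i : `|u ord0 i| <= `|u|.
Proof.
rewrite [in leRHS]/Num.Def.normr/= mx_normrE.
by apply: (le_trans _ (le_bigmax _ _ (ord0, i))).
Qed.

Lemma normr_coord_enorm u i : `|u ord0 i| <= enorm u.
Proof.
rewrite -sqrtr_sqr ler_wsqrtr// expr2 /dotp (bigD1 i)//= lerDl.
by apply: sumr_ge0 => j _; rewrite -expr2 sqr_ge0.
Qed.

Lemma normr_rV u e : 0 <= e -> (forall i, `|u ord0 i| <= e) -> `|u| <= e.
Proof.
move=> e0 ue; rewrite [in leLHS]/Num.Def.normr/= mx_normrE.
by apply: bigmax_le => // -[i j] _/=; rewrite (ord1 i).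
Qed.

Lemma enorm_le_normr u : enorm u <= n%:R * `|u|.
Proof.
apply: enorm_le_sqr; first by rewrite mulr_ge0.
apply: (@le_trans _ _ (\sum_(i < n) `|u| ^+ 2)).
  apply: ler_sum => i _; rewrite -expr2 -real_normK ?num_real//.
  by rewrite lerXn2r ?nnegrE// normr_coord.
rewrite sumr_const card_ord exprMn -[leLHS]mulr_natl; apply: ler_wpM2r.
  exact: sqr_ge0.
have le_sq k : (k <= k ^ 2)%N by case: k => // k; rewrite expnS expn1 leq_pmulr.
by rewrite -natrX ler_nat.
Qed.

End euclid.
#[global] Hint Extern 0 (is_true (0 <= enorm _)) => solve [apply: enorm_ge0] : core.

Section projection.
Context {R : realType} {n : nat}.
Implicit Types (S : set 'rV[R]_n) (u v w p q : 'rV[R]_n).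

Definition linear_subspace S :=
  S 0 /\ forall a u v, S u -> S v -> S (a *: u + v).

(** Existence of an orthogonal projection is part of the notion: tangent spaces get theirs from the
    explicit matrix [kerproj]. *)
Definition projectable S := linear_subspace S /\
  forall v, exists2 p, S p & forall q, S q -> dotp (v - p) q = 0.

Section with_subspace.
Variable S : set 'rV[R]_n.
Hypothesis hS : projectable S.

Lemma linsub0 : S 0. Proof. by case: hS => -[]. Qed.

Lemma linsubZ a u : S u -> S (a *: u).
Proof.
by case: hS => -[S0 h] _ Su; have := h a u 0 Su S0; rewrite addr0.
Qed.

Lemma linsubD u v : S u -> S v -> S (u + v).
Proof. by case: hS => -[S0 h] _ Su Sv; have := h 1 u v Su Sv; rewrite scale1r. Qed.

Lemma linsubN u : S u -> S (- u).
Proof. by move=> Su; rewrite -scaleN1r; exact: linsubZ. Qed.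

Lemma linsubB u v : S u -> S v -> S (u - v).
Proof. by move=> Su Sv; apply: linsubD => //; exact: linsubN. Qed.

Lemma oprojP v : S (oproj S v) /\ forall q, S q -> dotp (v - oproj S v) q = 0.
Proof.
case: hS => _ /(_ v)[p Sp hp]; rewrite /oproj; case: xgetP => [x _ //|/(_ p)].
by case.
Qed.

Lemma oprojS v : S (oproj S v). Proof. by case: (oprojP v). Qed.
Hint Resolve oprojS : core.

Lemma oproj_perp v q : S q -> dotp (v - oproj S v) q = 0.
Proof. by case: (oprojP v) => _; exact. Qed.

Lemma dotp_oprojl v q : S q -> dotp (oproj S v) q = dotp v q.
Proof. by move=> /(oproj_perp v)/eqP; rewrite dotpBl subr_eq0 => /eqP. Qed.

Lemma oproj_uniq v p :
  S p -> (forall q, S q -> dotp (v - p) q = 0) -> oproj S v = p.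
Proof.
move=> Sp hp; apply/eqP; rewrite -subr_eq0; apply/eqP/dotp_eq0.
have Spp : S (oproj S v - p) by exact: linsubB.
have {1}-> : oproj S v - p = (v - p) - (v - oproj S v).
  by apply/rowP => i; rewrite !mxE; ring.
by rewrite dotpBl hp// oproj_perp// subrr.
Qed.

Lemma oproj_id v : S v -> oproj S v = v.
Proof. by move=> Sv; apply: oproj_uniq => // q _; rewrite subrr dotp0l. Qed.

Lemma oprojD u v : oproj S (u + v) = oproj S u + oproj S v.
Proof.
apply: oproj_uniq; first exact: linsubD.
by move=> q Sq; rewrite opprD addrACA dotpDl !oproj_perp// addr0.
Qed.

Lemma oprojZ a u : oproj S (a *: u) = a *: oproj S u.
Proof.
apply: oproj_uniq; first exact: linsubZ.
by move=> q Sq; rewrite -scalerBr dotpZl !oproj_perp// mulr0.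
Qed.

Lemma oprojN u : oproj S (- u) = - oproj S u.
Proof. by rewrite -scaleN1r oprojZ scaleN1r. Qed.

Lemma oprojB u v : oproj S (u - v) = oproj S u - oproj S v.
Proof. by rewrite oprojD oprojN. Qed.

Lemma oproj_sum (I : Type) (r : seq I) (Q : pred I) (f : I -> 'rV[R]_n) :
  oproj S (\sum_(i <- r | Q i) f i) = \sum_(i <- r | Q i) oproj S (f i).
Proof.
elim/big_rec2 : _ => [|i x y _ <-]; last by rewrite oprojD.
by apply: oproj_id; exact: linsub0.
Qed.

Lemma oproj_sym u v : dotp (oproj S u) v = dotp u (oproj S v).
Proof.
rewrite -[RHS](dotp_oprojl u (oprojS v)) dotpC.
by rewrite -(dotp_oprojl v (oprojS u)); exact: dotpC.
Qed.

Lemma oproj_pythagoras v :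
  dotp v v = dotp (oproj S v) (oproj S v)
             + dotp (v - oproj S v) (v - oproj S v).
Proof.
have := @oproj_perp v (oproj S v) (oprojS v).
rewrite !(dotpBl, dotpBr) (dotpC (oproj S v) v); lra.
Qed.

Lemma oproj_contr v : enorm (oproj S v) <= enorm v.
Proof.
apply: enorm_le_sqr => //; rewrite enorm_sqr [leRHS]oproj_pythagoras lerDl.
exact: dotp_ge0.
Qed.

Lemma oproj_contrC v : enorm (v - oproj S v) <= enorm v.
Proof.
apply: enorm_le_sqr => //; rewrite enorm_sqr [leRHS]oproj_pythagoras lerDr.
exact: dotp_ge0.
Qed.

(* Cauchy-Schwarz in R^2, applied to the pairs of component norms. *)
Lemma oproj_mixed_le u v :
  enorm (u - oproj S u) * enorm (oproj S v) + enorm (oproj S u)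
    * enorm (v - oproj S v) <= enorm u * enorm v.
Proof.
have hu := oproj_pythagoras u; have hv := oproj_pythagoras v.
rewrite -!enorm_sqr in hu hv.
set a := enorm (oproj S u) in hu *; set b := enorm (u - oproj S u) in hu *.
set c := enorm (oproj S v) in hv *; set e := enorm (v - oproj S v) in hv *.
have [a0 b0 c0 e0] : [/\ 0 <= a, 0 <= b, 0 <= c & 0 <= e]
  by split; exact: enorm_ge0.
rewrite -(@ler_pXn2r _ 2)// ?nnegrE ?addr_ge0 ?mulr_ge0 ?enorm_ge0//.
rewrite exprMn hu hv; have := sqr_ge0 (a * c - b * e); nra.
Qed.

End with_subspace.

Section nearest_ball.
Variables (S : set 'rV[R]_n) (D : R).
Hypotheses (hS : projectable S) (D0 : 0 <= D).

(** Outside the ball the triangle inequality makes the radial rescaling a minimizer; since [nearest]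
    returns an arbitrary minimizer, uniqueness is shown as well. *)
Lemma nearest_ballE v : S v -> nearest [set u | S u /\ enorm u <= D] v =
  (if enorm v <= D then 1 else D / enorm v) *: v.
Proof.
move=> Sv; case: ifPn => [vD|]; last rewrite -ltNge => Dv.
  rewrite scale1r /nearest; case: xgetP => [p _ [_ hp]|/(_ v)]; last first.
    by case; split => // q _; rewrite subrr enorm0.
  have := hp v (conj Sv vD); rewrite subrr enorm0 => vp.
  apply/esym/eqP; rewrite -subr_eq0; apply/eqP/enorm_eq0.
  by apply/eqP; rewrite eq_le vp/=.
have v0 : 0 < enorm v by exact: le_lt_trans Dv.
set q0 := (D / enorm v) *: v.
have Sq0 : S q0 by exact: linsubZ.
have q0D : enorm q0 <= D.
  by rewrite enormZ ger0_norm ?divr_ge0// divfK// gt_eqF.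
have vq0 : enorm (v - q0) = enorm v - D.
  have -> : v - q0 = (1 - D / enorm v) *: v by rewrite scalerBl scale1r.
  rewrite enormZ ger0_norm; first by rewrite mulrBl mul1r divfK// gt_eqF.
  by rewrite subr_ge0 ler_pdivrMr// mul1r ltW.
have near q : enorm q <= D -> enorm (v - q0) <= enorm (v - q).
  move=> qD; rewrite vq0 lerBlDr.
  apply: (@le_trans _ _ (enorm (v - q) + enorm q)); last by rewrite lerD2l.
  by rewrite -{1}(subrK q v) enormD.
rewrite /nearest; case: xgetP => [p _ [[Sp pD] hp]|/(_ q0)]; last first.
  by case; split => // q []; exact: (fun _ => @near q).
have := hp q0 (conj Sq0 q0D); rewrite vq0 => h.
apply/eqP; rewrite -subr_eq0; apply/eqP/dotp_eq0; apply/eqP.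
rewrite eq_le dotp_ge0 andbT.
have {}h : dotp (v - p) (v - p) <= (enorm v - D) ^+ 2.
  by rewrite -enorm_sqr lerXn2r ?nnegrE// subr_ge0 ltW.
have pD2 : enorm p ^+ 2 <= D ^+ 2 by rewrite lerXn2r ?nnegrE.
(* With [a = |v|], [c = <v, p>] and [e = |p|^2], minimality of [p] gives [2 c >= e + 2 D a - D^2].
   Inserted into [E1], this bounds [|p - q0|^2] by [(1 - D / a) (e - D^2)], which is nonpositive. *)
have E1 : dotp (p - q0) (p - q0) =
    enorm p ^+ 2 + D ^+ 2 - (D / enorm v) * (2 * dotp v p).
  rewrite /q0 !(dotpBl, dotpBr, dotpZl, dotpZr) -!enorm_sqr (dotpC p v).
  by field; rewrite gt_eqF.
have E2 : dotp (v - p) (v - p) = enorm v ^+ 2 - 2 * dotp v p + enorm p ^+ 2.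
  by rewrite !(dotpBl, dotpBr) -!enorm_sqr (dotpC p v); ring.
rewrite E1; rewrite E2 in h.
set a := enorm v in h v0 Dv vq0 *; set c := dotp v p in h *.
set e := enorm p ^+ 2 in h pD2 *.
have : (D / a) * (e + 2 * D * a - D ^+ 2) <= (D / a) * (2 * c).
  by apply: ler_wpM2l; [rewrite divr_ge0// ltW|nra].
have : 0 <= (1 - D / a) * (D ^+ 2 - e).
  by rewrite mulr_ge0 ?subr_ge0// ler_pdivrMr// mul1r ltW.
have -> : D / a * (e + 2 * D * a - D ^+ 2) = D / a * (e - D ^+ 2) + 2 * D ^+ 2.
  by field; rewrite gt_eqF.
lra.
Qed.

Lemma nearest_ball_in v : S v -> S (nearest [set u | S u /\ enorm u <= D] v) /\
  enorm (nearest [set u | S u /\ enorm u <= D] v) <= D.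
Proof.
move=> Sv; rewrite nearest_ballE//; split; first exact: linsubZ.
case: ifPn => [vD|]; first by rewrite scale1r.
rewrite -ltNge => Dv; have v0 : 0 < enorm v by exact: le_lt_trans Dv.
by rewrite enormZ ger0_norm ?divr_ge0// divfK// gt_eqF.
Qed.

(** The point [u] may lie outside [S], because clipping is radial: [|v - u|^2 - |r v - u|^2 = (1 -
    r) ((1 + r) |v|^2 - 2 <v, u>)], and as [r |v| = D] the last factor is at least
    [|v| (|v| - D)]. *)
Lemma nearest_ball_nonexpansive v u : S v -> enorm u <= D ->
  enorm (nearest [set u | S u /\ enorm u <= D] v - u) <= enorm (v - u).
Proof.
move=> Sv uD; rewrite nearest_ballE//.
case: ifPn => [_|]; first by rewrite scale1r.
rewrite -ltNge => Dv; have v0 : 0 < enorm v by exact: le_lt_trans Dv.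
apply: enorm_le_sqr => //; rewrite enorm_sqr -subr_ge0.
set r := D / enorm v.
have ra : r * enorm v = D by rewrite divfK// gt_eqF.
have r1 : r <= 1 by rewrite ler_pdivrMr// mul1r ltW.
rewrite !(dotpBl, dotpBr, dotpZl, dotpZr) -!enorm_sqr (dotpC u v).
have vu : dotp v u <= enorm v * D.
  by rewrite (le_trans (dotp_le _ _))// ler_wpM2l.
set a := enorm v in v0 Dv ra vu *.
have r0 : 0 <= r by rewrite divr_ge0.
have : 0 <= (1 - r) * ((1 + r) * a ^+ 2 - 2 * dotp v u).
  rewrite mulr_ge0 ?subr_ge0//.
  have : 0 <= a * (a - D) by rewrite mulr_ge0 ?ltW ?subr_gt0.
  have -> : (1 + r) * a ^+ 2 = a ^+ 2 + (r * a) * a by ring.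
  rewrite ra; nra.
nra.
Qed.

End nearest_ball.
End projection.

(** * Smooth functions *)

(** [g] is [f] plus a function that vanishes near [a] and so has zero differential there. *)
Lemma near_eq_differentiable (R : realType) (V W : normedModType R)
    (f g : V -> W) (a : V) :
  {near a, f =1 g} -> differentiable f a -> differentiable g a.
Proof.
move=> fg df; rewrite -(subrK f g); apply: differentiableD => //.
pose e := g - f; rewrite -/e.
have e0 : \forall x \near a, e x = 0.
  by near=> x; rewrite -[LHS]/(g x - f x) (near fg x)// subrr.
have ea : e a = 0 by exact: (nbhs_singleton e0).
have sh : (fun y : V => y + a) @ (0 : V) --> a.
  by rewrite -[X in _ --> X]add0r; apply: cvgD; [exact: cvg_id|exact: cvg_cst].
have h : continuous (\0 : V -> W) /\ e \o shift a = cst (e a) + \0 +o_ (0 : V) id.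
  split; first exact: cst_continuous.
  apply/eqaddoP => _/posnumP[eps]; near=> x.
  have -> : (e \o shift a - (cst (e a) + \0)) x = e (x + a).
    by rewrite -[LHS]/(e (x + a) - (e a + 0)) ea addr0 subr0.
  suff -> : e (x + a) = 0 by rewrite normr0 mulr_ge0.
  by near: x; exact: sh _ e0.
have E : 'd e a = 0 :> (V -> W) by apply/diff_unique; case: h.
by apply/diff_locallyP; rewrite E; case: h.
Unshelve. all: by end_near. Qed.

Section Ck_theory.
Context {R : realType} {V : normedModType R}.
Implicit Types (U : set V) (k : nat).

Lemma Ck_sub (W : normedModType R) k U U' (f : V -> W) :
  U' `<=` U -> Ck k U f -> Ck k U' f.
Proof.
move=> sU; elim: k f => [|k IH] f /=; first by move=> h x /sU; exact: h.
by move=> [h1 h2]; split=> [x /sU|v]; [exact: h1|exact/IH/h2].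
Qed.

Lemma eq_Ck (W : normedModType R) k U (f g : V -> W) : open U ->
  (forall x, U x -> f x = g x) -> Ck k U f -> Ck k U g.
Proof.
move=> oU; elim: k f g => [|k IH] f g fg /=.
  move=> h x Ux; have nU : \forall y \near x, f y = g y.
    by apply: filterS (open_nbhs_nbhs (conj oU Ux)) => y; exact: fg.
  have := h x Ux; rewrite /prop_for /continuous_at (fg x Ux).
  by apply: cvg_trans; apply: near_eq_cvg.
move=> [h1 h2]; split=> [x Ux|v].
  apply: near_eq_differentiable (h1 x Ux).
  by apply: filterS (open_nbhs_nbhs (conj oU Ux)) => y; exact: fg.
apply: IH (h2 v) => x Ux; apply: near_eq_derive.
by apply: filterS (open_nbhs_nbhs (conj oU Ux)) => y; exact: fg.
Qed.

Lemma CkS (W : normedModType R) k U (f : V -> W) : Ck k.+1 U f -> Ck k U f.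
Proof.
elim: k f => [|k IH] f; last by move=> [h1 h2]; split=> // v; exact/IH/h2.
by move=> [h1 _] x /h1; exact: differentiable_continuous.
Qed.

Lemma Ck_cst (W : normedModType R) k U (a : W) : Ck k U (fun _ => a).
Proof.
elim: k a => [|k IH] a /=; first by move=> x _; exact: cst_continuous.
split=> [x _|v]; first exact: differentiable_cst.
suff -> : 'D_v (cst a : V -> W) = cst 0 by exact: IH.
by apply/funext => x; exact: derive_cst.
Qed.

Lemma CkD (W : normedModType R) k U (f g : V -> W) : open U ->
  Ck k U f -> Ck k U g -> Ck k U (fun x => f x + g x).
Proof.
move=> oU; elim: k f g => [|k IH] f g /=.
  by move=> hf hg x Ux; apply: cvgD; [exact: hf|exact: hg].
move=> [f1 f2] [g1 g2]; split=> [x Ux|v].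
  by apply: (@differentiableD _ _ _ f g); [exact: f1|exact: g1].
apply: eq_Ck (IH _ _ (f2 v) (g2 v)) => // x Ux.
by apply/esym/(@deriveD _ _ _ f g); apply: diff_derivable; [exact: f1|exact: g1].
Qed.

Lemma Ck_sum (W : normedModType R) k U (I : Type) (r : seq I) (Q : pred I)
    (f : I -> V -> W) : open U ->
  (forall i, Ck k U (f i)) -> Ck k U (fun x => \sum_(i <- r | Q i) f i x).
Proof.
move=> oU hf; elim: r => [|i r IH].
  apply: eq_Ck (@Ck_cst _ k U 0) => // x _; by rewrite big_nil.
case Qi : (Q i); last by apply: eq_Ck IH => // x _; rewrite big_cons Qi.
by apply: eq_Ck (CkD oU (hf i) IH) => // x _; rewrite big_cons Qi.
Qed.

Lemma CkM k U (f g : V -> R) : open U ->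
  Ck k U f -> Ck k U g -> Ck k U (fun x => f x * g x).
Proof.
move=> oU; elim: k f g => [|k IH] f g.
  by move=> hf hg x Ux; apply: cvgM; [exact: hf|exact: hg].
move=> hf hg; have [[f1 f2] [g1 g2]] := (hf, hg); split=> [x Ux|v].
  by apply: (@differentiableM _ _ f g); [exact: f1|exact: g1].
apply: (@eq_Ck _ k U (fun x => f x * 'D_v g x + g x * 'D_v f x)) => //.
  move=> x Ux; apply/esym/(@deriveM _ _ f g); apply: diff_derivable.
    exact: f1.
  exact: g1.
have [hf' hg'] := (CkS hf, CkS hg).
by apply: CkD => //; apply: IH => //; [exact: g2|exact: f2].
Qed.

Lemma Ck_prod k U (I : Type) (r : seq I) (f : I -> V -> R) : open U ->
  (forall i, Ck k U (f i)) -> Ck k U (fun x => \prod_(i <- r) f i x).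
Proof.
move=> oU hf; elim: r => [|i r IH].
  apply: (@eq_Ck _ k U (cst (1 : R))) => //; last exact: Ck_cst.
  by move=> x _; rewrite big_nil.
by apply: eq_Ck (CkM oU (hf i) IH) => // x _; rewrite big_cons.
Qed.

Lemma CkV k U (f : V -> R) : open U -> (forall x, U x -> f x != 0) ->
  Ck k U f -> Ck k U (fun x => (f x)^-1).
Proof.
move=> oU f0; elim: k f f0 => [|k IH] f f0.
  by move=> hf x Ux; apply: cvgV; [exact: f0|exact: hf].
move=> hf; have [f1 f2] := hf; split=> [x Ux|v].
  by apply: differentiableV; [exact: f1|exact: f0].
apply: (@eq_Ck _ k U (fun x => -1 * (((f x)^-1 * (f x)^-1) * 'D_v f x))) => //.
  move=> x Ux; rewrite deriveV ?f0//; last exact/diff_derivable/f1.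
  by rewrite -[RHS]/(_ * _) mulN1r mulNr expr2 invfM.
have hV := IH f f0 (CkS hf).
apply: (CkM oU (@Ck_cst _ k U (-1 : R))); apply: (CkM oU (CkM oU hV hV)); exact: f2.
Qed.

Lemma Ck_rowP k n U (f : V -> 'rV[R]_n) : open U ->
  Ck k U f <-> forall i, Ck k U (fun x => f x ord0 i).
Proof.
move=> oU; elim: k f => [|k IH] f; split.
- move=> hf i x Ux; apply: (@cvg_comp _ _ _ f (fun y : 'rV[R]_n => y ord0 i)).
    exact: hf.
  exact: coord_continuous.
- move=> hf x Ux; apply/cvgrPdist_le => e e0.
  near=> y; apply: normr_rV; first exact: ltW.
  move=> i; rewrite !mxE; move: i; near: y; apply: filter_forall => i.
  by move/cvgrPdist_le : (hf i x Ux); exact.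
- move=> [f1 f2] i; split=> [x Ux|v].
    apply: (@differentiable_comp _ _ _ _ f (fun y : 'rV[R]_n => y ord0 i)).
      exact: f1.
    exact: differentiable_coord.
  have /IH/(_ i) := f2 v; apply: eq_Ck => // x Ux.
  by rewrite derive_mx ?mxE//; exact/diff_derivable/f1.
- move=> hf; have df x : U x -> differentiable f x.
    move=> Ux; have -> : f = \sum_(i < n) (fun x => f x ord0 i *: delta_mx 0 i).
      by apply/funext => y; rewrite {1}(row_sum_delta (f y)) fct_sumE.
    by apply: differentiable_sum => i; apply: differentiableZl; case: (hf i) => + _; exact.
  split=> // v; apply/IH => i; have [_ /(_ v)] := hf i.
  apply: eq_Ck => // x Ux; by rewrite derive_mx ?mxE//; exact/diff_derivable/df.
Unshelve. all: by end_near. Qed.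

End Ck_theory.

Section smooth_matrix.
Context {R : realType} {V : normedModType R}.
Implicit Types (U : set V).

Definition smooth_mx p q U (A : V -> 'M[R]_(p, q)) :=
  forall i j k, Ck k U (fun x => A x i j).

Variable U : set V.
Hypothesis oU : open U.

Lemma smooth_mxM p q r (A : V -> 'M[R]_(p, q)) (B : V -> 'M[R]_(q, r)) :
  smooth_mx U A -> smooth_mx U B -> smooth_mx U (fun x => A x *m B x).
Proof.
move=> hA hB i j k.
apply: (@eq_Ck _ _ _ _ _ (fun x => \sum_l A x i l * B x l j)) => //.
  by move=> x _; rewrite mxE.
by apply: Ck_sum => // l; exact: CkM.
Qed.

Lemma smooth_mxT p q (A : V -> 'M[R]_(p, q)) :
  smooth_mx U A -> smooth_mx U (fun x => (A x)^T).
Proof. by move=> hA i j k; apply: eq_Ck (hA j i k) => // x _; rewrite mxE. Qed.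

Lemma smooth_mxB p q (A B : V -> 'M[R]_(p, q)) :
  smooth_mx U A -> smooth_mx U B -> smooth_mx U (fun x => A x - B x).
Proof.
move=> hA hB i j k.
apply: (@eq_Ck _ _ _ _ _ (fun x => A x i j + -1 * B x i j)) => //.
  by move=> x _; rewrite !mxE mulN1r.
by apply: CkD => //; apply: CkM => //; exact: Ck_cst.
Qed.

Lemma Ck_det p (A : V -> 'M[R]_p) k :
  smooth_mx U A -> Ck k U (fun x => \det (A x)).
Proof.
move=> hA; apply: Ck_sum => // s; apply: CkM => //.
  exact: Ck_cst.
by apply: Ck_prod => // i; exact: hA.
Qed.

(** Cramer's rule: each entry is a cofactor divided by the determinant, and both are polynomials in
    the entries of [A x]. *)
Lemma smooth_invmx p (A : V -> 'M[R]_p) :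
  (forall x, U x -> A x \in unitmx) -> smooth_mx U A ->
  smooth_mx U (fun x => invmx (A x)).
Proof.
move=> uA hA i j k.
apply: (@eq_Ck _ _ _ _ _ (fun x => (\det (A x))^-1 *
   ((-1) ^+ (j + i) * \det (row' j (col' i (A x)))))) => //.
  by move=> x Ux; rewrite /invmx uA// !mxE.
apply: CkM => //.
  apply: CkV => //; last exact: Ck_det.
  by move=> x /uA; rewrite unitmxE unitfE.
apply: CkM => //; first exact: Ck_cst.
apply: Ck_det => i' j' k'.
by apply: eq_Ck (hA (lift j i') (lift i j') k') => // x _; rewrite !mxE.
Qed.

End smooth_matrix.

(** * Ordinary differential equations *)

Section primitive.
Context {R : realType}.
Implicit Types (f g : R -> R) (a b t : R).

Lemma is_derive_continuous (W : normedModType R) (f : R -> W) (df : W) t :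
  is_derive t 1 f df -> {for t, continuous f}.
Proof. by case=> /derivable1_diffP/differentiable_continuous. Qed.

Lemma MVT_closed f (df : R -> R) a b : a <= b ->
  (forall t, t \in `[a, b] -> is_derive t 1 f (df t)) ->
  exists2 c, c \in `[a, b] & f b - f a = df c * (b - a).
Proof.
move=> ab h; have h1 : forall t : R, t \in `]a, b[ -> is_derive t 1 f (df t).
  by move=> t tab; apply: h; exact: (subset_itv_oo_cc tab).
have H := @MVT_segment R f df a b ab h1.
refine (H _); apply: derivable_within_continuous => t tab.
by case: (h t tab).
Qed.

Lemma derive0_eq f a b : (forall t, t \in `]a, b[ -> is_derive t 1 f 0) ->
  forall x y, x \in `]a, b[ -> y \in `]a, b[ -> f x = f y.
Proof.
move=> h; suff H x y : x \in `]a, b[ -> y \in `]a, b[ -> x <= y -> f x = f y.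
  by move=> x y xab yab; case: (leP x y) => [|/ltW] xy; [exact: H|exact/esym/H].
rewrite !in_itv/= => /andP[ax xb] /andP[ay yb] xy.
have hxy t : t \in `[x, y] -> is_derive t 1 f 0.
  rewrite in_itv/= => /andP[xt ty]; apply: h.
  by rewrite in_itv/= (lt_le_trans ax xt) (le_lt_trans ty yb).
have [c _ /eqP] := @MVT_closed f (cst 0) x y xy hxy.
by rewrite mul0r subr_eq0 => /eqP.
Qed.

(** Primitives on the segments [[-m, m]], normalized at 0, agree where two of them are defined
    because their difference has zero derivative; [G t] uses an [m] that exceeds [|t|]. *)
Lemma antiderivative g : continuous g ->
  exists2 G : R -> R, G 0 = 0 & forall t, is_derive t 1 G (g t).
Proof.
move=> cg; pose I (m t : R) := \int[lebesgue_measure]_(r in `[- m, t]) g r.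
have intg (u v : R) : lebesgue_measure.-integrable `[u, v] (EFin \o g).
  apply: continuous_compact_integrable; first exact: segment_compact.
  exact: continuous_subspaceT.
pose G0 m t := I m t - I m 0.
have dG0 m t : t \in `]- m, m[ -> is_derive t 1 (G0 m) (g t).
  rewrite in_itv/= => /andP[mt tm].
  have [d1 d2] := continuous_FTC1_closed tm (intg _ _) mt (cg t).
  rewrite derive1E in d2; rewrite -(subr0 (g t)) -d2.
  by apply: is_deriveB; exact/derivableP.
pose G t := G0 ((Num.truncn `|t|).+1%:R) t.
have lt_tr (t : R) : `|t| < (Num.truncn `|t|).+1%:R.
  by case/andP: (truncn_itv (normr_ge0 t)).
have GE m t : `|t| < m -> G t = G0 m t.
  move=> tm; pose p := (Num.truncn `|t|).+1%:R : R.
  have tp : `|t| < p by exact: lt_tr.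
  pose q := Num.min p m.
  have tq : `|t| < q by rewrite lt_min tp.
  have q0 : 0 < q by exact: le_lt_trans tq.
  have h r : r \in `]- q, q[ -> is_derive r 1 (G0 p - G0 m) 0.
    rewrite in_itv/= -ltr_norml lt_min -(subrr (g r)) => /andP[rp rm].
    by apply: is_deriveB; apply: dG0; rewrite in_itv/= -ltr_norml.
  have := derive0_eq h (x := t) (y := 0).
  rewrite !in_itv/= -ltr_norml tq q0 oppr_lt0 q0 => /(_ isT isT)/eqP.
  by rewrite -![(G0 p - G0 m) _]/(G0 p _ - G0 m _) /G0 !subrr subr_eq0
    => /eqP.
exists G; first by rewrite /G /G0 subrr.
move=> t; pose m := `|t| + 1.
have tm : `|t| < m by rewrite ltrDl.
apply: (@near_eq_is_derive _ _ _ (G0 m)); last first.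
  by apply: dG0; rewrite in_itv/= -ltr_norml.
near=> r; apply/esym/GE; rewrite /m -(subrK t r) (le_lt_trans (ler_normD _ _))//.
rewrite addrC ltrD2l distrC; near: r.
exact: nbhsx_ballx.
Unshelve. all: by end_near. Qed.

(** [K expR (a t) - G t] is nonnegative at 0 and nondecreasing for [t >= 0]. *)
Lemma le_expR_ge0 (K a : R) (G g : R -> R) : 0 < a -> G 0 = 0 ->
  (forall t, is_derive t 1 G (g t)) ->
  (forall t, 0 <= t -> g t <= a * K * expR (a * t)) -> 0 <= K ->
  forall t, 0 <= t -> G t <= K * expR (a * t).
Proof.
move=> a0 G0 dG gK K0 t t0.
pose h r : R := K * expR (a * r) - G r.
have dh (r : R) : is_derive r 1 h (K * (expR (a * r) * a) - g r).
  have d1 : is_derive r 1 (fun x : R => expR (a * x)) (expR (a * r) * a).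
    have d0 : is_derive r (1 : R) ( *%R a : R -> R) a.
      have := @is_deriveZ R R R id a r 1 1 (is_derive_id _ _).
      by rewrite /GRing.scale/= mulr1.
    exact: (is_derive1_comp (is_derive_expR (a * r)) d0).
  by apply: is_deriveB; exact: (is_deriveZ K d1).
have [c] := @MVT_closed h _ 0 t t0 (fun r _ => dh r).
rewrite in_itv/= => /andP[c0 _]; rewrite subr0 /h mulr0 expR0 mulr1 G0 subr0.
move=> E; have : 0 <= (K * (expR (a * c) * a) - g c) * t.
  by rewrite mulr_ge0// subr_ge0 (le_trans (gK _ c0))//; lra.
rewrite -E; lra.
Qed.

Lemma norm_le_expR (K a : R) (G g : R -> R) : 0 < a -> G 0 = 0 ->
  (forall t, is_derive t 1 G (g t)) ->
  (forall t, `|g t| <= a * K * expR (a * `|t|)) -> 0 <= K ->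
  forall t, `|G t| <= K * expR (a * `|t|).
Proof.
move=> a0 G0 dG gK K0.
have H (G' g' : R -> R) : G' 0 = 0 -> (forall t, is_derive t 1 G' (g' t)) ->
    (forall t, `|g' t| <= a * K * expR (a * `|t|)) ->
    forall t, 0 <= t -> `|G' t| <= K * expR (a * `|t|).
  move=> G'0 dG' gK' t t0; rewrite (ger0_norm t0) ler_norml lerNl; apply/andP; split.
    apply: (@le_expR_ge0 K a (fun r => - G' r) (fun r => - g' r)) => //.
    - by rewrite G'0 oppr0.
    - move=> r r0; rewrite -[in leRHS](ger0_norm r0); apply: le_trans (gK' r).
      by rewrite -normrN ler_norm.
  apply: (@le_expR_ge0 K a G' g') => // r r0.
  rewrite -[in leRHS](ger0_norm r0); apply: le_trans (gK' r); exact: ler_norm.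
move=> t; have [t0|/ltW t0] := leP 0 t; first exact: (H G g).
have := H (fun r => G (- r)) (fun r => - g (- r)) _ _ _ (- t).
rewrite opprK normrN oppr_ge0; apply; rewrite ?oppr0//.
  move=> r; have := @is_derive1_comp R G -%R r _ _ (dG (- r)) (is_deriveNid _ _).
  by rewrite mulrN1.
by move=> r; rewrite normrN -(normrN r); exact: gK.
Qed.

End primitive.

Lemma is_derive_coord (R : realType) (n : nat) (y : R -> 'rV[R]_n) (t : R)
    (dy : 'rV[R]_n) i :
  is_derive t 1 y dy -> is_derive t 1 (fun t => y t ord0 i) (dy ord0 i).
Proof.
move=> [d <-]; split; first by have /derivable_mxP/(_ ord0 i) := d.
by rewrite derive_mx// mxE.
Qed.

Lemma is_derive_row (R : realType) (n : nat) (y : R -> 'rV[R]_n) (t : R)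
    (dy : 'rV[R]_n) :
  (forall i, is_derive t 1 (fun t => y t ord0 i) (dy ord0 i)) ->
  is_derive t 1 y dy.
Proof.
move=> h; have d : derivable y t 1.
  by apply/derivable_mxP => j i; rewrite (ord1 j); case: (h i).
split => //; rewrite derive_mx//; apply/rowP => i; rewrite !mxE.
by case: (h i).
Qed.

Section picard.
Context {R : realType} {n : nat}.
Variables (F : R -> 'rV[R]_n -> 'rV[R]_n) (y0 : 'rV[R]_n) (L B : R).
Hypotheses (L0 : 0 < L) (B0 : 0 <= B).
Hypothesis cF : forall y : R -> 'rV[R]_n, continuous y ->
  continuous (fun t => F t (y t)).
Hypothesis lF : forall t y z, `|F t y - F t z| <= L * `|y - z|.
Hypothesis bF : forall t : R, `|F t y0| <= B.

(** Bielecki weight. Since [L W] integrates from 0 to at most half of [W], the Picard operator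
    halves distances measured relative to [W] on the whole line, and no short time interval has to
    be chosen. *)
Let W (t : R) := expR (2 * L * `|t|).

Let W1 t : 1 <= W t.
Proof. by rewrite -expR0 ler_expR mulr_ge0// mulr_ge0// ltW. Qed.

Let W0 t : 0 <= W t.
Proof. by rewrite expR_ge0. Qed.

Let picard_step (y : R -> 'rV[R]_n) : {y' : R -> 'rV[R]_n | continuous y ->
  y' 0 = y0 /\ forall t : R, is_derive t 1 y' (F t (y t))}.
Proof.
apply: cid; case: (pselect (continuous y)) => [cy|ncy]; last by exists y.
have h i : exists G : R -> R, G 0 = 0 /\
    forall t : R, is_derive t 1 G (F t (y t) ord0 i).
  have [|G G0 dG] := @antiderivative R (fun t => F t (y t) ord0 i); last by exists G.
  move=> t; apply: (@cvg_comp _ _ _ (fun t => F t (y t)) (fun z : 'rV[R]_n => z ord0 i)).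
    exact: cF.
  exact: coord_continuous.
have {}h : exists G : 'I_n -> R -> R, forall i, G i 0 = 0 /\
    forall t : R, is_derive t 1 (G i) (F t (y t) ord0 i).
  by exists (fun i => sval (cid (h i))) => i; case: (cid (h i)).
case: h => G hG; exists (fun t => y0 + \row_i G i t) => _; split.
  by rewrite -[RHS]addr0; congr (_ + _); apply/rowP => i; rewrite !mxE; case: (hG i).
move=> t; rewrite -[F t (y t)]add0r; apply: is_deriveD.
apply: is_derive_row => i; rewrite (_ : (fun x => _) = G i).
  by case: (hG i) => _; exact.
by apply/funext => r; rewrite mxE.
Qed.

Let T y := sval (picard_step y).

Let T0 y : continuous y -> T y 0 = y0.
Proof. by move=> cy; rewrite /T; case: (picard_step y) => y' /= /(_ cy)[]. Qed.

Let dT y : continuous y -> forall t : R, is_derive t 1 (T y) (F t (y t)).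
Proof. by move=> cy; rewrite /T; case: (picard_step y) => y' /= /(_ cy)[]. Qed.

Let cT y : continuous y -> continuous (T y).
Proof. by move=> cy t; exact: is_derive_continuous (dT cy t). Qed.

Let T_contract y z K : continuous y -> continuous z -> 0 <= K ->
  (forall t : R, `|y t - z t| <= K * W t) ->
  forall t : R, `|T y t - T z t| <= K / 2 * W t.
Proof.
move=> cy cz K0 yz t; apply: normr_rV.
  by rewrite mulr_ge0 ?divr_ge0 ?W0//.
move=> i.
have /= := @norm_le_expR R (K / 2) (2 * L)
  (fun t => (T y t - T z t) ord0 i) (fun t => (F t (y t) - F t (z t)) ord0 i).
apply; rewrite ?divr_ge0//.
- by rewrite mulr_gt0.
- by rewrite !T0// subrr mxE.
- move=> r; apply: (is_derive_coord (y := fun t => T y t - T z t)).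
  by apply: is_deriveB; exact: dT.
- move=> r; rewrite (le_trans (normr_coord _ _))// (le_trans (lF _ _ _))//.
  apply: (@le_trans _ _ (L * (K * W r))); first by rewrite ler_pM2l.
  by rewrite /W; lra.
Qed.

Let y_ k := iter k T (cst y0).

Let cy_ k : continuous (y_ k).
Proof. by elim: k => [|k IH]; [exact: cst_continuous|exact: cT]. Qed.

(** Weighted bound on the first Picard increment: [|F t y0| <= B = 2 L K0 <= 2 L K0 W t]. *)
Let K0 := B / (2 * L).

Let K0_ge0 : 0 <= K0.
Proof. by rewrite divr_ge0// mulr_ge0// ltW. Qed.

Let Kk2 k : 0 <= K0 / 2 ^+ k * 2.
Proof. by apply: mulr_ge0 => //; apply: divr_ge0; [exact: K0_ge0|exact: exprn_ge0]. Qed.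

Let y_step k t : `|y_ k.+1 t - y_ k t| <= K0 / 2 ^+ k * W t.
Proof.
elim: k t => [|k IH] t; last first.
  have Kk : 0 <= K0 / 2 ^+ k by rewrite mulr_ge0// invr_ge0 exprn_ge0.
  have := @T_contract (y_ k.+1) (y_ k) _ (@cy_ k.+1) (@cy_ k) Kk IH t.
  by have -> : K0 / 2 ^+ k.+1 = K0 / 2 ^+ k / 2 by rewrite exprSr invfM [in LHS]mulrA.
rewrite expr0 divr1; apply: normr_rV.
  by rewrite mulr_ge0 ?K0_ge0 ?W0//.
move=> i.
have /= := @norm_le_expR R K0 (2 * L)
  (fun t => (y_ 1 t - y0) ord0 i) (fun t => (F t y0 - 0) ord0 i).
apply; rewrite ?K0_ge0//.
- by rewrite mulr_gt0.
- by rewrite /y_/= T0 ?subrr ?mxE//; exact: cst_continuous.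
- move=> r; apply: (is_derive_coord (y := fun t => y_ 1 t - y0)).
  by apply: is_deriveB; apply: (dT (y := cst y0)); exact: cst_continuous.
- move=> r; rewrite subr0 (le_trans (normr_coord _ _))// (le_trans (bF _))//.
  rewrite /K0 mulrC [X in _ <= _ * X](_ : _ = B); last first.
    by rewrite mulrC divfK// gt_eqF// mulr_gt0.
  by rewrite ler_peMl//; exact: W1.
Qed.

Let y_dist k j t : `|y_ (k + j)%N t - y_ k t| <= K0 / 2 ^+ k * 2 * W t.
Proof.
suff: `|y_ (k + j)%N t - y_ k t| <= K0 / 2 ^+ k * (2 - 2 / 2 ^+ j) * W t.
  move/le_trans; apply; rewrite ler_wpM2r ?W0// ler_wpM2l//.
    by rewrite mulr_ge0// invr_ge0 exprn_ge0.
  by rewrite lerBlDr lerDl divr_ge0// exprn_ge0.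
elim: j => [|j IH].
  by rewrite addn0 subrr normr0 expr0 divr1 subrr mulr0 mul0r.
rewrite addnS -(subrK (y_ (k + j)%N t) (y_ (k + j).+1 t)) -addrA.
rewrite (le_trans (ler_normD _ _))// (le_trans (lerD (y_step _ _) IH))//.
rewrite -mulrDl ler_wpM2r ?W0//.
have p k' : (2 : R) ^+ k' != 0 by rewrite expf_neq0.
rewrite exprD exprS; rewrite le_eqVlt; apply/orP; left; apply/eqP.
by field; rewrite !p.
Qed.

Let small e t : 0 < e -> exists k, K0 / 2 ^+ k * 2 * W t < e.
Proof.
move=> e0; have [k hk] : exists k, K0 * 2 * W t / e < k%:R.
  exists (Num.truncn (K0 * 2 * W t / e)).+1.
  have h0 : 0 <= K0 * 2 * W t / e.
    by rewrite divr_ge0 ?(ltW e0)// mulr_ge0 ?W0// mulr_ge0// K0_ge0.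
  by case/andP: (truncn_itv h0).
exists k; rewrite ltr_pdivrMr// in hk.
have k2 : k%:R <= (2 : R) ^+ k by rewrite -natrX ler_nat ltnW// ltn_expl.
have p : 0 < (2 : R) ^+ k by rewrite exprn_gt0.
have -> : K0 / 2 ^+ k * 2 * W t = (K0 * 2 * W t) / 2 ^+ k by ring.
by rewrite ltr_pdivrMr// (lt_le_trans hk)// mulrC ler_wpM2l// ltW.
Qed.

Let y t := lim ((fun k => y_ k t) @ \oo).

Let y_cvg t : (fun k => y_ k t) @ \oo --> y t.
Proof.
apply/cauchy_cvgP/cauchy_exP => e e0; have [k hk] := small t e0.
exists (y_ k t); rewrite nbhs_filterE; exists k => // j /= kj.
rewrite -ball_normE /= distrC -(subnKC kj); exact: le_lt_trans (y_dist _ _ _) hk.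
Qed.

Let y_close k t : `|y t - y_ k t| <= K0 / 2 ^+ k * 2 * W t.
Proof.
apply/ler_addgt0Pr => e e0.
have /cvgrPdist_le/(_ e e0)[j _ hj] := @y_cvg t.
have /= h := hj (k + j)%N (leq_addl _ _).
rewrite -(subrK (y_ (k + j)%N t) (y t)) -addrA (le_trans (ler_normD _ _))//.
by rewrite [leRHS]addrC; apply: lerD => //; exact: y_dist.
Qed.

Let cy : continuous y.
Proof.
move=> t; apply/cvgrPdist_lt => e e0.
have e3 : 0 < e / 3 by rewrite divr_gt0.
have [k hk] := small (`|t| + 1) e3.
have nt : nbhs t (fun r : R => `|t - r| < 1) := nbhsx_ballx t 1 ltr01.
near=> r.
have close x : `|x| <= `|t| + 1 -> `|y x - y_ k x| < e / 3.
  move=> xt; apply: le_lt_trans (y_close k x) _; apply: le_lt_trans hk.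
  apply: ler_wpM2l; first exact: Kk2.
  rewrite /W ler_expR; apply: ler_wpM2l; first by rewrite mulr_ge0// ltW.
  by rewrite [leRHS]ger0_norm// addr_ge0.
have rt : `|r| <= `|t| + 1.
  have tr : `|t - r| < 1 by near: r; exact: nt.
  by have := ler_normD (r - t) t; rewrite subrK distrC; lra.
have -> : y t - y r = (y t - y_ k t) + (y_ k t - y_ k r) - (y r - y_ k r).
  by apply/rowP => i; rewrite !mxE; ring.
apply: (le_lt_trans (ler_normB _ _)).
have -> : e = e / 3 + e / 3 + e / 3 by field.
apply: ltrD; last exact: close.
apply: (le_lt_trans (ler_normD _ _)); apply: ltrD.
  by apply: close; rewrite lerDl.
near: r; by have /cvgrPdist_lt/(_ _ e3) := @cy_ k t.
Unshelve. all: by end_near. Qed.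

(** The increments of the iterates have weighted size at most [K0 / 2^k]. The limit is therefore
    continuous, and it equals its own image under the Picard operator because both are limits of the
    same iterates; a fixed point solves the equation. *)
Lemma picard : exists2 y : R -> 'rV[R]_n, y 0 = y0 &
  forall t : R, is_derive t 1 y (F t (y t)).
Proof.
suff E : T y = y by exists y; [rewrite -E T0|move=> t; rewrite -{1}E; exact: dT].
apply/funext => t; apply/eqP; rewrite -subr_eq0 -normr_le0; apply/ler_addgt0Pr.
move=> e e0; rewrite add0r; have e2 : 0 < e / 2 by rewrite divr_gt0.
have [k hk] := small t e2.
have h1 K := @T_contract y (y_ k) _ (@cy) (@cy_ k) K (y_close k) t.
rewrite -(subrK (y_ k.+1 t) (T y t)) -addrA (le_trans (ler_normD _ _))//.
have hk' : K0 / 2 ^+ k.+1 * 2 * W t < e / 2.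
  apply: le_lt_trans hk; rewrite ler_wpM2r ?W0// ler_wpM2r//.
  rewrite ler_wpM2l// lef_pV2 ?posrE ?exprn_gt0// exprS ler_peMl ?exprn_ge0//.
  by rewrite ler1n.
rewrite (splitr e) lerD//.
  apply: le_trans (h1 (Kk2 k)) _.
  apply/ltW/(le_lt_trans _ hk); rewrite ler_wpM2r ?W0//.
  have h0 := Kk2 k.
  by rewrite ler_pdivrMr//; lra.
by rewrite distrC; apply/ltW/(le_lt_trans (y_close _ _)).
Qed.

End picard.

(** * Chain rules and local Lipschitz bounds *)

Section chain_rule.
Context {R : realType}.

Lemma is_derive_comp_curve (V W : normedModType R) (g : V -> W) (c : R -> V)
    (t : R) (w : V) :
  differentiable g (c t) -> is_derive t 1 c w ->
  is_derive t 1 (g \o c) ('D_w g (c t)).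
Proof.
move=> dg [/derivable1_diffP dc <-].
have dgc : differentiable (g \o c) t by exact: differentiable_comp.
split; first exact: diff_derivable.
by rewrite deriveE// diff_comp//= !deriveE.
Qed.

Lemma derivable_line (V : normedModType R) (a b : V) (t : R) :
  is_derive t 1 (fun r : R => a + r *: b) b.
Proof.
rewrite -[X in is_derive _ _ _ X]add0r; apply: is_deriveD.
split; first by apply/derivable1_diffP; exact: differentiableZl.
by rewrite deriveE ?diffZl ?diff_val ?scale1r//; exact: differentiableZl.
Qed.

Lemma deriveE_coord (n : nat) (W : normedModType R) (g : 'rV[R]_n -> W) x v :
  differentiable g x -> 'D_v g x = \sum_i v ord0 i *: 'D_(delta_mx 0 i) g x.
Proof.
move=> dg; rewrite deriveE// {1}(row_sum_delta v) linear_sum.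
by apply: eq_bigr => i _; rewrite linearZ deriveE.
Qed.

Lemma smooth_on_open (V W : normedModType R) (S : set V) (f : V -> W) x :
  open S -> smooth_on S f -> S x ->
  exists U, [/\ open U, U x, U `<=` S & forall k, Ck k U f].
Proof.
move=> oS sf Sx; have [U [g [oU Ux Cg gf]]] := sf x Sx.
exists (U `&` S); split => //; first exact: openI.
move=> k; apply: (@eq_Ck _ _ _ k _ g) => //; first exact: openI.
  by move=> y [Uy Sy]; exact: gf.
by apply: Ck_sub (Cg k) => y [].
Qed.

Lemma Ck_differentiable (V W : normedModType R) k (U : set V) (f : V -> W) x :
  Ck k.+1 U f -> U x -> differentiable f x.
Proof. by move=> [h _]; exact: h. Qed.

Lemma Ck_derive (V W : normedModType R) k (U : set V) (f : V -> W) v :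
  Ck k.+1 U f -> Ck k U ('D_v f).
Proof. by move=> [_]; exact. Qed.

Lemma Ck_coord (n : nat) k (U : set 'rV[R]_n) i : open U ->
  Ck k U (fun y : 'rV[R]_n => y ord0 i).
Proof.
move=> oU; case: k => [|k]; first by move=> x _; exact: coord_continuous.
split=> [x _|v]; first exact: differentiable_coord.
apply: (@eq_Ck _ _ _ k _ (fun=> v ord0 i)) => //; last exact: Ck_cst.
move=> x _.
have := @is_derive_comp_curve _ _ (fun y : 'rV[R]_n => y ord0 i)
  (fun r : R => x + r *: v) 0 v.
rewrite scale0r addr0 => /(_ (differentiable_coord _ _ _) (derivable_line _ _ _)).
case=> _ <-; have [_ <-] := is_derive_coord i (derivable_line x v 0).
by [].
Qed.

(** The sup-norm ball is convex, so each coordinate of [f] obeys the mean value theorem on the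
    segment from [z] to [y], where the partial derivatives stay below [K]. *)
Lemma C1_locally_lipschitz (n m : nat) (U : set 'rV[R]_n)
    (f : 'rV[R]_n -> 'rV[R]_m) x :
  open U -> Ck 1 U f -> U x ->
  exists r : R, 0 < r /\ exists L : R, [/\ 0 < L,
    (forall y, `|y - x| <= r -> U y) & forall y z, `|y - x| <= r ->
    `|z - x| <= r -> `|f y - f z| <= L * `|y - z|].
Proof.
move=> oU Cf Ux; have [df Cdf] := Cf.
(* Each partial derivative at [x] is at most the whole sum; the extra 1 absorbs its variation near
   [x]. *)
pose K := \sum_(i < n) `|'D_(delta_mx 0 i) f x| + 1.
have K0 : 0 < K by rewrite ltr_wpDl// sumr_ge0.
have : \forall y \near x, U y /\ forall i : 'I_n, `|'D_(delta_mx 0 i) f y| < K.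
  near=> y; split; first by near: y; exact: open_nbhs_nbhs.
  move=> i; move: i; near: y; apply: filter_forall => i.
  have := Cdf (delta_mx 0 i) x Ux; rewrite /prop_for /continuous_at.
  move=> /cvgrPdist_lt/(_ 1 ltr01); apply: filterS => y.
  rewrite distrC => h; rewrite -(subrK ('D_(delta_mx 0 i) f x) ('D_(delta_mx 0 i) f y)).
  rewrite (le_lt_trans (ler_normD _ _))// addrC ler_ltD//.
  by rewrite (bigD1 i)//= lerDl sumr_ge0.
move=> /nbhs_ballP[e /= e0 eB]; exists (e / 2); split; first by rewrite divr_gt0.
have e2 y : `|y - x| <= e / 2 -> ball x e y.
  move=> h; rewrite -ball_normE/= distrC (le_lt_trans h)//.
  by rewrite ltr_pdivrMr// ltr_pMr// ltr1n.
exists (n%:R * K + 1); split.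
- by rewrite ltr_wpDl// mulr_ge0// ltW.
- by move=> y /e2/eB[].
move=> y z hy hz; pose c (t : R) := z + t *: (y - z).
have cB t : t \in `[0, 1] -> `|c t - x| <= e / 2.
  rewrite in_itv/= => /andP[t0 t1].
  have -> : c t - x = (1 - t) *: (z - x) + t *: (y - x).
    by apply/rowP => i; rewrite !mxE; ring.
  rewrite (le_trans (ler_normD _ _))// !normrZ (ger0_norm t0) ger0_norm ?subr_ge0//.
  have -> : e / 2 = (1 - t) * (e / 2) + t * (e / 2) by ring.
  by rewrite lerD// ler_wpM2l// subr_ge0.
have dc (t : R) : t \in `[0, 1] -> is_derive t 1 (f \o c) ('D_(y - z) f (c t)).
  move=> /cB/e2/eB[Uct _]; apply: is_derive_comp_curve (derivable_line _ _ _).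
  exact: df.
apply: normr_rV => [|j]; first by rewrite mulr_ge0// addr_ge0// mulr_ge0// ltW.
have dcj (t : R) (t01 : t \in `[0, 1]) := is_derive_coord j (dc t t01).
have [t t01] := @MVT_closed _ _ _ 0 1 ler01 dcj.
rewrite !mxE /= /c scale1r scale0r addr0 (addrC z) subrK subr0 mulr1 => ->.
apply: (le_trans (normr_coord _ _)).
have [Uct hK] := eB _ (e2 _ (cB _ t01)).
rewrite deriveE_coord; last exact: df.
rewrite (le_trans (ler_norm_sum _ _ _))//.
apply: (@le_trans _ _ (\sum_(i < n) `|y - z| * K)).
  apply: ler_sum => i _; rewrite normrZ ler_pM//; last exact/ltW/hK.
  exact: normr_coord.
rewrite sumr_const card_ord -[leLHS]mulr_natl mulrCA mulrC ler_wpM2r//.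
by rewrite lerDl.
Unshelve. all: by end_near. Qed.

Lemma derive_scale1 (W : normedModType R) (f : R -> W) (t v : R) :
  differentiable f t -> 'D_v f t = v *: 'D_1 f t.
Proof.
by move=> df; rewrite !deriveE// -linearZ; congr ('d f t _); rewrite -[RHS]/(v * 1) mulr1.
Qed.

Lemma Ck_line (V W : normedModType R) (U : set V) (I : set R) (g : V -> W)
    (a b : V) : open U -> open I -> (forall s, I s -> U (a + s *: b)) ->
  (forall k, Ck k U g) -> forall k, Ck k I (fun s : R => g (a + s *: b)).
Proof.
move=> oU oI IU Cg k; elim: k g Cg => [|k IH] g Cg.
  move=> s Is; apply: (@continuous_comp _ _ _ (fun s : R => a + s *: b) g).
    exact: is_derive_continuous (derivable_line a b s).
  exact: (Cg 0) _ (IU _ Is).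
have dg s : I s -> differentiable g (a + s *: b).
  by move=> /IU; exact: Ck_differentiable (Cg 1).
have dgs (s : R) : I s ->
    is_derive s 1 (fun r : R => g (a + r *: b)) ('D_b g (a + s *: b)).
  move=> /dg gs.
  have H := @is_derive_comp_curve _ _ g (fun r => a + r *: b) s b gs
    (derivable_line a b s).
  refine H.
have ds s : I s -> differentiable (fun r : R => g (a + r *: b)) s.
  by move=> /dgs[+ _] => /derivable1_diffP.
split=> [s Is|v]; first exact: ds.
have CD j : Ck j U (fun y => v *: 'D_b g y).
  apply: (@eq_Ck _ _ _ j _ ('D_(v *: b) g)) => //; last exact: Ck_derive (Cg j.+1).
  by move=> y Uy; rewrite !deriveE ?linearZ//; exact: Ck_differentiable (Cg 1) Uy.
refine (@eq_Ck _ _ _ k I _ _ oI _ (IH _ CD)) => s Is.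
rewrite (derive_scale1 v (ds s Is)).
by case: (dgs s Is) => _ ->.
Qed.

End chain_rule.

Section clamp.
Context {R : realType} {n : nat}.
Variables (x : 'rV[R]_n) (r : R).
Hypothesis r0 : 0 < r.

(** A 1-Lipschitz retraction onto the closed sup-norm ball around [x]. Composing with it turns a
    field that is Lipschitz near [x] into a globally Lipschitz one, to which [picard] applies. *)
Definition clamp (z : 'rV[R]_n) : 'rV[R]_n :=
  \row_i Num.max (x ord0 i - r) (Num.min (x ord0 i + r) (z ord0 i)).

Lemma clamp_id z : `|z - x| <= r -> clamp z = z.
Proof.
move=> zx; apply/rowP => i; rewrite mxE.
have := le_trans (normr_coord (z - x) i) zx; rewrite !mxE ler_norml => /andP[h1 h2].
rewrite min_r; last by lra.
by rewrite max_r//; lra.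
Qed.

Lemma clamp_in z : `|clamp z - x| <= r.
Proof.
apply: normr_rV; first exact: ltW.
move=> i; rewrite !mxE ler_norml; apply/andP; split;
case: (leP (x ord0 i + r) (z ord0 i)) => h1;
 case: (leP (x ord0 i - r) _) => h2; have := r0; lra.
Qed.

Lemma clamp_lip y z : `|clamp y - clamp z| <= `|y - z|.
Proof.
apply: normr_rV => // i; apply: le_trans (normr_coord (y - z) i).
rewrite !mxE; set a := x ord0 i; set b := y ord0 i; set c := z ord0 i.
rewrite ler_norml.
have := ler_norm (b - c); have := ler_norm (- (b - c)); rewrite normrN => h1 h2.
have := normr_ge0 (b - c) => h3.
apply/andP; split;
 case: (leP (a + r) b) => h4; case: (leP (a + r) c) => h5;
 case: (leP (a - r) _) => h6; try (case: (leP (a - r) _) => h7); have := r0; lra.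
Qed.

Lemma clamp_continuous : continuous clamp.
Proof.
move=> y; apply/(@cvgrPdist_lt _ _ _ (nbhs y) (nbhs_filter y)) => e e0.
have := nbhsx_ballx y e e0; apply: (@filterS _ (nbhs y) (nbhs_filter y)) => z.
by rewrite -ball_normE/=; apply: le_lt_trans; exact: clamp_lip.
Qed.

End clamp.

(* A curve solving an autonomous ODE with smooth right-hand side is as smooth
   as one likes: differentiating [Psi \o c] gives a function of the same form. *)
Lemma Ck_flow (R : realType) (n : nat) (A : set 'rV[R]_n)
    (Phi : 'rV[R]_n -> 'rV[R]_n) (I : set R) (c : R -> 'rV[R]_n) :
  open A -> open I -> (forall k, Ck k A Phi) -> (forall t, I t -> A (c t)) ->
  (forall t : R, I t -> is_derive t 1 c (Phi (c t))) ->
  forall k (Psi : 'rV[R]_n -> R), (forall k, Ck k A Psi) -> Ck k I (Psi \o c).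
Proof.
move=> oA oI CPhi cA dc; elim=> [|k IH] Psi CPsi.
  move=> t It; apply: continuous_comp.
    exact: is_derive_continuous (dc t It).
  exact: (CPsi 0) _ (cA _ It).
have dPsi t : I t -> differentiable Psi (c t).
  by move=> /cA; exact: Ck_differentiable (CPsi 1).
have dcomp t : I t -> is_derive t 1 (Psi \o c) ('D_(Phi (c t)) Psi (c t)).
  by move=> It; apply: is_derive_comp_curve; [exact: dPsi|exact: dc].
have diffc t : I t -> differentiable (Psi \o c) t.
  by move=> It; apply/derivable1_diffP; case: (dcomp t It).
split=> // v.
pose Psi' y := \sum_(i < n) Phi y ord0 i * 'D_(delta_mx 0 i) Psi y.
have CPsi' j : Ck j A Psi'.
  apply: Ck_sum => // i; apply: CkM => //.
    exact: (Ck_rowP j Phi oA).1 (CPhi j) i.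
  exact: Ck_derive (CPsi j.+1).
have Cv : Ck k I (fun t => v * (Psi' \o c) t).
  apply: CkM => //; first exact: Ck_cst.
  exact: IH.
apply: eq_Ck Cv => // t It.
rewrite deriveE; last exact: diffc.
rewrite -[v in RHS]mulr1 -[v * 1]/(v *: (1 : R)) linearZ -deriveE; last exact: diffc.
case: (dcomp t It) => _ ->; congr (_ * _).
by rewrite deriveE_coord//; exact: dPsi.
Qed.

(** * Local equations and the projection onto their kernels *)

Section chart.
Context {R : realType} {n m : nat}.
Variables (A : set 'rV[R]_n) (h : 'rV[R]_n -> 'rV[R]_m).
Hypotheses (oA : open A) (Ch : forall k, Ck k A h).

Let J y : 'M[R]_(n, m) := jacobian h y.

Hypothesis uJ : forall y, A y -> (J y)^T *m J y \in unitmx.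

(** Orthogonal projection onto the left kernel of the Jacobian (vectors are rows), from the normal
    equations. It makes sense on all of [A], also off the zero set of [h], and can thus be
    differentiated in every direction. *)
Definition kerproj y : 'M[R]_n :=
  1%:M - J y *m invmx ((J y)^T *m J y) *m (J y)^T.

Lemma derive_jacobian y v : A y -> 'D_v h y = v *m J y.
Proof. by move=> Ay; apply: deriveEjacobian; exact: Ck_differentiable (Ch 1) Ay. Qed.

Lemma smooth_jacobian : smooth_mx A J.
Proof.
move=> i j k; have Ci := Ck_derive (delta_mx 0 i) (Ch k.+1).
apply: eq_Ck ((Ck_rowP k _ oA).1 Ci j) => // x Ax.
by rewrite derive_jacobian// -rowE mxE.
Qed.

Lemma smooth_kerproj : smooth_mx A kerproj.
Proof.
apply: smooth_mxB => //.
  by move=> i j k; exact: Ck_cst.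
have sT := smooth_mxT oA smooth_jacobian.
apply: smooth_mxM => //; apply: smooth_mxM => //; first exact: smooth_jacobian.
apply: smooth_invmx => //; apply: smooth_mxM => //; exact: smooth_jacobian.
Qed.

Lemma Ck_kerproj k (u : 'rV[R]_n) : Ck k A (fun y => u *m kerproj y).
Proof.
apply/Ck_rowP => // i.
apply: (@eq_Ck _ _ _ _ _ (fun y => \sum_l u ord0 l * kerproj y l i)) => //.
  by move=> y _; rewrite mxE.
apply: Ck_sum => // l; apply: CkM => //; first exact: Ck_cst.
exact: smooth_kerproj.
Qed.

Lemma kerproj_ker y (v : 'rV[R]_n) : A y -> v *m kerproj y *m J y = 0.
Proof.
move=> Ay; rewrite mulmxBr mulmx1 mulmxBl -!mulmxA mulVmx ?uJ// mulmx1 subrr//.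
Qed.

Lemma kerproj_perp y (v q : 'rV[R]_n) : q *m J y = 0 -> dotp (v - v *m kerproj y) q = 0.
Proof.
move=> qJ; have dotE (a b : 'rV[R]_n) : dotp a b = (a *m b^T) ord0 ord0.
  by rewrite mxE; apply: eq_bigr => i _; rewrite mxE.
rewrite dotE mulmxBr mulmx1 opprB addrC subrK -!mulmxA -trmx_mul qJ.
by rewrite trmx0 !mulmx0 mxE.
Qed.

Lemma kerproj_fix y (v : 'rV[R]_n) : v *m J y = 0 -> A y -> v *m kerproj y = v.
Proof.
move=> vJ Ay; apply/esym/eqP; rewrite -subr_eq0; apply/eqP/dotp_eq0.
apply: kerproj_perp => //; rewrite mulmxBl vJ kerproj_ker// subrr//.
Qed.

(** Takes the place of the implicit function theorem: the integral curve from [x] of the field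
    [y |-> v *m kerproj y] keeps [h] constant, as the field lies in the kernel of the Jacobian; its
    initial velocity is [v] because [v] itself lies there. *)
Lemma ker_flow x v : A x -> h x = 0 -> v *m J x = 0 ->
  exists c : R -> 'rV[R]_n, exists e : R,
    [/\ 0 < e, forall k, Ck k `]- e, e[%classic c,
        forall t, t \in `]- e, e[ -> A (c t) /\ h (c t) = 0, c 0 = x
      & is_derive (0 : R) 1 c v].
Proof.
move=> Ax hx vJ; pose Phi y := v *m kerproj y.
have CPhi k : Ck k A Phi by exact: Ck_kerproj.
have [r [r0 [L [L0 rA lipPhi]]]] : exists r : R, 0 < r /\ exists L : R, [/\ 0 < L,
    (forall y, `|y - x| <= r -> A y) & forall y z, `|y - x| <= r ->
    `|z - x| <= r -> `|Phi y - Phi z| <= L * `|y - z|].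
  exact: C1_locally_lipschitz (CPhi 1) Ax.
pose F (t : R) y := Phi (clamp x r y).
have clA y : A (clamp x r y) by apply/rA/clamp_in.
have xcl : clamp x r x = x by apply: clamp_id; rewrite subrr normr0 ltW.
have cF (y : R -> 'rV[R]_n) : continuous y -> continuous (fun t => F t (y t)).
  move=> cy t; rewrite /F.
  apply: (@continuous_comp _ _ _ (fun t => clamp x r (y t)) Phi); last first.
    exact: (CPhi 0) _ (clA _).
  apply: (@continuous_comp _ _ _ y (clamp x r)); first exact: cy.
  exact: clamp_continuous.
have lF (t : R) y z : `|F t y - F t z| <= L * `|y - z|.
  apply: (le_trans (lipPhi _ _ (clamp_in x r0 y) (clamp_in x r0 z))).
  by rewrite ler_pM2l// clamp_lip.
have [c c0 dc] := @picard _ _ F x L `|Phi x| L0 (normr_ge0 _) cF lF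
  (fun t => eq_ind_r (fun w => `|Phi w| <= _) (lexx _) xcl).
have cc : {for (0 : R), continuous c} by exact: is_derive_continuous (dc 0).
(* For times below [e] the solution stays in the ball where [clamp] is the identity, so there it
   solves the original equation. *)
have := cc => /cvgrPdist_lt/(_ r r0)/nbhs_ballP[e /= e0 eB].
have cr t : t \in `]- e, e[ -> `|c t - x| <= r.
  rewrite in_itv/= -ltr_norml => te; rewrite distrC -c0; apply/ltW/eB.
  by rewrite -ball_normE/= sub0r normrN.
have dcPhi (t : R) : t \in `]- e, e[ -> is_derive t 1 c (Phi (c t)).
  by move=> /cr te; have := dc t; rewrite /F clamp_id.
exists c, e; split => //.
- move=> k; apply/Ck_rowP; first exact: interval_open.
  have cA t : `]- e, e[%classic t -> A (c t) by move=> te; exact/rA/cr.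
  move=> i; have oI : open (`]- e, e[%classic : set R) by exact: interval_open.
  have H := @Ck_flow R n A Phi _ c oA oI CPhi cA dcPhi k _ (fun j => Ck_coord j i oA).
  refine H.
- move=> t te; split; first exact/rA/cr.
  have hd (s : R) : s \in `]- e, e[ -> is_derive s 1 (h \o c) 0.
    move=> se; have Acs : A (c s) by exact/rA/cr.
    have := is_derive_comp_curve (Ck_differentiable (Ch 1) Acs) (dcPhi s se).
    by rewrite derive_jacobian// kerproj_ker.
  apply/rowP => i; rewrite -hx -c0.
  have hi (s : R) : s \in `]- e, e[ -> is_derive s 1 (fun t => h (c t) ord0 i) 0.
    by move=> /hd/(is_derive_coord i); rewrite mxE.
  apply: (derive0_eq hi) => //.
  by rewrite in_itv/= oppr_lt0 e0.
- by have := dc 0; rewrite c0 /F xcl /Phi kerproj_fix.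
Qed.

End chart.

(** * Tangent spaces *)

Section curves.
Context {R : realType} {n : nat}.
Implicit Types (M : set 'rV[R]_n).

Lemma smooth_on_derivable (W : normedModType R) (S : set R) (c : R -> W) (t : R) :
  open S -> smooth_on S c -> S t -> is_derive t 1 c (derive1 c t).
Proof.
move=> oS sc St; have [U [oU Ut _ CU]] := smooth_on_open oS sc St.
have dc : derivable c t 1.
  by apply/derivable1_diffP; exact: Ck_differentiable (CU 1) Ut.
by split; [exact: dc|rewrite derive1E].
Qed.

Lemma curve_through_derive M x v c :
  curve_through M x v c -> is_derive (0 : R) 1 c v.
Proof.
move=> [e [e0 sc _ _ <-]]; apply: smooth_on_derivable sc _.
  exact: interval_open.
by rewrite /= in_itv/= oppr_lt0 e0.
Qed.

Lemma curve_through_near M x v c :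
  curve_through M x v c -> \forall t \near (0 : R), M (c t).
Proof.
move=> [e [e0 _ cM _ _]]; exists e => //= t.
by rewrite /ball_/= sub0r normrN ltr_norml => te; apply: cM; rewrite in_itv/=.
Qed.

End curves.

Section manifold.
Context {R : realType} {n d : nat}.
Variable M : set 'rV[R]_n.
Hypothesis hM : embedded_submanifold d M.

(** A local equation rather than a parametrization. Surjectivity of the differential is phrased by
    the Gram matrix, the one that [kerproj] inverts. *)
Definition is_chart (A : set 'rV[R]_n) (h : 'rV[R]_n -> 'rV[R]_(n - d)) :=
  [/\ open A, forall k, Ck k A h, forall y, A y -> (M y <-> h y = 0)
    & forall y, A y -> (jacobian h y)^T *m jacobian h y \in unitmx].

(** If [w] is killed by the Gram matrix then [|w *m B^T|^2 = 0], and full rank of [B] gives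
    [w = 0]. *)
Lemma gram_unitmx p q (B : 'M[R]_(p, q)) : row_full B -> B^T *m B \in unitmx.
Proof.
move=> fB; rewrite -row_free_unit; apply/row_freeP.
suff K0 : kermx (B^T *m B) = 0.
  have := mxrank_ker (B^T *m B); rewrite K0 mxrank0 => /esym/eqP.
  rewrite subn_eq0 => rk; apply/row_freeP; rewrite /row_free eqn_leq rk andbT.
  exact: rank_leq_row.
apply/row_matrixP => i; rewrite row0; set w := row i _.
have wB : w *m (B^T *m B) = 0.
  by apply/sub_kermxP; exact: row_sub.
have dotE (a b : 'rV[R]_p) : dotp a b = (a *m b^T) ord0 ord0.
  by rewrite mxE; apply: eq_bigr => j _; rewrite mxE.
have wBT : w *m B^T = 0.
  apply: dotp_eq0; rewrite dotE trmx_mul trmxK mulmxA -(mulmxA w) wB.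
  by rewrite mul0mx mxE.
have /row_fullP[B' B'B] := fB.
by rewrite -[w]mulmx1 -[1%:M]trmx1 -B'B trmx_mul mulmxA wBT mul0mx.
Qed.

(** The differential is known to be onto at [x] only; the domain is cut down to the open set where
    the Gram determinant does not vanish. *)
Lemma chart_exists x : M x -> exists A h, is_chart A h /\ A x.
Proof.
case: hM => _ _ hMx Mx; have [U [h [oU Ux sh hU hx]]] := hMx x Mx.
have [U' [oU' U'x U'U CU']] := smooth_on_open oU sh Ux.
have smJ := smooth_jacobian oU' CU'.
pose dt y := \det ((jacobian h y)^T *m jacobian h y).
have Cdt : Ck 0 U' dt.
  apply: Ck_det => //; apply: smooth_mxM => //; exact: smooth_mxT.
have dtx : dt x != 0.
  rewrite -unitfE -unitmxE; apply: gram_unitmx; rewrite -sub1mx.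
  apply/row_subP => i; have [v hv] := hx (row i 1%:M).
  rewrite -hv -deriveE; last exact: Ck_differentiable (CU' 1) U'x.
  by rewrite (derive_jacobian CU')// submxMl.
exists (U' `&` [set y | dt y != 0]), h; split; last by [].
split.
- rewrite openE => y [U'y dty]; rewrite /interior; near=> z; split.
    by near: z; exact: open_nbhs_nbhs.
  near: z; have /= := Cdt y U'y; rewrite /prop_for /continuous_at => /cvgrPdist_lt.
  move=> /(_ `|dt y|); rewrite normr_gt0 => /(_ dty); apply: filterS => z /=.
  by apply: contraTneq => ->; rewrite subr0 ltxx.
- by move=> k; apply: Ck_sub (CU' k) => y [].
- by move=> y [/U'U Uy _]; exact: hU.
- by move=> y [_]; rewrite unitmxE unitfE.
Unshelve. all: by end_near. Qed.

(** Along a curve in [M], [h] vanishes near time 0; conversely [ker_flow] realizes every vector of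
    the kernel as a velocity. *)
Lemma tangentP A h x v : is_chart A h -> A x -> M x ->
  tangent M x v <-> v *m jacobian h x = 0.
Proof.
move=> [oA Ch hA uA] Ax Mx; split.
  move=> [c cv]; have dc := curve_through_derive cv.
  have c0 : c 0 = x by case: cv => e [].
  have dh : differentiable h (c 0) by rewrite c0; exact: Ck_differentiable (Ch 1) Ax.
  have [dhc E] := is_derive_comp_curve dh dc.
  rewrite c0 (derive_jacobian Ch v Ax) in E; rewrite -E.
  rewrite -[RHS](derive_cst (0 : 'rV[R]_(n - d)) (0 : R) 1).
  apply: near_eq_derive; have cM := curve_through_near cv.
  have cA : \forall t \near (0 : R), A (c t).
    have := is_derive_continuous dc; rewrite /prop_for/continuous_at c0; apply.
    exact: open_nbhs_nbhs.
  near=> t; apply: (hA _ _).1; first by near: t.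
  by near: t.
move=> vJ; have hx : h x = 0 by exact/(hA _ Ax).
have [c [e [e0 Cc cA c0 dc]]] := ker_flow oA Ch uA Ax hx vJ.
exists c, e; split => //.
- by move=> t te; exists `]- e, e[%classic, c; split.
- by move=> t /cA[Act /(hA _ Act)].
- by rewrite derive1E; case: dc.
Unshelve. all: by end_near. Qed.

Lemma tangent_kerproj A h x v : is_chart A h -> A x -> M x ->
  [/\ tangent M x (v *m kerproj h x) & forall q, tangent M x q ->
      dotp (v - v *m kerproj h x) q = 0].
Proof.
move=> ch Ax Mx; have [oA Ch hA uA] := ch; split.
  by apply/(tangentP _ ch Ax Mx); exact: (kerproj_ker uA).
by move=> q /(tangentP _ ch Ax Mx) qJ; exact: kerproj_perp.
Qed.

Lemma projectable_tangent x : M x -> projectable (tangent M x).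
Proof.
move=> Mx; have [A [h [ch Ax]]] := chart_exists Mx; split.
  split; first by apply/(tangentP _ ch Ax Mx); rewrite mul0mx.
  move=> a u v /(tangentP _ ch Ax Mx) uJ /(tangentP _ ch Ax Mx) vJ.
  by apply/(tangentP _ ch Ax Mx); rewrite mulmxDl -scalemxAl uJ vJ scaler0 addr0.
move=> v; have [h1 h2] := tangent_kerproj v ch Ax Mx.
by exists (v *m kerproj h x).
Qed.

Lemma oproj_kerproj A h x v : is_chart A h -> A x -> M x ->
  oproj (tangent M x) v = v *m kerproj h x.
Proof.
move=> ch Ax Mx; have [h1 h2] := tangent_kerproj v ch Ax Mx.
by apply: oproj_uniq => //; exact: projectable_tangent.
Qed.

Lemma vector_field_oproj (A : set 'rV[R]_n) u :
  vector_field M A (fun y => oproj (tangent M y) u).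
Proof.
split; last by move=> y My _; apply: oprojS; exact: projectable_tangent.
move=> x [Mx _]; have [B [h [ch Bx]]] := chart_exists Mx.
have [oB Ch hB uB] := ch.
exists B, (fun y => u *m kerproj h y); split => //.
  by move=> k; exact: Ck_kerproj.
by move=> y By [My _]; rewrite (oproj_kerproj _ ch).
Qed.

Lemma tangent_curve (c : R -> 'rV[R]_n) (t : R) w :
  (\forall r \near t, M (c r)) -> is_derive t 1 c w -> tangent M (c t) w.
Proof.
move=> cM dc; have Mx : M (c t) by exact: nbhs_singleton cM.
have [A [h [ch Ax]]] := chart_exists Mx; have [oA Ch hA uA] := ch.
apply/(tangentP _ ch Ax Mx).
have dh : differentiable h (c t) by exact: Ck_differentiable (Ch 1) Ax.
have [dhc E] := is_derive_comp_curve dh dc.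
rewrite (derive_jacobian Ch w Ax) in E; rewrite -E.
rewrite -[RHS](derive_cst (0 : 'rV[R]_(n - d)) (t : R) 1).
apply: near_eq_derive.
have cA : \forall r \near t, A (c r).
  have := is_derive_continuous dc; rewrite /prop_for/continuous_at; apply.
  exact: open_nbhs_nbhs.
near=> r; apply: (hA _ _).1; first by near: r.
by near: r.
Unshelve. all: by end_near. Qed.

(* The derivative at [x], in the direction [w], of the tangential projection of
   [u]. *)
Definition dproj (x w u : 'rV[R]_n) : 'rV[R]_n := xget 0 [set b | exists A h,
  [/\ is_chart A h, A x & b = 'D_w (fun y => u *m kerproj h y) x]].

(** Projections built from two charts agree on [M] only, but a curve in [M] cannot see the
    difference: whichever chart [dproj] selects yields the derivative along [c]. *)
Lemma dproj_curve (c : R -> 'rV[R]_n) (t : R) w u :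
  (\forall r \near t, M (c r)) -> is_derive t 1 c w ->
  is_derive t 1 (fun r => oproj (tangent M (c r)) u) (dproj (c t) w u).
Proof.
move=> cM dc; have Mx : M (c t) by exact: nbhs_singleton cM.
rewrite /dproj; case: xgetP => [b _ [A [h [ch Ax ->]]]|]; last first.
  have [A [h [ch Ax]]] := chart_exists Mx.
  by move=> /(_ ('D_w (fun y => u *m kerproj h y) (c t))); case; exists A, h.
have [oA Ch hA uA] := ch.
have dP : differentiable (fun y => u *m kerproj h y) (c t).
  exact: Ck_differentiable (Ck_kerproj oA Ch uA 1 u) Ax.
apply: near_eq_is_derive (is_derive_comp_curve dP dc).
have cA : \forall r \near t, A (c r).
  have := is_derive_continuous dc; rewrite /prop_for/continuous_at; apply.
  exact: open_nbhs_nbhs.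
near=> r; rewrite /= (oproj_kerproj _ ch)//; by near: r.
Unshelve. all: by end_near. Qed.

End manifold.

(** * Variation of the tangent projections *)

Section is_derive_dotp.
Context {R : realType} {n : nat}.

Lemma is_derive_dotp (f g : R -> 'rV[R]_n) (t : R) df dg :
  is_derive t 1 f df -> is_derive t 1 g dg ->
  is_derive t 1 (fun r => dotp (f r) (g r)) (dotp df (g t) + dotp (f t) dg).
Proof.
move=> hf hg.
have h i : is_derive t 1 (fun r => f r ord0 i * g r ord0 i)
    (df ord0 i * g t ord0 i + f t ord0 i * dg ord0 i).
  have H := @is_deriveM _ _ _ _ t 1 _ _ (is_derive_coord i hf) (is_derive_coord i hg).
  apply: (is_derive_eq H); rewrite /GRing.scale/=; ring.
have := is_derive_sum h; rewrite big_split/=.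
by rewrite (_ : \sum_(i < n) _ = fun r => dotp (f r) (g r))//; apply/funext => r;
  rewrite fct_sumE.
Qed.

Lemma is_derive_dotpr (f : R -> 'rV[R]_n) (t : R) df a :
  is_derive t 1 f df -> is_derive t 1 (fun r => dotp a (f r)) (dotp a df).
Proof.
move=> hf; have := is_derive_dotp (is_derive_cst a t 1) hf.
by rewrite dotp0l add0r.
Qed.

Lemma is_derive_eq_near (W : normedModType R) (f g : R -> W) (t : R) df dg :
  is_derive t 1 f df -> is_derive t 1 g dg -> (\forall r \near t, f r = g r) ->
  df = dg.
Proof. by move=> [_ <-] [_ <-] fg; exact: near_eq_derive. Qed.

End is_derive_dotp.

Section second_fundamental_form.
Context {R : realType} {n d : nat}.
Variable M : set 'rV[R]_n.
Hypothesis hM : embedded_submanifold d M.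
Variables (x w : 'rV[R]_n).
Hypotheses (Mx : M x) (tw : tangent M x w).

Let P := oproj (tangent M x).
Let DP := dproj (d:=d) M x w.

Let hT := projectable_tangent hM Mx.

Let curve : exists c : R -> 'rV[R]_n, [/\ curve_through M x w c, c 0 = x,
  \forall t \near (0 : R), M (c t) & forall u,
  is_derive (0 : R) 1 (fun r => oproj (tangent M (c r)) u) (DP u)].
Proof.
case: (tw) => c cw; have c0 : c 0 = x by case: cw => e [].
have cM := curve_through_near cw.
exists c; split => // u; rewrite /DP -c0.
exact: dproj_curve hM _ _ _ _ cM (curve_through_derive cw).
Qed.

Lemma dproj_sym a u : dotp a (DP u) = dotp (DP a) u.
Proof.
have [c [cw c0 cM dc]] := curve.
have h1 := is_derive_dotpr a (dc u); have h2 := is_derive_dotpr u (dc a).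
rewrite (dotpC (DP a)); apply: is_derive_eq_near h1 h2 _.
apply: filterS cM => r Mr; rewrite (dotpC u).
by rewrite (oproj_sym (projectable_tangent hM Mr)).
Qed.

(* Differentiate [P^2 = P]. *)
Lemma dproj_idem a u : dotp (DP a) (P u) + dotp (P a) (DP u) = dotp a (DP u).
Proof.
have [c [cw c0 cM dc]] := curve.
have := is_derive_dotp (dc a) (dc u); rewrite c0 => h1.
apply: is_derive_eq_near h1 (is_derive_dotpr a (dc u)) _.
apply: filterS cM => r Mr; have hr := projectable_tangent hM Mr.
by rewrite oproj_sym// (oproj_id hr)//; exact: oprojS.
Qed.

(** Sandwiching [P' = P' P + P P'] between two copies of [P] gives [P P' P = 2 P P' P]: the
    derivative has no tangent-to-tangent block. *)
Lemma dproj_normal u : P (DP (P u)) = 0.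
Proof.
set z := DP (P u); have PP v : P (P v) = P v.
  by apply: (oproj_id hT); exact: (oprojS hT).
have := dproj_idem (P z) (P u); rewrite !PP -dproj_sym -/z => h.
apply: dotp_eq0; rewrite (dotp_oprojl hT _ (oprojS hT z)) dotpC -/P.
by move: h; lra.
Qed.

Lemma dprojZ a u : DP (a *: u) = a *: DP u.
Proof.
have [c [cw c0 cM dc]] := curve.
apply: (is_derive_eq_near (dc (a *: u)) (is_deriveZ a (dc u))).
by apply: filterS cM => r Mr; rewrite (oprojZ (projectable_tangent hM Mr)).
Qed.

(** The field [y |-> P_y u] is a tangent extension of [u] with derivative [DP u] along [w], and this
    derivative is already normal by [dproj_normal]. *)
Lemma dproj_second_ff u : tangent M x u -> second_ff M x w u (DP u).
Proof.
move=> tu; have [c [cw c0 cM dc]] := curve.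
exists setT, (fun y => oproj (tangent M y) u), c; split => //.
- by split => //; exact: openT.
- exact: (vector_field_oproj hM).
- by rewrite oproj_id.
- rewrite /= derive1E; case: (dc u) => _ ->.
  have := dproj_normal u; rewrite /P (oproj_id hT tu) => ->.
  by rewrite subr0.
Qed.

(** Covers the case in which [C <= (n - d) C] can fail: in codimension 0 the local equations are
    vacuous and every tangent projection is the identity. *)
Lemma dproj_codim0 u : (n <= d)%N -> DP u = 0.
Proof.
move=> nd; have [c [cw c0 cM dc]] := curve.
refine (is_derive_eq_near (dc u) (is_derive_cst u (0 : R) (1 : R)) _).
apply: filterS cM => r Mr; apply: oproj_id; first exact: (projectable_tangent hM Mr).
have [A [h [ch Ax]]] := chart_exists hM Mr.
apply/(tangentP _ ch Ax Mr); apply/rowP => -[k kn]; exfalso.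
by move: kn; rewrite (eqP nd).
Qed.

End second_fundamental_form.

Section dproj_bound.
Context {R : realType} {n d : nat}.
Variable M : set 'rV[R]_n.
Hypothesis hM : embedded_submanifold d M.

Lemma dproj_scale x w a u : M x -> tangent M x w ->
  dproj (d:=d) M x (a *: w) u = a *: dproj (d:=d) M x w u.
Proof.
move=> Mx [c cw]; have c0 : c 0 = x by case: cw => e [].
have cM := curve_through_near cw; have dc := curve_through_derive cw.
have sa : is_derive (0 : R) 1 (fun r : R => r * a) a.
  have := @derivable_line R _ 0 a 0.
  by rewrite (_ : (fun r : R => 0 + r *: a) = fun r => r * a)//; apply/funext => r; rewrite add0r.
have c0a : c (0 * a) = x by rewrite mul0r.
have diffc (W : normedModType R) (f : R -> W) df :
    is_derive (0 : R) 1 f df -> differentiable f (0 * a).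
  by rewrite mul0r => -[/derivable1_diffP].
have dca : is_derive (0 : R) 1 (fun r => c (r * a)) (a *: w).
  have H := @is_derive_comp_curve _ _ _ c (fun r => r * a) 0 a (diffc _ _ _ dc) sa.
  rewrite mul0r derive_scale1 in H; last by apply/derivable1_diffP; case: dc.
  by case: dc H => _ ->.
have caM : \forall r \near (0 : R), M (c (r * a)).
  have := is_derive_continuous sa; rewrite /prop_for/continuous_at mul0r => ca.
  exact: (ca _ cM).
have h1 := dproj_curve hM u caM dca.
have h2 := dproj_curve hM u cM dc.
rewrite c0a in h1; rewrite c0 in h2.
have H := @is_derive_comp_curve _ _ _ (fun r => oproj (tangent M (c r)) u)
  (fun r => r * a) 0 a (diffc _ _ _ h2) sa.
rewrite mul0r derive_scale1 in H; last by apply/derivable1_diffP; case: h2.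
by case: h2 H => _ -> [_ <-]; case: h1 => _ <-.
Qed.

(** The constant is a parameter because two are used: [C] for parallel transport and [(n - d) C] for
    the iteration. Bounding a pairing, rather than a norm, suits the mean value theorem, which acts
    on scalar functions. *)
Definition dproj_bounded (kappa : R) := forall x w a u, M x -> tangent M x w ->
  `|dotp a (dproj (d:=d) M x w u)| <= kappa * enorm w * (enorm a * enorm u).

Variable C : R.
Hypotheses (C0 : 0 <= C) (hII : second_ff_bounded M C).

Lemma enorm_dproj_tangent x w u : M x -> tangent M x w -> tangent M x u ->
  enorm (dproj (d:=d) M x w u) <= C * enorm w * enorm u.
Proof.
move=> Mx tw tu; have hT := projectable_tangent hM Mx.
have [w0|w0] := eqVneq (enorm w) 0.
  have -> : dproj (d:=d) M x w u = 0.
    rewrite (_ : w = 0 *: w); last by rewrite scale0r (enorm_eq0 w0).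
    by rewrite dproj_scale// scale0r.
  by rewrite enorm0 !mulr_ge0.
have [u0|u0] := eqVneq (enorm u) 0.
  have -> : dproj (d:=d) M x w u = 0.
    rewrite (_ : u = 0 *: u); last by rewrite scale0r (enorm_eq0 u0).
    by rewrite dprojZ// scale0r.
  by rewrite enorm0 !mulr_ge0.
have unit (v : 'rV[R]_n) : enorm v != 0 -> enorm ((enorm v)^-1 *: v) = 1.
  by move=> v0; rewrite enormZ ger0_norm ?invr_ge0// mulVf.
have tw' : tangent M x ((enorm w)^-1 *: w) by exact: linsubZ.
have tu' : tangent M x ((enorm u)^-1 *: u) by exact: linsubZ.
have := hII Mx tw' tu' (unit _ w0) (unit _ u0) (dproj_second_ff hM Mx tw' tu').
rewrite dproj_scale// dprojZ// !enormZ !ger0_norm ?invr_ge0// mulrA -invfM.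
rewrite -ler_pdivlMl ?invr_gt0 ?mulr_gt0 ?lt0r ?w0 ?u0 ?enorm_ge0//.
by rewrite invrK mulrC mulrA.
Qed.

(** The derivative of the projection exchanges tangent and normal parts. Its two off-diagonal blocks
    are adjoint and each is bounded through the second fundamental form ([bt]); [oproj_mixed_le]
    adds them without losing a factor 2. *)
Lemma dproj_bounded_second_ff : dproj_bounded C.
Proof.
move=> x w a u Mx tw; have hT := projectable_tangent hM Mx.
have bt z v : `|dotp z (dproj (d:=d) M x w (oproj (tangent M x) v))| <=
    C * enorm w * (enorm (z - oproj (tangent M x) z) * enorm (oproj (tangent M x) v)).
  have -> : dotp z (dproj (d:=d) M x w (oproj (tangent M x) v)) =
      dotp (z - oproj (tangent M x) z) (dproj (d:=d) M x w (oproj (tangent M x) v)).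
    by rewrite dotpBl (oproj_sym hT) (dproj_normal hM Mx tw) dotp0r subr0.
  apply: (le_trans (normr_dotp _ _)).
  rewrite mulrCA ler_wpM2l//; apply: enorm_dproj_tangent => //; exact: oprojS.
rewrite -(dproj_idem hM tw) -(dproj_sym hM tw).
have E : dotp (oproj (tangent M x) a) (dproj (d:=d) M x w u) =
  dotp u (dproj (d:=d) M x w (oproj (tangent M x) a)).
  by rewrite (dproj_sym hM tw) dotpC.
rewrite E (le_trans (ler_normD _ _))// (le_trans (lerD (bt _ _) (bt _ _)))//.
rewrite -mulrDr ler_wpM2l ?mulr_ge0//.
by rewrite [X in _ + X <= _]mulrC oproj_mixed_le.
Qed.

Lemma dproj_bounded_codim : dproj_bounded ((n - d)%:R * C).
Proof.
move=> x w a u Mx tw; have [nd|nd] := leqP n d.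
  rewrite (dproj_codim0 hM tw)// dotp0r normr0 !mulr_ge0//.
apply: (le_trans (dproj_bounded_second_ff _ _ Mx tw)).
rewrite ler_wpM2r ?mulr_ge0// ler_wpM2r// ler_peMl// ler1n subn_gt0//.
Qed.

End dproj_bound.

(** * Retraction curves and geodesic distance *)

(* No measurability is assumed: the integral of a nonnegative function is a
   supremum over the simple functions below it. *)
Lemma ge0_le_integral_sup d (T : measurableType d) (R : realType)
    (mu : {measure set T -> \bar R}) (D : set T) (f g : T -> \bar R) :
  (forall x, D x -> (0 <= f x)%E) -> (forall x, D x -> (f x <= g x)%E) ->
  (\int[mu]_(x in D) f x <= \int[mu]_(x in D) g x)%E.
Proof.
move=> f0 fg; have g0 x : D x -> (0 <= g x)%E.
  by move=> Dx; exact: le_trans (f0 x Dx) (fg x Dx).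
rewrite !ge0_integralE//; apply: le_ereal_sup => _ [h /= hf <-]; exists h => //= x.
apply: (le_trans (hf x)); rewrite /patch; case: ifPn => // xD.
by apply: fg; rewrite inE in xD.
Qed.

Section paths.
Context {R : realType} {n : nat}.
Variable M : set 'rV[R]_n.

Lemma Rintegral_unit_le (g : R -> R) (K : R) :
  (forall t, t \in `[0, 1] -> 0 <= g t <= K) ->
  \int[lebesgue_measure]_(t in `[0, 1]) g t <= K.
Proof.
move=> gK; have K0 : 0 <= K.
  have : 0 \in `[0, (1 : R)] by rewrite in_itv/= lexx ler01.
  by move=> /gK/andP[]; exact: le_trans.
have le1 : (\int[lebesgue_measure]_(t in `[0%R, 1%R]) (g t)%:E <= K%:E)%E.
  apply: (@le_trans _ _ (\int[lebesgue_measure]_(t in `[0%R, 1%R]) K%:E)%E).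
    by apply: ge0_le_integral_sup => t /= /gK /andP[]; rewrite !lee_fin.
  rewrite integral_cst//= lebesgue_measure_itv/= lte_fin ltr01.
  by rewrite oppr0 adde0 mule1.
rewrite /Rintegral -lee_fin fineK//; apply/fin_real/andP; split.
  by apply: (@lt_le_trans _ _ 0%E) => //; apply: integral_ge0 => t /gK/andP[].
exact: le_lt_trans le1 (ltry _).
Qed.

(** A distance bound witnessed by an actual path. It chains additively, and yields both the
    inequality for [gdist] and its finiteness. *)
Definition reach (x y : 'rV[R]_n) (r : R) :=
  exists2 l, path_length M x y l & l <= r.

Lemma path_length_trans x y z l l' :
  path_length M x y l -> path_length M y z l' -> path_length M x z (l + l').
Proof.
move=> xy; elim: xy z l' => [x' _|y' l0 c sc cM _ IH] z l' h; first by rewrite add0r.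
by rewrite -addrA; apply: path_length_cons => //; exact: IH.
Qed.

Lemma reach_refl x : M x -> reach x x 0.
Proof. by move=> Mx; exists 0 => //; exact: path_length_nil. Qed.

Lemma reach_trans x y z r r' : reach x y r -> reach y z r' -> reach x z (r + r').
Proof.
move=> [l xy lr] [l' yz lr']; exists (l + l'); last exact: lerD.
exact: path_length_trans xy yz.
Qed.

Lemma reach_le x y r r' : r <= r' -> reach x y r -> reach x y r'.
Proof. by move=> rr' [l h lr]; exists l => //; exact: le_trans lr rr'. Qed.

Lemma path_length_ge0 x y l : path_length M x y l -> 0 <= l.
Proof.
elim=> [//|y' l0 c _ _ _ l00]; rewrite addr_ge0//.
by apply: fine_ge0; apply: integral_ge0 => t _; rewrite lee_fin.
Qed.

Lemma reach_gdist x y r : reach x y r ->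
  (gdist M x y <= r%:E)%E /\ gdist M x y \is a fin_num.
Proof.
move=> [l h lr].
have le : (gdist M x y <= r%:E)%E.
  apply: (@le_trans _ _ l%:E); last by rewrite lee_fin.
  by apply: ereal_inf_lbound; exists l.
split => //; apply/fin_real/andP; split; last exact: le_lt_trans le (ltry _).
apply: (@lt_le_trans _ _ 0%E) => //; apply: le_ereal_inf_tmp => _ [l' h' <-].
by rewrite lee_fin; exact: path_length_ge0 h'.
Qed.

End paths.

Section retraction_curves.
Context {R : realType} {n d : nat}.
Variable M : set 'rV[R]_n.
Hypothesis hM : embedded_submanifold d M.
Variable Retr : 'rV[R]_n -> 'rV[R]_n -> 'rV[R]_n.
Hypothesis hRetr : is_retraction M Retr.
Variables (x xi : 'rV[R]_n).
Hypotheses (Mx : M x) (txi : tangent M x xi).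

Let gam (t : R) := Retr x (t *: xi).

Lemma retr_M t : M (gam t).
Proof.
case: hRetr => _ h _ _; apply: h => //.
exact: (linsubZ (projectable_tangent hM Mx)).
Qed.

Lemma retr_smooth t : exists I : set R, [/\ open I, I t & forall k, Ck k I gam].
Proof.
have [sR _ _ _] := hRetr.
have tb (r : R) : tangent_bundle M (x, r *: xi).
  by split => //=; exact: (linsubZ (projectable_tangent hM Mx)).
have [U [g [oU Ut CU gR]]] := sR _ (tb t).
pose a : 'rV[R]_n * 'rV[R]_n := (x, 0); pose b : 'rV[R]_n * 'rV[R]_n := (0, xi).
have ab (s : R) : a + s *: b = (x, s *: xi).
  by rewrite /a /b; congr (_, _); rewrite /= ?scaler0 ?addr0 ?add0r.
pose I := (fun s : R => a + s *: b) @^-1` U.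
have oI : open I.
  apply: open_comp => // s _; exact: is_derive_continuous (derivable_line a b s).
exists I; split => //; first by rewrite /I /preimage/= ab.
move=> k; have IU s : I s -> U (a + s *: b) by [].
refine (@eq_Ck _ _ _ k I _ _ oI _ (Ck_line oU oI IU CU k)) => s Is.
by rewrite ab gR// -ab.
Qed.

Lemma retr_derive (t : R) : is_derive t 1 gam (derive1 gam t).
Proof.
have [I [oI It CI]] := retr_smooth t.
have dc : derivable gam t 1.
  by apply/derivable1_diffP; exact: Ck_differentiable (CI 1) It.
by split; [exact: dc|rewrite derive1E].
Qed.

Lemma retr_derive2 (t : R) : is_derive t 1 (derive1 gam) (derive1n 2 gam t).
Proof.
have [I [oI It CI]] := retr_smooth t.
have dE : derive1 gam = 'D_1 gam by apply/funext => s; rewrite derive1E.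
have dc : derivable (derive1 gam) t 1.
  apply/derivable1_diffP; rewrite dE.
  have H := Ck_derive (1 : R) (CI 2); refine (Ck_differentiable H It).
split; [exact: dc|by rewrite -derive1E].
Qed.

Lemma retr_tangent t : tangent M (gam t) (derive1 gam t).
Proof.
apply: (tangent_curve hM _ (retr_derive t)).
by near=> r; exact: retr_M.
Unshelve. all: by end_near. Qed.

Lemma retr_0 : gam 0 = x.
Proof. by case: hRetr => _ _ h _; rewrite /gam scale0r h. Qed.

Lemma retr_derive0 : derive1 gam 0 = xi.
Proof. by case: hRetr => _ _ _; exact. Qed.

Variable C' : R.
Hypothesis hRB : retraction_bounded M Retr C'.

Lemma retr_speed t : enorm (derive1 gam t) <= enorm xi.
Proof. by have [] := hRB t Mx txi. Qed.

(** The mean value theorem is applied to the scalar [s |-> <v, gamma'(s)>] with the fixed vector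
    [v = gamma'(t) - xi], whose increment is [|v|^2]; one factor [|v|] then cancels. *)
Lemma retr_deviation t : 0 <= t ->
  enorm (derive1 gam t - xi) <= C' * enorm xi ^+ 2 * t.
Proof.
move=> t0; set v := _ - xi.
have dv (s : R) (_ : s \in `[0, t]) := is_derive_dotpr v (retr_derive2 s).
have [c c0t] := @MVT_closed _ _ _ 0 t t0 dv.
rewrite retr_derive0 -dotpBr -/v -enorm_sqr subr0 => E.
have [v0|v0] := eqVneq (enorm v) 0.
  have [_] := hRB 0 Mx txi; move/(le_trans (enorm_ge0 _)) => h.
  by rewrite v0 mulr_ge0.
have vp : 0 < enorm v by rewrite lt0r v0 enorm_ge0.
rewrite -(ler_pM2l vp) -expr2 E mulrA ler_wpM2r//.
rewrite (le_trans (dotp_le _ _))// ler_wpM2l//.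
by have [] := hRB c Mx txi.
Qed.

Lemma reach_retr a b : reach M (gam a) (gam b) (`|b - a| * enorm xi).
Proof.
pose c (t : R) := gam (a + t * (b - a)).
have dl (t : R) : is_derive t 1 (fun r : R => a + r * (b - a)) (b - a).
  by have := @derivable_line R _ a (b - a) t.
have dc (t : R) : is_derive t 1 c ((b - a) *: derive1 gam (a + t * (b - a))).
  have dg := retr_derive (a + t * (b - a)).
  have dfg : differentiable gam (a + t * (b - a)).
    by apply/derivable1_diffP; case: dg.
  have H := @is_derive_comp_curve _ _ _ gam (fun r => a + r * (b - a)) t _ dfg (dl t).
  have E : 'D_(b - a) gam (a + t * (b - a)) =
      (b - a) *: derive1 gam (a + t * (b - a)).
    by rewrite (derive_scale1 _ dfg) derive1E.
  rewrite -E; refine H.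
have sc : smooth_on (`[0, 1] : set R) c.
  move=> t _; have [I [oI It CI]] := retr_smooth (a + t * (b - a)).
  pose I' := (fun r : R => a + r *: (b - a)) @^-1` I.
  have oI' : open I'.
    apply: open_comp => // s _; exact: is_derive_continuous (dl s).
  exists I', c; split => // k.
  have II s : I' s -> I (a + s *: (b - a)) by [].
  have H := Ck_line oI oI' II CI k; refine H.
have cM t : t \in `[0, 1] -> M (c t) by move=> _; exact: retr_M.
have E0 : c 0 = gam a by rewrite /c mul0r addr0.
have E1 : c 1 = gam b by rewrite /c mul1r addrC subrK.
rewrite -E0 -E1; eexists.
  by apply: path_length_cons sc cM (path_length_nil _); rewrite E1; exact: retr_M.
rewrite addr0; apply: Rintegral_unit_le => t _.
rewrite enorm_ge0/= derive1E; case: (dc t) => _ ->.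
by rewrite enormZ ler_wpM2l// retr_speed.
Qed.

Variable kappa : R.
Hypothesis hk : dproj_bounded (d:=d) M kappa.

Lemma oproj_retr_lip t a u : 0 <= t ->
  `|dotp a (oproj (tangent M (gam t)) u - oproj (tangent M x) u)| <=
  kappa * enorm xi * t * (enorm a * enorm u).
Proof.
move=> t0; have dv (s : R) (_ : s \in `[0, t]) :
    is_derive s 1 (fun r => dotp a (oproj (tangent M (gam r)) u))
      (dotp a (dproj (d:=d) M (gam s) (derive1 gam s) u)).
  apply: is_derive_dotpr; apply: (dproj_curve hM _ _ (retr_derive s)).
  by near=> r; exact: retr_M.
have [c c0t] := @MVT_closed _ _ _ 0 t t0 dv.
rewrite retr_0 -dotpBr subr0 => ->; rewrite normrM (ger0_norm t0).
rewrite [leRHS](_ : _ = kappa * enorm xi * (enorm a * enorm u) * t); last by ring.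
rewrite ler_wpM2r//.
(* The sign of [kappa] comes from the bound at [xi] itself; it allows [|gamma'|] to be replaced by
   the larger [|xi|]. *)
have k0 : 0 <= kappa * (enorm a * enorm u) * enorm xi.
  have := hk a u Mx txi; move/(le_trans (normr_ge0 _)).
  by rewrite mulrAC.
apply: (le_trans (hk a u (retr_M c) (retr_tangent c))).
have [xi0|xi0] := eqVneq (enorm xi) 0.
  have := retr_speed c; rewrite xi0 => h.
  have -> : enorm (derive1 gam c) = 0 by apply/eqP; rewrite eq_le h enorm_ge0.
  by rewrite !mulr0 !mul0r.
have xp : 0 < enorm xi by rewrite lt0r xi0 enorm_ge0.
rewrite pmulr_lge0// in k0.
rewrite mulrAC [leRHS]mulrAC; exact: (ler_wpM2l k0 (retr_speed c)).
Unshelve. all: by end_near. Qed.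

End retraction_curves.

(** * Riemannian gradients *)

Section riemannian_gradient.
Context {R : realType} {n d : nat}.
Variable M : set 'rV[R]_n.
Hypothesis hM : embedded_submanifold d M.
Variable f : 'rV[R]_n -> R.

(** The tangential projection of the Euclidean gradient of a local extension [g] has the required
    pairings, since [f] and [g] agree along curves of [M]. *)
Lemma rgradP x : rdifferentiable M f x -> is_rgrad M f x (rgrad M f x).
Proof.
move=> df; have [Mx [g gf dg]] := df; have hT := projectable_tangent hM Mx.
pose a : 'rV[R]_n := \row_i 'D_(delta_mx 0 i) g x.
rewrite /rgrad; case: xgetP => // /(_ (oproj (tangent M x) a)); case.
split => //; first exact: oprojS.
move=> xi c cxi; have c0 : c 0 = x by case: cxi => e [].
have dc := curve_through_derive cxi; have cM := curve_through_near cxi.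
have txi : tangent M x xi by exists c.
have dgc : differentiable g (c 0) by rewrite c0.
have H := is_derive_comp_curve dgc dc.
rewrite dotp_oprojl// derive1E (@near_eq_derive _ _ _ _ (g \o c)).
  case: H => _ ->; rewrite c0 deriveE_coord//; apply: eq_bigr => i _.
  by rewrite mxE -[_ *: _]/(_ * _) mulrC.
have cc := is_derive_continuous dc; rewrite /prop_for/continuous_at c0 in cc.
near=> t; apply/esym; have : M (c t) by near: t.
by near: t; exact: (cc _ gf).
Unshelve. all: by end_near. Qed.

Lemma rgrad_tangent x : M x -> tangent M x (rgrad M f x).
Proof.
move=> Mx; rewrite /rgrad; case: xgetP => [v _ []//|_].
exact: (linsub0 (projectable_tangent hM Mx)).
Qed.

(** [is_rgrad] speaks of smooth curves only. A smooth curve [c'] with the same velocity at the same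
    point is chosen, and both derivatives are computed as ['D_w g] for one extension [g]. *)
Lemma rgrad_curve (c : R -> 'rV[R]_n) (t : R) w :
  (\forall r \near t, M (c r)) -> is_derive t 1 c w -> rdifferentiable M f (c t) ->
  is_derive t 1 (f \o c) (dotp (rgrad M f (c t)) w).
Proof.
move=> cM dc df; have [_ _ hg] := rgradP df; have [Mx [g gf dg]] := df.
have [c' cw] := tangent_curve hM cM dc.
have c0 : c' 0 = c t by case: cw => e [].
rewrite -(hg _ _ cw) derive1E.
have dc' := curve_through_derive cw; have cM' := curve_through_near cw.
have dg' : differentiable g (c' 0) by rewrite c0.
have H := is_derive_comp_curve dg dc; have H' := is_derive_comp_curve dg' dc'.
have -> : 'D_1 (f \o c') 0 = 'D_w g (c t).
  rewrite -c0; case: H' => _ <-; apply: near_eq_derive.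
  have cc := is_derive_continuous dc'; rewrite /prop_for/continuous_at c0 in cc.
  near=> r; apply/esym; have : M (c' r) by near: r.
  by near: r; exact: (cc _ gf).
apply: near_eq_is_derive H.
have cc := is_derive_continuous dc; rewrite /prop_for/continuous_at in cc.
near=> r; have : M (c r) by near: r.
by near: r; exact: (cc _ gf).
Unshelve. all: by end_near. Qed.

Lemma rdifferentiable_cvg x : rdifferentiable M f x ->
  forall e, 0 < e -> exists U, [/\ open U, U x & forall y, U y -> M y -> `|f x - f y| < e].
Proof.
move=> [Mx [g gf dg]] e e0.
have gx := nbhs_singleton gf Mx.
have : \forall y \near x, M y -> `|f x - f y| < e.
  have := differentiable_continuous dg; rewrite /continuous_at.
  move=> /cvgrPdist_lt/(_ e e0) => h; apply: filterS2 gf h => y gy gxy My.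
  by rewrite -gx -gy.
move=> h; exists (interior [set y | M y -> `|f x - f y| < e]); split.
- exact: open_interior.
- exact: h.
- by move=> y /interior_subset; exact.
Qed.

End riemannian_gradient.

Lemma is_derive_lipschitz_le (R : realType) (phi : R -> R) (K dphi : R) :
  is_derive (0 : R) 1 phi dphi ->
  (forall s, 0 <= s -> `|phi s - phi 0| <= K * s) -> dphi <= K.
Proof.
move=> dp hK; rewrite leNgt; apply/negP => Kd.
have [dd dE] := dp; rewrite -dE in Kd.
have e0 : 0 < 'D_1 phi 0 - K by rewrite subr_gt0.
have /cvgrPdist_lt/(_ _ e0) := dd.
move=> [r /= r0 hr].
have r2 : 0 < r / 2 by rewrite divr_gt0.
have h1 : `|0 - r / 2| < r.
  by rewrite sub0r normrN gtr0_norm// ltr_pdivrMr// ltr_pMr// ltr1n.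
have h2 : r / 2 != 0 by rewrite gt_eqF.
have /= := hr (r / 2) h1 h2.
rewrite -[_ *: 1]/(_ * 1) mulr1 addr0 -[_ *: (_ - _)]/(_ * _).
have := hK (r / 2) (ltW r2) => /(le_trans (ler_norm _)).
rewrite -ler_pdivrMr// mulrC => h; apply/negP; rewrite -leNgt.
apply: (le_trans _ (ler_norm _)); rewrite lerD2l lerN2//.
Qed.

(** * Parallel transport *)

Section unit_interval.
Context {R : realType}.

Lemma cvg_sum_ord (T : Type) (F : set_system T) (FF : Filter F)
    (V : normedModType R) m (f : 'I_m -> T -> V) (a : 'I_m -> V) :
  (forall i, f i t @[t --> F] --> a i) ->
  (\sum_(i < m) f i t) @[t --> F] --> \sum_(i < m) a i.
Proof.
elim: m f a => [|m IH] f a h.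
  rewrite big_ord0 (_ : (fun t => _) = cst 0); first exact: cvg_cst.
  by apply/funext => t; rewrite big_ord0.
rewrite big_ord_recr/= (_ : (fun t => _) =
  fun t => (\sum_(i < m) f (widen_ord (leqnSn m) i) t) + f ord_max t); last first.
  by apply/funext => t; rewrite big_ord_recr.
by apply: cvgD; [exact: IH|exact: h].
Qed.

Definition clamp01 (t : R) : R := Num.max 0 (Num.min 1 t).

Lemma clamp01_in t : clamp01 t \in `[0, 1].
Proof.
rewrite in_itv/= /clamp01; apply/andP; split; first by rewrite le_max lexx.
by rewrite ge_max ler01/= ge_min lexx.
Qed.

Lemma clamp01_id t : t \in `[0, 1] -> clamp01 t = t.
Proof. by rewrite in_itv/= => /andP[t0 t1]; rewrite /clamp01 min_r// max_r. Qed.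

Lemma clamp01_continuous : continuous clamp01.
Proof.
move=> y; apply/cvgrPdist_lt => e e0; have := nbhsx_ballx y e e0.
apply: filterS => z; rewrite -ball_normE/=; apply: le_lt_trans.
have := ler_norm (y - z); have := ler_norm (- (y - z)); rewrite normrN => h1 h2.
rewrite ler_norml /clamp01; apply/andP; split;
 case: (leP 1 y) => h4; case: (leP 1 z) => h5;
 case: (leP 0 _) => h6; try (case: (leP 0 _) => h7); lra.
Qed.

Lemma MVT_continuous (f df : R -> R) (a b : R) : a <= b -> continuous f ->
  (forall t : R, t \in `]a, b[ -> is_derive t 1 f (df t)) ->
  exists2 c, c \in `[a, b] & f b - f a = df c * (b - a).
Proof.
move=> ab cf h; have H := @MVT_segment R f df a b ab h; apply: H.
exact: continuous_subspaceT.
Qed.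

Lemma MVT_continuous_lt (f df : R -> R) (a b : R) : a < b -> continuous f ->
  (forall t : R, t \in `]a, b[ -> is_derive t 1 f (df t)) ->
  exists2 c, c \in `]a, b[ & f b - f a = df c * (b - a).
Proof.
move=> ab cf h; have H := @MVT R f df a b ab h; apply: H.
exact: continuous_subspaceT.
Qed.

(** Smoothness on [[0, 1]] gives extensions near each point but no control on the derivative of [f]
    at the endpoints. The derivative is read off from the extension chosen at each point; it is
    continuous because in the interior all extensions have the same derivative. Precomposing with
    [clamp01] makes it bounded on the whole line. *)
Lemma C1_glue m (f : R -> 'rV[R]_m) :
  (forall t0 : R, t0 \in `[0, 1] -> exists (U : set R) (q dq : R -> 'rV[R]_m),
    [/\ open U, U t0, forall t : R, U t -> is_derive t 1 q (dq t),
        forall t : R, U t -> {for t, continuous dq}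
      & forall t, U t -> t \in `[0, 1] -> f t = q t]) ->
  exists ft df : R -> 'rV[R]_m, [/\ continuous ft, continuous df,
    forall t, t \in `[0, 1] -> ft t = f t,
    forall t : R, t \in `]0, 1[ -> is_derive t 1 f (df t)
    & exists2 K, 0 <= K & forall t, `|df t| <= K].
Proof.
move=> loc.
have /boolp.choice[Q hQ] : forall t0 : R, exists Q : set R * (R -> 'rV[R]_m) * (R -> 'rV[R]_m),
    t0 \in `[0, 1] -> [/\ open Q.1.1, Q.1.1 t0,
      forall t : R, Q.1.1 t -> is_derive t 1 Q.1.2 (Q.2 t),
      forall t : R, Q.1.1 t -> {for t, continuous Q.2}
      & forall t, Q.1.1 t -> t \in `[0, 1] -> f t = Q.1.2 t].
  move=> t0; case: (boolP (t0 \in `[0, 1])) => [/loc[U [q [dq H]]]|_].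
    by exists (U, q, dq).
  by exists (set0, f, f).
pose b t := (Q t).2 t.
have oo : open (`]0, 1[%classic : set R) by exact: interval_open.
have sub t : t \in `]0, (1 : R)[ -> t \in `[0, 1] by exact: subset_itv_oo_cc.
have fder (t0 t : R) : t0 \in `[0, 1] -> (Q t0).1.1 t -> t \in `]0, 1[ ->
    is_derive t 1 f ((Q t0).2 t).
  move=> /hQ[oU Ut0 dq cq fq] Ut t01; apply: near_eq_is_derive (dq t Ut).
  have nt := open_nbhs_nbhs (conj (openI oU oo) (conj Ut t01)).
  by apply: filterS nt => r [Ur r01]; rewrite (fq r Ur)//; exact: sub.
have bE t0 t : t0 \in `[0, 1] -> (Q t0).1.1 t -> t \in `]0, 1[ -> b t = (Q t0).2 t.
  move=> t00 Ut t01; have [oU Ut' _ _ _] := hQ t (sub _ t01).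
  apply: (is_derive_eq_near (fder t t (sub _ t01) Ut' t01) (fder t0 t t00 Ut t01)).
  by near=> r.
have bnear (t0 : R) : t0 \in `[0, 1] -> \forall t \near t0, t \in `[0, 1] -> b t = (Q t0).2 t.
  move=> t01; have [oU Ut0 _ _ _] := hQ t0 t01.
  have n1 := open_nbhs_nbhs (conj oU Ut0).
  have n2 := nbhsx_ballx t0 1 ltr01.
  (* Near an endpoint every other point of [[0, 1]] is interior, so [b] is compared with the
     extension at [t0] through interior points only. *)
  have n3 : \forall t \near t0, t \in `[0, 1] -> t != t0 -> t \in `]0, 1[.
    have [i0|i0] := boolP (t0 \in `]0, (1 : R)[).
      by apply: filterS (open_nbhs_nbhs (conj oo i0)).
    apply: filterS n2 => t; rewrite -ball_normE/= ltr_norml => /andP[h1 h2].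
    move: t01 i0; rewrite !in_itv/= !negb_and -!leNgt => /andP[a0 a1] i0 /andP[t00 t1] tt0.
    move: i0 => /orP[i0|i0].
      have E : t0 = 0 by apply/eqP; rewrite eq_le i0 a0.
      have t0' : 0 < t by rewrite lt0r t00 -E tt0.
      by rewrite E in h1; apply/andP; split; lra.
    have E : t0 = 1 by apply/eqP; rewrite eq_le i0 a1.
    have t1' : t < 1 by rewrite lt_neqAle t1 -E tt0.
    by rewrite E in h2; apply/andP; split; lra.
  apply: filterS2 n1 n3 => t Ut h tt.
  have [->//|ne] := eqVneq t t0.
  by apply: bE => //; exact: h.
have cdf : continuous (fun t => b (clamp01 t)).
  move=> s; set t0 := clamp01 s; have t01 : t0 \in `[0, 1] by exact: clamp01_in.
  have [oU Ut0 _ cq _] := hQ t0 t01.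
  have e1 : \forall r \near s, (Q t0).2 (clamp01 r) = b (clamp01 r).
    have H : \forall r \near s, clamp01 r \in `[0, 1] ->
        b (clamp01 r) = (Q t0).2 (clamp01 r).
      exact: (@clamp01_continuous s _ (bnear t0 t01)).
    by move: H; apply: filterS => r h; apply/esym/h/clamp01_in.
  have H2 : (fun r => (Q t0).2 (clamp01 r)) @ s --> b (clamp01 s).
    exact: (@continuous_comp _ _ _ clamp01 (Q t0).2 s (@clamp01_continuous s) (cq t0 Ut0)).
  refine (cvg_trans _ H2); exact: near_eq_cvg.
have cft : continuous (fun t => f (clamp01 t)).
  move=> s; set t0 := clamp01 s; have t01 : t0 \in `[0, 1] by exact: clamp01_in.
  have [oU Ut0 dq _ fq] := hQ t0 t01.
  have e1 : \forall r \near s, (Q t0).1.2 (clamp01 r) = f (clamp01 r).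
    have H : \forall r \near s, (Q t0).1.1 (clamp01 r).
      exact: (@clamp01_continuous s _ (open_nbhs_nbhs (conj oU Ut0))).
    by move: H; apply: filterS => r h; apply/esym/fq => //; exact: clamp01_in.
  have H2 : (fun r => (Q t0).1.2 (clamp01 r)) @ s --> (Q t0).1.2 (clamp01 s).
    exact: (@continuous_comp _ _ _ clamp01 (Q t0).1.2 s (@clamp01_continuous s)
      (is_derive_continuous (dq t0 Ut0))).
  rewrite -/t0 -(fq t0 Ut0 t01) in H2.
  refine (cvg_trans _ H2); exact: near_eq_cvg.
exists (fun t => f (clamp01 t)), (fun t => b (clamp01 t)); split => //.
- by move=> t /clamp01_id ->.
- move=> t t01; rewrite clamp01_id; last exact: sub.
  have [oU Ut _ _ _] := hQ t (sub _ t01).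
  exact: fder (sub _ t01) Ut t01.
- have cn : {within `[0, (1 : R)], continuous (fun t => `|b (clamp01 t)|)}.
    apply: continuous_subspaceT => t.
    apply: (@continuous_comp _ _ _ (fun t => b (clamp01 t)) (fun z => `|z|)).
      exact: cdf.
    exact: norm_continuous.
  have [c c01 hc] := EVT_max ler01 cn.
  exists `|b (clamp01 c)| => // t; have := hc _ (clamp01_in t).
  by rewrite (clamp01_id (clamp01_in t)).
Unshelve. all: by end_near. Qed.

End unit_interval.

Lemma oproj_coord (R : realType) (n : nat) (S : set 'rV[R]_n) u :
  projectable S ->
  oproj S u = \sum_i u ord0 i *: oproj S (delta_mx 0 i).
Proof.
move=> hS; rewrite {1}(row_sum_delta u) oproj_sum//.
by apply: eq_bigr => i _; rewrite oprojZ.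
Qed.

Section parallel_transport.
Context {R : realType} {n d : nat}.
Variable M : set 'rV[R]_n.
Hypothesis hM : embedded_submanifold d M.
Variable c : R -> 'rV[R]_n.
Hypotheses (sc : smooth_on (`[0, 1] : set R) c)
  (cM : forall t, t \in `[0, 1] -> M (c t)).

Lemma C1_curve : exists ct dc : R -> 'rV[R]_n, [/\ continuous ct, continuous dc,
  forall t, t \in `[0, 1] -> ct t = c t,
  forall t : R, t \in `]0, 1[ -> is_derive t 1 c (dc t)
  & exists2 K, 0 <= K & forall t, `|dc t| <= K].
Proof.
apply: C1_glue => t0 t01; have [U [g [oU Ut CU gc]]] := sc t01.
have dg (t : R) : U t -> is_derive t 1 g ('D_1 g t).
  move=> Ut'; split => [|//].
  by apply/derivable1_diffP; exact: Ck_differentiable (CU 1) Ut'.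
exists U, g, ('D_1 g); split; [exact: oU|exact: Ut|exact: dg| |].
  exact: (Ck_derive (1 : R) (CU 1)).
by move=> t Ut' t'01; rewrite gc.
Qed.

Lemma C1_oproj u : exists pt dp : R -> 'rV[R]_n,
  [/\ continuous pt, continuous dp,
  forall t, t \in `[0, 1] -> pt t = oproj (tangent M (c t)) u,
  forall t : R, t \in `]0, 1[ ->
    is_derive t 1 (fun t => oproj (tangent M (c t)) u) (dp t)
  & exists2 K, 0 <= K & forall t, `|dp t| <= K].
Proof.
apply: C1_glue => t0 t01; have [U [g [oU Ut CU gc]]] := sc t01.
have gt0 : g t0 = c t0 by exact: gc.
have [A [h [ch Ax]]] := chart_exists hM (cM t01); have [oA Ch hA uA] := ch.
have dg (t : R) : U t -> is_derive t 1 g ('D_1 g t).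
  move=> Ut'; split => [|//].
  by apply/derivable1_diffP; exact: Ck_differentiable (CU 1) Ut'.
have CK := Ck_kerproj oA Ch uA.
pose K y := u *m kerproj h y.
pose dq t : 'rV[R]_n := \sum_i ('D_1 g t) ord0 i *: 'D_(delta_mx 0 i) K (g t).
pose W := U `&` [set t | A (g t)].
have oW : open W.
  rewrite openE => t [Ut' At]; rewrite /interior.
  have n1 := open_nbhs_nbhs (conj oU Ut').
  have n2 := is_derive_continuous (dg t Ut') (open_nbhs_nbhs (conj oA At)).
  by apply: filterS2 n1 n2.
exists W, (K \o g), dq; split; first exact: oW.
- by split => //=; rewrite gt0.
- move=> t [Ut' At]; have dK : differentiable K (g t).
    exact: Ck_differentiable (CK 1 u) At.
  have := is_derive_comp_curve dK (dg t Ut').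
  by rewrite (deriveE_coord _ dK).
- move=> t [Ut' At]; rewrite /dq.
  apply: cvg_sum_ord => i; apply: cvgZ.
    apply: (@continuous_comp _ _ _ ('D_1 g) (fun z : 'rV[R]_n => z ord0 i)).
      exact: (Ck_derive (1 : R) (CU 1)).
    exact: coord_continuous.
  apply: (@continuous_comp _ _ _ g ('D_(delta_mx 0 i) K)).
    exact: is_derive_continuous (dg t Ut').
  exact: (Ck_derive (delta_mx 0 i) (CK 1 u)).
- move=> t [Ut' At] t'01; rewrite /K/= gc//; apply: (oproj_kerproj hM _ ch).
    by rewrite -gc.
  exact: cM.
Qed.

Lemma dproj_coord x w u : M x -> tangent M x w ->
  dproj (d:=d) M x w u = \sum_i u ord0 i *: dproj (d:=d) M x w (delta_mx 0 i).
Proof.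
move=> Mx tw; apply/eqP; rewrite -subr_eq0; apply/eqP/dotp_eq0.
set z := _ - _; rewrite {2}/z dotpBr [X in _ - X]dotpC dotp_suml.
rewrite (dproj_sym hM tw) {1}(row_sum_delta u) dotpC dotp_suml -sumrB big1// => i _.
by rewrite !dotpZl dotpC [X in _ - _ * X]dotpC (dproj_sym hM tw) subrr.
Qed.

(** Why the solution of [V' = P' V] is tangent: its normal part [W = V - P V] has derivative
    [- P P' V], orthogonal to [W], so [|W|] keeps its initial value 0. Then [V' = P' P V] is normal,
    which makes [V] parallel and [|V|] constant. *)
Lemma parallel_transport v : tangent M (c 0) v ->
  exists V, [/\ parallel_along M c V, V 0 = v
    & forall C, 0 <= C -> dproj_bounded (d:=d) M C ->
      enorm (V 1 - v) <= C * enorm v *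
        \int[lebesgue_measure]_(t in `[0, 1]) enorm (derive1 c t)].
Proof.
move=> tv; have [ct [dc [cct cdc ctE dcE [Kc Kc0 hKc]]]] := C1_curve.
have /boolp.choice[P hP] i := C1_oproj (delta_mx 0 i).
have /boolp.choice[DP {}hP] i := hP i.
have sub t : t \in `]0, (1 : R)[ -> t \in `[0, 1] by exact: subset_itv_oo_cc.
have oo : open (`]0, 1[%classic : set R) by exact: interval_open.
have nearM (t : R) : t \in `]0, 1[ -> \forall r \near t, M (c r).
  move=> t01; apply: filterS (open_nbhs_nbhs (conj oo t01)) => r r01.
  by apply: cM; exact: sub.
have tdc t : t \in `]0, 1[ -> tangent M (c t) (dc t).
  by move=> t01; exact: (tangent_curve hM (nearM t t01) (dcE t t01)).
have DPE t i : t \in `]0, 1[ -> DP i t = dproj (d:=d) M (c t) (dc t) (delta_mx 0 i).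
  move=> t01; have [_ _ _ h _] := hP i.
  have h2 := dproj_curve hM (delta_mx 0 i) (nearM t t01) (dcE t t01).
  by apply: (is_derive_eq_near (h t t01) h2); near=> r.
have hT t (t01 : t \in `[0, 1]) := projectable_tangent hM (cM t01).
(* The linear equation in coordinates: the coefficients [DP i] are continuous and bounded on the
   whole line, as [picard] requires, and agree with [dproj] on the open interval. *)
pose F (t : R) (y : 'rV[R]_n) := \sum_i y ord0 i *: DP i t.
have FE t y : t \in `]0, 1[ -> F t y = dproj (d:=d) M (c t) (dc t) y.
  move=> t01; rewrite [RHS]dproj_coord; [|exact/cM/sub|exact: tdc].
  by apply: eq_bigr => i _; rewrite DPE.
have /boolp.choice[K hK] : forall i, exists K, 0 <= K /\ forall t, `|DP i t| <= K.
  by move=> i; case: (hP i) => _ _ _ _ [K K0 h]; exists K.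
have cF (y : R -> 'rV[R]_n) : continuous y -> continuous (fun t => F t (y t)).
  move=> cy t; rewrite /F.
  apply: cvg_sum_ord => i; apply: cvgZ.
    apply: (@continuous_comp _ _ _ y (fun z : 'rV[R]_n => z ord0 i)); first exact: cy.
    exact: coord_continuous.
  by case: (hP i) => _ cDP _ _ _; exact: cDP.
have FL (t : R) y : `|F t y| <= (\sum_i K i + 1) * `|y|.
  apply: (le_trans (ler_norm_sum _ _ _)).
  apply: (@le_trans _ _ (\sum_i K i * `|y|)).
    apply: ler_sum => i _; rewrite normrZ mulrC ler_pM//; first by case: (hK i).
    exact: normr_coord.
  by rewrite -mulr_suml mulrDl mul1r lerDl.
have L0 : 0 < \sum_i K i + 1.
  by rewrite ltr_wpDl// sumr_ge0// => i _; case: (hK i).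
have lF (t : R) y z : `|F t y - F t z| <= (\sum_i K i + 1) * `|y - z|.
  have -> : F t y - F t z = F t (y - z).
    by rewrite /F -sumrB; apply: eq_bigr => i _; rewrite -scalerBl !mxE.
  exact: FL.
have B0 : 0 <= (\sum_i K i + 1) * `|v| by rewrite mulr_ge0// ltW.
have [V V0 dV] := @picard _ _ F v _ _ L0 B0 cF lF (fun t => FL t v).
have cV : continuous V by move=> t; exact: is_derive_continuous (dV t).
pose W (t : R) := V t - \sum_i V t ord0 i *: P i t.
have WE t : t \in `[0, 1] -> W t = V t - oproj (tangent M (c t)) (V t).
  move=> t01; rewrite /W (oproj_coord _ (hT t t01)).
  congr (_ - _); apply: eq_bigr => i _; congr (_ *: _).
  by case: (hP i) => _ _ PE _ _; rewrite PE.
have cW : continuous W.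
  move=> t; apply: cvgB; first exact: cV.
  apply: cvg_sum_ord => i; apply: cvgZ.
    apply: (@continuous_comp _ _ _ V (fun z : 'rV[R]_n => z ord0 i)); first exact: cV.
    exact: coord_continuous.
  by case: (hP i) => cP _ _ _ _; exact: cP.
have cdotp (f : R -> 'rV[R]_n) : continuous f -> continuous (fun t => dotp (f t) (f t)).
  move=> cf t; rewrite /dotp.
  have ci i : (fun r => f r ord0 i) @ t --> f t ord0 i.
    apply: (@continuous_comp _ _ _ f (fun z : 'rV[R]_n => z ord0 i)); first exact: cf.
    exact: coord_continuous.
  by apply: cvg_sum_ord => i; exact: cvgM (ci i) (ci i).
have dW (t : R) : t \in `]0, 1[ ->
    is_derive t 1 W (- oproj (tangent M (c t)) (dproj (d:=d) M (c t) (dc t) (V t))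
      - (dproj (d:=d) M (c t) (dc t) (V t) - dproj (d:=d) M (c t) (dc t) (V t))).
  move=> t01; have t01' := sub t t01.
  have h i : is_derive t 1 (fun t => V t ord0 i *: P i t)
      (V t ord0 i *: DP i t + (F t (V t)) ord0 i *: P i t).
    have dPi : is_derive t 1 (P i) (DP i t).
      case: (hP i) => _ _ PE hd _; apply: near_eq_is_derive (hd t t01).
      by apply: filterS (open_nbhs_nbhs (conj oo t01)) => r r01; rewrite PE//; exact: sub.
    apply: is_derive_row => j.
    have H := @is_deriveM _ _ _ _ t 1 _ _ (is_derive_coord i (dV t)) (is_derive_coord j dPi).
    rewrite (_ : (fun r => _) = (fun r => V r ord0 i) * (fun r => P i r ord0 j)); last first.
      by apply/funext => r; rewrite mxE.
    by apply: (is_derive_eq H); rewrite !mxE /GRing.scale/= [X in _ + X]mulrC.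
  have hs := is_deriveB (dV t) (is_derive_sum h).
  rewrite (_ : W = V - \sum_i (fun t => V t ord0 i *: P i t)); last first.
    by apply/funext => r; rewrite -[RHS]/(_ - (\sum_i (fun t => V t ord0 i *: P i t)) r) fct_sumE.
  apply: (is_derive_eq hs); rewrite big_split/= -/(F t (V t)) FE//.
  set z := dproj _ _ _ _.
  have -> : oproj (tangent M (c t)) z = \sum_i z ord0 i *: P i t.
    rewrite (oproj_coord _ (hT t t01')); apply: eq_bigr => i _; congr (_ *: _).
    by case: (hP i) => _ _ PE _ _; rewrite PE.
  by rewrite subrr subr0 opprD addrA subrr add0r.
have W0 t : t \in `[0, 1] -> W t = 0.
  move=> t01; have t0 : 0 <= t by move: t01; rewrite in_itv/= => /andP[].
  apply: dotp_eq0.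
  have sub' r : r \in `]0, t[ -> r \in `]0, 1[.
    move: t01; rewrite !in_itv/= => /andP[_ t1] /andP[-> rt]/=; exact: lt_le_trans rt t1.
  have d0 (r : R) : r \in `]0, t[ -> is_derive r 1 (fun r => dotp (W r) (W r)) 0.
    move=> /sub' r01; have r01' := sub r r01.
    have H := is_derive_dotp (dW r r01) (dW r r01).
    have Z z : dotp (W r) (- oproj (tangent M (c r)) z - (z - z)) = 0.
      rewrite subrr subr0 dotpNr (WE r r01') (oproj_perp (hT r r01')) ?oppr0//.
      exact: (oprojS (hT r r01')).
    by apply: (is_derive_eq H); rewrite [X in X + _]dotpC Z addr0.
  have [r _] := MVT_continuous t0 (@cdotp W (@cW)) d0.
  have tv0 : W 0 = 0.
    rewrite WE; last by rewrite in_itv/= lexx ler01.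
    have i0 : (0 : R) \in `[0, 1] by rewrite in_itv/= lexx ler01.
    by rewrite V0 (oproj_id (hT 0 i0))// subrr.
  by rewrite mul0r tv0 dotp0l subr0.
have Vt t : t \in `[0, 1] -> oproj (tangent M (c t)) (V t) = V t.
  by move=> t01; have := W0 t t01; rewrite WE// => /eqP; rewrite subr_eq0 => /eqP.
have tV t : t \in `[0, 1] -> tangent M (c t) (V t).
  by move=> t01; rewrite -Vt//; exact: (oprojS (hT t t01)).
have nV t : t \in `]0, 1[ -> oproj (tangent M (c t)) (F t (V t)) = 0.
  move=> t01; have t01' := sub t t01; rewrite FE// -(Vt t t01').
  exact: (dproj_normal hM (cM t01') (tdc t t01)).
exists V; split => //.
  split => //; first exact: continuous_subspaceT.
  move=> t t01; split; first by case: (dV t).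
  by rewrite derive1E; case: (dV t) => _ ->; exact: nV.
have nVc t : t \in `[0, 1] -> enorm (V t) = enorm v.
  move=> t01; have t0 : 0 <= t by move: t01; rewrite in_itv/= => /andP[].
  have sub' r : r \in `]0, t[ -> r \in `]0, 1[.
    move: t01; rewrite !in_itv/= => /andP[_ t1] /andP[-> rt]/=; exact: lt_le_trans rt t1.
  have d0 (r : R) : r \in `]0, t[ -> is_derive r 1 (fun r => dotp (V r) (V r)) 0.
    move=> /sub' r01; have r01' := sub r r01.
    have H := is_derive_dotp (dV r) (dV r).
    apply: (is_derive_eq H); rewrite [X in X + _]dotpC -(Vt r r01').
    rewrite (oproj_sym (hT r r01')) (Vt r r01') nV// dotp0r.
    by rewrite addr0.
  have [r _] := MVT_continuous t0 (@cdotp V (@cV)) d0.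
  rewrite mul0r V0 => /eqP; rewrite subr_eq0 => /eqP E.
  by rewrite /enorm E.
move=> C C0 hC.
have cs : continuous (fun t => enorm (dc t)).
  move=> t; apply: (@continuous_comp _ _ _ (fun t => dotp (dc t) (dc t)) Num.sqrt).
    exact: cdotp.
  exact: sqrt_continuous.
have [S S0 dS] := antiderivative (@cs).
(* [S] integrates the speed of the continuous extension [dc], whereas the length uses [derive1 c],
   uncontrolled at 0 and 1. The comparison takes place on the open interval; the endpoint values
   enter [K'] only to show that the length is finite. *)
have lenS : S 1 <= \int[lebesgue_measure]_(t in `[0, 1]) enorm (derive1 c t).
  have E1 : (\int[lebesgue_measure]_(t in `[0%R, 1%R]) (enorm (dc t))%:E = (S 1)%:E)%E.
    rewrite (@continuous_FTC2 _ _ S)//.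
    - by rewrite S0 sube0.
    - exact: continuous_subspaceT.
    - have cS t : S @ t --> S t by exact: is_derive_continuous (dS t).
      split.
      + by move=> t _; case: (dS t).
      + exact: cvg_at_right_filter (cS 0).
      + exact: cvg_at_left_filter (cS 1).
    - by move=> t _; rewrite derive1E; case: (dS t).
  have ms (D : set R) : measurable D ->
      measurable_fun D (EFin \o (fun t : R => enorm (dc t))).
    move=> mD; apply/measurable_EFinP; apply: measurable_funTS.
    exact: continuous_measurable_fun.
  rewrite -integral_itv_bndo_bndc in E1; last exact: ms.
  rewrite -integral_itv_obnd_cbnd in E1; last exact: ms.
  rewrite /Rintegral -lee_fin -E1 fineK; last first.
    apply/fin_real/andP; split.
      by apply: (@lt_le_trans _ _ 0%E) => //; apply: integral_ge0 => t _; rewrite lee_fin.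
    pose K' := n%:R * Kc + enorm (derive1 c 0) + enorm (derive1 c 1).
    apply: (@le_lt_trans _ _ (\int[lebesgue_measure]_(t in `[0%R, 1%R]) K'%:E)%E).
      apply: ge0_le_integral_sup => t t01; rewrite lee_fin//.
      have nK : 0 <= n%:R * Kc by rewrite mulr_ge0.
      have [->|tn0] := eqVneq t 0.
        by rewrite /K' -addrA addrCA lerDl addr_ge0.
      have [->|tn1] := eqVneq t 1; first by rewrite /K' lerDr addr_ge0.
      have t01' : t \in `]0, 1[.
        move: t01; rewrite /= !in_itv/= => /andP[t0 t1].
        by rewrite lt0r tn0 t0 lt_neqAle tn1.
      rewrite derive1E; case: (dcE t t01') => _ ->.
      apply: (le_trans (enorm_le_normr _)); rewrite /K' -addrA.
      rewrite (le_trans (_ : _ <= n%:R * Kc)) ?lerDl ?addr_ge0//.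
      by rewrite ler_wpM2l.
    rewrite integral_cst//= lebesgue_measure_itv/= lte_fin ltr01.
    by rewrite oppr0 adde0 mule1 ltry.
  apply: (@le_trans _ _ (\int[lebesgue_measure]_(t in `]0%R, 1%R[) (enorm (derive1 c t))%:E)%E).
    rewrite le_eqVlt; apply/orP; left; apply/eqP; apply: eq_integral => t.
    by rewrite inE/= => t01; rewrite derive1E; case: (dcE t t01) => _ ->.
  rewrite [leLHS]integral_mkcond [leRHS]integral_mkcond.
  apply: ge0_le_integral_sup => t _; rewrite /patch.
    by case: ifP => // _; rewrite lee_fin.
  case: ifPn => [|_]; last by case: ifP => // _; rewrite lee_fin.
  by rewrite inE/= => t01; rewrite ifT// inE/=; exact: sub.
have [vz|vz] := eqVneq (enorm (V 1 - v)) 0.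
  rewrite vz !mulr_ge0//; apply: (le_trans _ lenS).
  rewrite -S0; have [r _] := MVT_closed ler01 (fun r _ => dS r).
  by rewrite subr0 mulr1 => E; rewrite -subr_ge0 E.
pose a := V 1 - v.
have ap : 0 < enorm a by rewrite lt0r vz enorm_ge0.
(* [psi' >= 0] on the open interval by the bound on [P'], and one application of the mean value
   theorem yields [|a|^2 <= C |v| |a| S(1)]. *)
pose psi t := C * enorm v * enorm a * S t - dotp a (V t).
have dpsi : forall t : R, is_derive t 1 psi
    (C * enorm v * enorm a * enorm (dc t) - dotp a (F t (V t))).
  move=> s; have h2 := is_derive_dotpr a (dV s).
  have h1 := is_deriveZ (C * enorm v * enorm a) (dS s).
  have H := is_deriveB h1 h2; refine H.
have cpsi : continuous psi by move=> t; exact: is_derive_continuous (dpsi t).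
have [r r01] := MVT_continuous_lt ltr01 (@cpsi) (fun (t : R) _ => dpsi t).
rewrite subr0 mulr1 /psi S0 mulr0 V0 => E.
have : 0 <= C * enorm v * enorm a * enorm (dc r) - dotp a (F r (V r)).
  have r01' := sub r r01.
  rewrite subr_ge0 FE// (le_trans (ler_norm _))//.
  rewrite (le_trans (hC _ _ a (V r) (cM r01') (tdc r r01)))//.
  by rewrite nVc// le_eqVlt; apply/orP; left; apply/eqP; ring.
rewrite -E => h; rewrite -(ler_pM2l ap) -/a.
have -> : enorm a * enorm a = dotp a (V 1) - dotp a v.
  by rewrite -dotpBr -enorm_sqr expr2.
apply: (@le_trans _ _ (C * enorm v * enorm a * S 1)); first by lra.
rewrite [leLHS](_ : _ = enorm a * (C * enorm v * S 1)); last by ring.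
rewrite ler_pM2l//; apply: ler_wpM2l => //; exact: mulr_ge0.
Unshelve. all: by end_near. Qed.

End parallel_transport.

(** * The Goldstein subdifferential *)

Section bounded_derivative.
Context {R : realType}.

Lemma harmonic_dnbhs : @harmonic R @ \oo --> (0 : R)^'.
Proof.
move=> A hA; have hA' : \forall x \near (0 : R), x != 0 -> A x by [].
have H : \forall k \near \oo, (@harmonic R k) != 0 -> A (harmonic k).
  exact: (@cvg_harmonic R _ hA').
suff : \forall k \near \oo, A (@harmonic R k) by [].
apply: filterS H => k; apply.
by have := @harmonic_gt0 R k; rewrite lt0r => /andP[].
Qed.

Lemma derive_harmonic (f : R -> R) (x df : R) : is_derive x 1 f df ->
  (fun k => (k.+1)%:R * (f (x + (k.+1)%:R^-1) - f x)) @ \oo --> df.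
Proof.
move=> [dd <-].
have H : (fun k => (harmonic k)^-1 *: (f (harmonic k *: 1 + x) - f x)) @ \oo
    --> 'D_1 f x.
  refine (@cvg_comp _ _ _ (@harmonic R) (fun h => h^-1 *: (f (h *: 1 + x) - f x))
    _ _ _ harmonic_dnbhs dd).
refine (cvg_trans _ H); apply: near_eq_cvg; near=> k => /=.
rewrite invrK; congr (_ * (f _ - _)).
by rewrite -[_ *: _]/(_ * _) mulr1 addrC.
Unshelve. all: by end_near. Qed.

(* The fundamental theorem of calculus for a function that is differentiable
   everywhere with a bounded, possibly discontinuous, derivative: dominated
   convergence of the difference quotients. *)
Lemma bounded_derivative_FTC (phi psi : R -> R) (K : R) :
  (forall t : R, is_derive t 1 phi (psi t)) -> (forall t, `|psi t| <= K) ->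
  [/\ measurable_fun (`[0, 1] : set R) psi,
      lebesgue_measure.-integrable `[0%R, 1%R] (EFin \o psi) &
  (\int[lebesgue_measure]_(t in `[0%R, 1%R]) (psi t)%:E = (phi 1 - phi 0)%:E)%E].
Proof.
move=> dphi hK.
have cphi : continuous phi by move=> t; exact: is_derive_continuous (dphi t).
have [Phi Phi0 dPhi] := antiderivative (@cphi).
(* Difference quotients of [phi] and of its primitive [Phi] with the same step: [Psi_ k] is a
   primitive of [psi_ k], which is bounded by [K], and its increment over [[0, 1]] tends to
   [phi 1 - phi 0] because [Phi' = phi]. *)
pose psi_ k (t : R) : R := k.+1%:R * (phi (t + k.+1%:R^-1) - phi t).
pose Psi_ k (t : R) : R := k.+1%:R * (Phi (t + k.+1%:R^-1) - Phi t).
have dsh (f : R -> R) (h t df : R) : is_derive (t + h) 1 f df ->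
    is_derive t 1 (fun r => f (r + h)) df.
  move=> fth; have sh : is_derive t 1 (fun r : R => r + h) 1.
    by rewrite -[X in is_derive _ _ _ X]addr0; apply: is_deriveD.
  have H := @is_derive1_comp R f (fun r => r + h) t df 1 fth sh; rewrite mulr1 in H; refine H.
have dPsi k (t : R) : is_derive t 1 (Psi_ k) (psi_ k t).
  have h1 := is_deriveB (dsh Phi k.+1%:R^-1 t _ (dPhi _)) (dPhi t).
  have H := is_deriveZ (k.+1%:R) h1; refine H.
have cpsi_ (k : nat) : continuous (psi_ k).
  move=> t; have d1 := is_deriveB (dsh phi k.+1%:R^-1 t _ (dphi _)) (dphi t).
  have d2 := is_deriveZ (k.+1%:R) d1.
  exact: (is_derive_continuous d2).
have bpsi k t : `|psi_ k t| <= K.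
  have kp : 0 < k.+1%:R^-1 :> R by rewrite invr_gt0.
  have tk : t <= t + k.+1%:R^-1 by rewrite lerDl ltW.
  have [c _ E] := MVT_closed tk (fun r _ => dphi r).
  rewrite /psi_ E addrAC subrr add0r mulrCA mulfV ?mulr1//.
have mpsi_ k : measurable_fun (`[0%R, 1%R] : set R) (EFin \o psi_ k).
  apply/measurable_EFinP; apply: measurable_funTS.
  exact: (continuous_measurable_fun (@cpsi_ k)).
have pcvg (t : R) : (fun k => (psi_ k t)%:E) @ \oo --> (psi t)%:E.
  by apply: cvg_EFin; [near=> k|exact: derive_harmonic].
have mpsi : measurable_fun (`[0%R, 1%R] : set R) (EFin \o psi).
  by apply: (emeasurable_fun_cvg _ _ mpsi_) => t _; exact: pcvg.
have iK : lebesgue_measure.-integrable `[0%R, 1%R] (cst K%:E : R -> \bar R).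
  apply/integrableP; split; first exact: measurable_cst.
  rewrite integral_cst//= lebesgue_measure_itv/= lte_fin ltr01.
  by rewrite oppr0 adde0 mule1 ltry.
have E k : (\int[lebesgue_measure]_(t in `[0%R, 1%R]) (psi_ k t)%:E =
    (Psi_ k 1 - Psi_ k 0)%:E)%E.
  have cPsi t : Psi_ k @ t --> Psi_ k t by exact: is_derive_continuous (dPsi k t).
  rewrite (@continuous_FTC2 _ _ (Psi_ k))//.
  - exact: continuous_subspaceT.
  - split.
    + by move=> t _; case: (dPsi k t).
    + exact: cvg_at_right_filter (cPsi 0).
    + exact: cvg_at_left_filter (cPsi 1).
  - by move=> t _; rewrite derive1E; case: (dPsi k t).
have ae1 : {ae lebesgue_measure, forall t : R, `[0%R, 1%R]%classic t ->
    (fun k => (psi_ k t)%:E) @ \oo --> (psi t)%:E}.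
  by apply: aeW => t _; exact: pcvg.
have ae2 : {ae lebesgue_measure, forall (t : R) (k : nat), `[0%R, 1%R]%classic t ->
    (`|(psi_ k t)%:E| <= K%:E)%E}.
  by apply: aeW => t k _; rewrite abse_EFin lee_fin; exact: bpsi.
have [ipsi _ H] := @dominated_convergence _ _ _ lebesgue_measure `[0%R, 1%R]%classic
  (measurable_itv _) (fun k t => (psi_ k t)%:E) (EFin \o psi) (cst K%:E)
  mpsi_ mpsi ae1 iK ae2.
split => //; first exact/measurable_EFinP.
have H2 : (fun k => (Psi_ k 1 - Psi_ k 0)%:E) @ \oo --> (phi 1 - phi 0)%:E.
  apply: cvg_EFin; first by near=> k.
  apply: cvgB; exact: derive_harmonic.
have EE : [sequence (\int[lebesgue_measure]_(t in `[0%R, 1%R]) (psi_ k t)%:E)%E]_k =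
    (fun k => (Psi_ k 1 - Psi_ k 0)%:E) by apply/funext => k; exact: E.
rewrite EE in H.
exact: (@cvg_unique _ (@ereal_hausdorff R) _ _ _ _ H H2).
Unshelve. all: by end_near. Qed.

End bounded_derivative.

Section goldstein.
Context {R : realType} {n d : nat}.
Variable M : set 'rV[R]_n.
Hypothesis hM : embedded_submanifold d M.
Variables (f : 'rV[R]_n -> R) (C L delta : R).
Hypotheses (C0 : 0 <= C) (hC : dproj_bounded (d:=d) M C)
  (df : forall x, M x -> rdifferentiable M f x)
  (gL : forall x, M x -> enorm (rgrad M f x) <= L)
  (hgeo : forall x y, M x -> M y -> (gdist M x y <= delta%:E)%E ->
     exists c, min_geodesic M x y c).

(** Differentiability everywhere lets the constant sequence at [x] serve, in a convex combination of
    one term. *)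
Lemma rgrad_rsubdiff x : M x -> rsubdiff M f x (rgrad M f x).
Proof.
move=> Mx; exists 1%N, (fun=> 1), (fun=> rgrad M f x); split.
- by [].
- by rewrite big_ord1.
- move=> _; split; first exact: (rgrad_tangent hM).
  exists (fun=> x); split; [by move=> _; exact: df|exact: cvg_cst|].
  by move=> X _; exact: cvg_cst.
- by rewrite big_ord1 scale1r.
Qed.

(** The average of the transported gradients lies in the subdifferential and differs from the
    average in R^n by at most [delta L C]. One [reach] hypothesis gives the geodesic from [w t] to
    [wbar], the other places [w t] in the ball around [wbar]. *)
Lemma goldstein_norm_le (T : nat) (w : 'I_T -> 'rV[R]_n) (wbar : 'rV[R]_n) :
  (0 < T)%N -> M wbar -> (forall t, M (w t)) ->
  (forall t, reach M (w t) wbar delta) -> (forall t, reach M wbar (w t) delta) ->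
  (goldstein_norm M delta f wbar <=
   (enorm (\sum_t rgrad M f (w t)) / T%:R + delta * L * C)%:E)%E.
Proof.
move=> T0 Mb Mw r1 r2.
have /boolp.choice[v hv] t : exists v, ptransport M (w t) wbar (rgrad M f (w t)) v /\
    enorm (v - rgrad M f (w t)) <= delta * L * C.
  have [gle _] := reach_gdist (r1 t).
  have [c mc] := hgeo (Mw t) Mb gle; have [[sc cM] c0 c1 _ len] := mc.
  have tg : tangent M (c 0) (rgrad M f (w t)) by rewrite c0; exact: (rgrad_tangent hM).
  have [V [pV V0 hV]] := parallel_transport hM sc cM tg.
  exists (V 1); split; first by exists c, V.
  apply: (le_trans (hV C C0 hC)).
  rewrite -len lee_fin in gle.
  rewrite [leRHS](_ : _ = C * L * delta); last by ring.
  apply: ler_pM => //; first by rewrite mulr_ge0.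
    apply: fine_ge0; apply: integral_ge0 => r _; by rewrite lee_fin.
  by apply: ler_wpM2l => //; exact: gL.
have Tp : 0 < T%:R :> R by rewrite ltr0n.
pose g := \sum_t T%:R^-1 *: v t.
apply: (@le_trans _ _ (enorm g)%:E).
  apply: ereal_inf_lbound; exists g => //; apply: subset_closure.
  exists T, (fun=> T%:R^-1), v; split => //.
  - by rewrite sumr_const card_ord -[LHS]mulr_natr mulVf// gt_eqF.
  - move=> t; exists (w t), (rgrad M f (w t)); split => //.
    + apply: subset_closure; split => //.
      by case: (reach_gdist (r2 t)).
    + exact: rgrad_rsubdiff.
    + by case: (hv t).
rewrite lee_fin.
have -> : g = T%:R^-1 *: \sum_t rgrad M f (w t) +
    T%:R^-1 *: \sum_t (v t - rgrad M f (w t)).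
  by rewrite /g -scaler_sumr -scalerDr -big_split/=; congr (_ *: _);
    apply: eq_bigr => t _; rewrite addrC subrK.
apply: (le_trans (enormD _ _)); rewrite !enormZ ger0_norm; last by rewrite invr_ge0 ltW.
apply: lerD; first by rewrite mulrC.
rewrite mulrC ler_pdivrMr//.
apply: (le_trans (enorm_sum _ _ _)).
apply: (@le_trans _ _ (\sum_(t < T) delta * L * C)).
  by apply: ler_sum => t _; case: (hv t).
by rewrite sumr_const card_ord mulr_natr.
Qed.

End goldstein.

(** * Regret of one projected step *)

Section regret.
Context {R : realType} {n : nat}.

(* Projected online gradient step with drifting tangent spaces; the comparator
   is the projection of a fixed ambient vector [u]. *)
Lemma regret_step (S S' Sw : set 'rV[R]_n) (D eta kappa : R)
    (Del Del' g u : 'rV[R]_n) :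
  projectable S -> projectable S' -> projectable Sw -> 0 <= D -> 0 < eta ->
  0 <= kappa ->
  (forall a b, `|dotp a (oproj S' b - oproj S b)| <= kappa * D * (enorm a * enorm b)) ->
  (forall a b, `|dotp a (oproj Sw b - oproj S b)| <= kappa * D * (enorm a * enorm b)) ->
  S Del -> enorm Del <= D -> Sw g -> enorm u <= D ->
  Del' = nearest [set v | S' v /\ enorm v <= D] (oproj S' (Del - eta *: g)) ->
  2 * eta * dotp g (Del - u) <=
    enorm (Del - oproj S u) ^+ 2 - enorm (Del' - oproj S' u) ^+ 2
    + eta ^+ 2 * enorm g ^+ 2 + 4 * (eta * (kappa * D ^+ 2)) * enorm g
    + 4 * (kappa * D ^+ 3) + (kappa * D ^+ 2) ^+ 2.
Proof.
move=> hS hS' hSw D0 eta0 k0 P1 P2 SD DD Sg uD Del'E.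
have uS : enorm (oproj S u) <= D by exact: le_trans (oproj_contr hS u) uD.
have uS' : enorm (oproj S' u) <= D by exact: le_trans (oproj_contr hS' u) uD.
(* Cost of moving the comparator to a neighbouring tangent space: a vector of norm at most [D]
   against a change of projection of size [kappa D]. *)
set b := kappa * D ^+ 2.
have b0 : 0 <= b by rewrite mulr_ge0// exprn_ge0.
pose z := Del - oproj S u - eta *: g.
have h1 : enorm (Del' - oproj S' u) <= enorm z + b.
  rewrite Del'E; apply: (le_trans (nearest_ball_nonexpansive hS' D0 (oprojS hS' _) uS')).
  rewrite -(oprojB hS').
  have -> : Del - eta *: g - u = z - (u - oproj S u).
    by rewrite /z; apply/rowP => i; rewrite !mxE; ring.
  rewrite (oprojB hS'); apply: (le_trans (enormB _ _)); apply: lerD.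
    exact: (oproj_contr hS').
  (* [u - P_S u] is killed by the projection on [S], so [P1] tested on [y] itself bounds [|y|^2] by
     [kappa D |y| |u - P_S u|]. *)
  set y := oproj S' _.
  have := P1 y (u - oproj S u).
  rewrite (oprojB hS u) (oproj_id hS (oprojS hS u)) subrr subr0 -/y.
  rewrite -enorm_sqr ger0_norm ?exprn_ge0// => h.
  have [->//|y0] := eqVneq (enorm y) 0.
  have yp : 0 < enorm y by rewrite lt0r y0 enorm_ge0.
  rewrite -(ler_pM2l yp) -expr2; apply: (le_trans h).
  rewrite [leRHS](_ : _ = kappa * D * (enorm y * D)); last by rewrite /b; ring.
  apply: ler_wpM2l; first exact: mulr_ge0.
  apply: ler_wpM2l => //.
  exact: le_trans (oproj_contrC hS u) uD.
have h2 : enorm z <= 2 * D + eta * enorm g.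
  apply: (le_trans (enormB _ _)); rewrite enormZ gtr0_norm// lerD2r.
  apply: (le_trans (enormB _ _)); lra.
have h3 : enorm z ^+ 2 = enorm (Del - oproj S u) ^+ 2
    - 2 * eta * dotp g (Del - oproj S u) + eta ^+ 2 * enorm g ^+ 2.
  rewrite /z !enorm_sqr; move: (Del - oproj S u) => y.
  by rewrite !(dotpBl, dotpBr, dotpZl, dotpZr) (dotpC y g); ring.
(* [g] is tangent at the query point, not at the iterate: [<g, u> = <g, P_Sw u>], and replacing [Sw]
   by [S] costs [b |g|]. *)
have h4 : `|dotp g u - dotp g (oproj S u)| <= b * enorm g.
  rewrite -{1}(oproj_id hSw Sg) (oproj_sym hSw) -dotpBr.
  apply: (le_trans (P2 _ _)).
  rewrite [leRHS](_ : _ = kappa * D * (enorm g * D)); last by rewrite /b; ring.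
  by apply: ler_wpM2l; [exact: mulr_ge0|exact: ler_wpM2l].
have h5 : enorm (Del' - oproj S' u) ^+ 2 <= (enorm z + b) ^+ 2.
  by rewrite lerXn2r ?nnegrE ?addr_ge0 ?enorm_ge0.
have h6 : dotp g (Del - oproj S u) >= dotp g (Del - u) - b * enorm g.
  by rewrite !dotpBr; move: h4; rewrite ler_norml => /andP[]; lra.
have h7 : enorm z * b <= (2 * D + eta * enorm g) * b by exact: ler_wpM2r.
have h8 : 2 * eta * (dotp g (Del - u) - b * enorm g) <= 2 * eta * dotp g (Del - oproj S u).
  by apply: ler_wpM2l => //; rewrite mulr_ge0// ltW.
(* Expanding [(|z| + b)^2] with [|z| <= 2 D + eta |g|] contributes [4 b D + 2 eta b |g| + b^2]; the
   change of projection in [h6] contributes the other [2 eta b |g|]. *)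
have E : kappa * D ^+ 3 = b * D by rewrite /b; ring.
rewrite E; nra.
Qed.

End regret.

(** * Measurability and independence *)

Section measurable_vectors.
Context {R : realType} {dO : measure_display} {O : measurableType dO}.

Definition mvec p (X : O -> 'rV[R]_p) :=
  forall i, measurable_fun setT (fun w => X w ord0 i).

(** A countable base whose members are boxes, so that coordinatewise measurability suffices to pull
    back open sets. *)
Definition rational_ball p (q : 'rV[rat]_p * rat) : set 'rV[R]_p :=
  [set y | forall i, `|ratr (q.1 ord0 i) - y ord0 i| < ratr q.2].

Lemma open_rational_balls p (W : set 'rV[R]_p) : open W ->
  W = \bigcup_(q in [set q | rational_ball q `<=` W]) rational_ball q.
Proof.
move=> oW; apply/seteqP; split => [x Wx|x [q qW] hx]; last exact: qW.
have [e /= e0 eW] : nbhs_ball x W by apply/nbhs_ballP; apply: open_nbhs_nbhs.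
have e2 : 0 < e / 2 by rewrite divr_gt0.
have [r] := rat_in_itvoo e2.
rewrite in_itv/= => /andP[r0 re].
have cx i : {c : rat | `|ratr c - x ord0 i| < ratr r}.
  apply: cid; have /rat_in_itvoo[c] : x ord0 i - ratr r < x ord0 i + ratr r :> R by lra.
  by rewrite in_itv/= => /andP[h1 h2]; exists c; rewrite ltr_distl; apply/andP; split.
exists (\row_i sval (cx i), r) => /=.
  move=> y hy; apply: eW; split => // i j; rewrite ord1 /=.
  have := hy j; rewrite mxE; have := svalP (cx j).
  rewrite distrC => h1 h2; apply: (le_lt_trans (ler_distD (ratr (sval (cx j))) _ _)).
  lra.
by move=> i; rewrite mxE; exact: svalP (cx i).
Qed.

Lemma mvec_open p (X : O -> 'rV[R]_p) (W : set 'rV[R]_p) :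
  mvec X -> open W -> measurable (X @^-1` W).
Proof.
move=> mX /open_rational_balls ->; rewrite preimage_bigcup bigcup_mkcond.
apply: countable_bigcupT_measurable; first exact: countableP.
move=> q; case: ifPn => _ //.
have -> : X @^-1` rational_ball q =
    \big[setI/setT]_(i < p) ((fun w => X w ord0 i) @^-1`
       [set` `]ratr (q.1 ord0 i) - ratr q.2, ratr (q.1 ord0 i) + ratr q.2[ ]).
  apply/seteqP; split => w /=.
    move=> h; apply/(big_ind (fun A : set O => A w)) => // i _ /=.
    by rewrite in_itv/=; have := h i; rewrite distrC ltr_distl.
  move=> h i; move: h; rewrite (bigD1 i)//= => -[]; rewrite in_itv/= => h _.
  by rewrite distrC ltr_distl.
apply: bigsetI_measurable => i _; rewrite -[X in measurable X]setTI.
exact: mX.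
Qed.

Lemma mvec_borel p (X : O -> 'rV[R]_p) : mvec X ->
  measurable_fun setT (X : O -> g_sigma_algebraType (@open 'rV[R]_p)).
Proof.
move=> mX.
refine (@measurability _ _ O (g_sigma_algebraType (@open 'rV[R]_p)) setT X
  (@open 'rV[R]_p) erefl _) => _ [W oW <-].
by rewrite setTI; exact: mvec_open.
Qed.

Lemma mvec_pair_open p q (X : O -> 'rV[R]_p) (Y : O -> 'rV[R]_q)
    (W : set ('rV[R]_p * 'rV[R]_q)) :
  mvec X -> mvec Y -> open W -> measurable ((fun w => (X w, Y w)) @^-1` W).
Proof.
move=> mX mY oW; pose W' := [set z : 'rV[R]_(p + q) | W (lsubmx z, rsubmx z)].
have -> : (fun w => (X w, Y w)) @^-1` W = (fun w => row_mx (X w) (Y w)) @^-1` W'.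
  by apply/seteqP; split => w; rewrite /preimage/= /W'/= row_mxKl row_mxKr.
apply: mvec_open.
  move=> i; case: (splitP i) => j ij.
    rewrite (_ : (fun w => _) = fun w => X w ord0 j)//.
    by apply/funext => w; rewrite (_ : i = lshift q j) ?row_mxEl//; exact: val_inj.
  rewrite (_ : (fun w => _) = fun w => Y w ord0 j)//.
  by apply/funext => w; rewrite (_ : i = rshift p j) ?row_mxEr//; exact: val_inj.
rewrite openE => z Wz; have [e /= e0 eW] : nbhs_ball (lsubmx z, rsubmx z) W.
  by apply/nbhs_ballP; apply: open_nbhs_nbhs.
apply/nbhs_ballP; exists e => // z' [_ zz']; apply: eW.
by split; split => // i j; rewrite ?mxE; exact: zz'.
Qed.

Definition cont_on (T : topologicalType) (S : set T) (phi : T -> R) :=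
  forall x, S x -> forall e, 0 < e ->
    exists U, [/\ open U, U x & forall y, U y -> S y -> `|phi x - phi y| < e].

(** On [S], the superlevel set [a < phi] is the trace of the open set [W], the union of all open
    sets whose points in [S] satisfy it. *)
Lemma cont_on_measurable (T : topologicalType) (S : set T) (phi : T -> R)
    (Z : O -> T) : (forall W, open W -> measurable (Z @^-1` W)) ->
  (forall w, S (Z w)) -> cont_on S phi -> measurable_fun setT (phi \o Z).
Proof.
move=> mZ SZ cphi.
refine (@measurability _ _ O _ setT (phi \o Z) _ (RGenOInfty.measurableE R) _).
move=> _ [_ [a ->] <-]; rewrite setTI.
pose W := \bigcup_(U in [set U | open U /\ forall y, U y -> S y -> a < phi y]) U.
have -> : (phi \o Z) @^-1` `]a, +oo[ = Z @^-1` W.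
  apply/seteqP; split => w /=.
    rewrite in_itv/= andbT => aw.
    have [|U [oU Ux hU]] := cphi _ (SZ w) (phi (Z w) - a); first by rewrite subr_gt0.
    exists U => //; split => // y Uy Sy; have := hU y Uy Sy.
    by move=> /(le_lt_trans (ler_norm _)); rewrite ltrD2l ltrN2.
  by move=> [U [oU hU] Uw]; rewrite in_itv/= andbT; apply: hU.
by apply: mZ; apply: bigcup_open => U [].
Qed.

Lemma smooth_on_cont_on (T : normedModType R) q (S : set T) (g : T -> 'rV[R]_q) i :
  smooth_on S g -> cont_on S (fun x => g x ord0 i).
Proof.
move=> sg x Sx e e0; have [U [h [oU Ux hC hg]]] := sg x Sx.
have /= := hC 0 x Ux; move=> /cvgrPdist_lt/(_ e e0) => hx.
exists (U `&` interior [set y | `|h x - h y| < e]); split.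
- by apply: openI => //; exact: open_interior.
- by split.
- move=> y [Uy /interior_subset/= hy] Sy; rewrite -!hg//.
  apply: le_lt_trans hy; have := normr_coord (h x - h y) i; by rewrite !mxE.
Qed.

End measurable_vectors.

Section manifold_measurability.
Context {R : realType} {n d : nat}.
Variable M : set 'rV[R]_n.
Hypothesis hM : embedded_submanifold d M.

Lemma cont_on_oproj u i : cont_on M (fun x => oproj (tangent M x) u ord0 i).
Proof.
apply: smooth_on_cont_on => x Mx.
have [A [h [ch Ax]]] := chart_exists hM Mx; have [oA hA _ gA] := ch.
exists A, (fun y => u *m kerproj h y); split => //.
  move=> k; exact: Ck_kerproj.
by move=> y Ay My; rewrite (oproj_kerproj hM _ ch).
Qed.

(** [U] is the union of all chart domains: inside one, [h] vanishes on [M], hence by continuity at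
    its limit points. This makes [M] a Borel set, as needed to use an oracle whose measurability is
    stated over [M]. *)
Lemma submanifold_locally_closed : exists2 U, open U & M = U `&` closure M.
Proof.
exists (\bigcup_(A in [set A | exists h, is_chart (d:=d) M A h]) A).
  by apply: bigcup_open => A [h []].
apply/seteqP; split => [x Mx|x [[A [h ch] Ax] cMx]].
  have [A [h [ch Ax]]] := chart_exists hM Mx.
  by split; [exists A => //; exists h|exact: subset_closure].
have [oA hA Mh _] := ch; apply/(Mh _ Ax); apply/eqP/contraT => hx.
have ch0 : {for x, continuous h} by have /= := hA 0; exact.
have hx0 : 0 < `|h x| by rewrite normr_gt0.
move/cvgrPdist_lt: ch0 => /(_ _ hx0) h1.
have : \forall y \near x, A y /\ h y != 0.
  near=> y; split; first by near: y; exact: open_nbhs_nbhs.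
  have : `|h x - h y| < `|h x| by near: y; exact: h1.
  by apply: contraTneq => ->; rewrite subr0 ltxx.
move=> /cMx[y [My [Ay]]]; by rewrite (proj1 (Mh _ Ay) My) eqxx.
Unshelve. all: by end_near. Qed.

Lemma submanifold_borel :
  measurable (M : set (g_sigma_algebraType (@open 'rV[R]_n))).
Proof.
have [U oU ->] := submanifold_locally_closed.
apply: measurableI; first exact: sub_sigma_algebra.
rewrite -[X in measurable X]setCK; apply: measurableC; apply: sub_sigma_algebra.
by apply: closed_openC; exact: closed_closure.
Qed.

End manifold_measurability.

(** * Independence and conditioning *)

Section independence.
Context {R : realType} {dO : measure_display} {O : measurableType dO}.
Variable P : probability O R.

(** The hypothesis identifies the joint law of [(Y, X)] with the product of the law of [Y] and [mu];
    the rest is Tonelli's theorem under that law. *)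
Lemma indep_tonelli d1 d2 (T1 : measurableType d1) (T2 : measurableType d2)
    (mu : probability T2 R) (Y : {mfun O >-> T1}) (X : {mfun O >-> T2})
    (h : T1 * T2 -> \bar R) :
  (forall A B, measurable A -> measurable B ->
     P (Y @^-1` A `&` X @^-1` B) = (P (Y @^-1` A) * mu B)%E) ->
  measurable_fun setT h -> (forall z, (0 <= h z)%E) ->
  (\int[P]_w h (Y w, X w) = \int[P]_w \int[mu]_v h (Y w, v))%E.
Proof.
move=> ind mh h0.
have mYX : measurable_fun setT (fun w => (Y w, X w)) by exact: measurable_fun_pair.
pose YX : {mfun O >-> (T1 * T2)%type} := mfun_Sub (mem_set mYX).
have E1 : (\int[P]_w h (Y w, X w) = \int[distribution P YX]_z h z)%E.
  by rewrite (ge0_integral_pushforward mYX).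
have prodE A : measurable A -> (distribution P Y \x mu)%E A = distribution P YX A.
  apply: product_measure_unique => A1 A2 mA1 mA2; rewrite -ind//.
rewrite E1 (eq_measure_integral (distribution P Y \x mu)%E); last first.
  by move=> A mA _; have := prodE A mA; move/esym.
rewrite fubini_tonelli1// (ge0_integral_pushforward (measurable_funPT Y))//.
- exact: measurable_fun_fubini_tonelli_F.
- by move=> y _; apply: integral_ge0 => v _; exact: h0.
Qed.

(** Signed version of [indep_tonelli], through positive and negative parts; the bound [B] on the
    inner integrals makes every term integrable. *)
Lemma indep_integral d1 d2 (T1 : measurableType d1) (T2 : measurableType d2)
    (mu : probability T2 R) (Y : {mfun O >-> T1}) (X : {mfun O >-> T2})
    (h : T1 * T2 -> R) (B : O -> R) :
  (forall A B, measurable A -> measurable B ->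
     P (Y @^-1` A `&` X @^-1` B) = (P (Y @^-1` A) * mu B)%E) ->
  measurable_fun setT h -> P.-integrable setT (EFin \o B) ->
  (forall w, \int[mu]_v `|(h (Y w, v))%:E| <= (B w)%:E)%E ->
  [/\ forall w, mu.-integrable setT (fun v => (h (Y w, v))%:E),
      P.-integrable setT (fun w => (h (Y w, X w))%:E),
      P.-integrable setT (fun w => (\int[mu]_v h (Y w, v))%:E)
    & \int[P]_w h (Y w, X w) = \int[P]_w \int[mu]_v h (Y w, v)].
Proof.
move=> ind mh iB hB; pose H := EFin \o h.
have mH : measurable_fun setT H by exact/measurable_EFinP.
have mHp := measurable_funepos mH; have mHn := measurable_funeneg mH.
have H0 : forall z, (0 <= `|H z|)%E by move=> z; exact: abse_ge0.
have mHY w : measurable_fun setT (fun v => (h (Y w, v))%:E).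
  exact: measurableT_comp mH (pair1_measurable (Y w)).
have imu w : mu.-integrable setT (fun v => (h (Y w, v))%:E).
  by apply/integrableP; split => //; exact: le_lt_trans (hB w) (ltry _).
have tri (G : T1 * T2 -> \bar R) : measurable_fun setT G ->
    (forall z, 0 <= G z)%E -> (forall z, G z <= `|H z|)%E ->
    P.-integrable setT (fun w => \int[mu]_v G (Y w, v))%E.
  move=> mG G0 GH; apply: (le_integrable measurableT _ _ iB).
    have m1 : measurable_fun setT (fubini_F mu G).
      exact: measurable_fun_fubini_tonelli_F.
    exact: measurableT_comp m1 (measurable_funPT Y).
  move=> w _; rewrite gee0_abs; last by apply: integral_ge0 => v _; exact: G0.
  apply: le_trans (lee_abs _); apply: le_trans (hB w).
  by apply: ge0_le_integral_sup => v _; [exact: G0|exact: GH].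
have mXY : measurable_fun setT (fun w => (Y w, X w)) by exact: measurable_fun_pair.
have iP : P.-integrable setT (fun w => (h (Y w, X w))%:E).
  apply/integrableP; split; first exact: measurableT_comp mH mXY.
  have -> := indep_tonelli ind (measurableT_comp (@abse_measurable _ _) mH) H0.
  have /integrableP[_] := iB; apply: le_lt_trans; apply: ge0_le_integral_sup => w _.
    by apply: integral_ge0 => v _; exact: H0.
  exact: le_trans (hB w) (lee_abs _).
have ipos : P.-integrable setT (fun w => \int[mu]_v H^\+ (Y w, v))%E.
  by apply: tri => // z; rewrite funeposE ge_max lee_abs abse_ge0.
have ineg : P.-integrable setT (fun w => \int[mu]_v H^\- (Y w, v))%E.
  by apply: tri => // z; rewrite funenegE ge_max -{1}abseN lee_abs abse_ge0.
have E w : ((\int[mu]_v h (Y w, v))%:E =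
    \int[mu]_v H^\+ (Y w, v) - \int[mu]_v H^\- (Y w, v))%E.
  rewrite /Rintegral fineK; last exact: integrable_fin_num (imu w).
  rewrite integralE; congr (_ - _)%E; apply: eq_integral => v _.
    by rewrite !funeposE.
  by rewrite !funenegE.
split => //.
  have := integrableB measurableT ipos ineg; apply: eq_integrable => // w _; exact/esym/E.
rewrite /Rintegral; congr fine; under [RHS]eq_integral do rewrite E.
rewrite integralB// integralE.
rewrite -(indep_tonelli ind mHp)// -(indep_tonelli ind mHn)//; congr (_ - _)%E.
  by apply: eq_integral => w _; rewrite !funeposE.
by apply: eq_integral => w _; rewrite !funenegE.
Qed.

End independence.

Section cylinders.
Context {R : realType} {dO : measure_display} {O : measurableType dO}.
Variables (P : probability O R) (I : finType) (E : I -> set (set O)).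

Definition cylinders (S : {set I}) : set (set O) :=
  [set C | exists2 A : I -> set O,
     (forall i, i \in S -> E i (A i)) & C = \bigcap_(i in [set` S]) A i].

Hypotheses (ET : forall i, E i setT) (EI : forall i, setI_closed (E i))
  (EO : forall i A, E i A -> measurable A) (indE : mutually_independent P E).

Lemma cylinder_measurable S C : cylinders S C -> measurable C.
Proof.
move=> [A EA ->]; apply: fin_bigcap_measurable => [|i iS].
  exact: finite_finset.
by apply: EO; exact: EA.
Qed.

Lemma sub_cylinders (S : {set I}) i A : i \in S -> E i A -> cylinders S A.
Proof.
move=> iS EA; exists (fun j => if j == i then A else setT) => [j jS|].
  by case: eqP => [->|].
apply/seteqP; split => [w Aw j /= jS|w /(_ i iS)]; last by rewrite eqxx.
by case: eqP.
Qed.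

(** The finite measures that send [C] to the probability of its intersection with [B] and to
    [P C * P B] agree on cylinders, which are stable under intersection, hence on the generated
    sigma-algebra. *)
Lemma cylinders_indep (S : {set I}) i B C : i \notin S -> E i B ->
  <<s cylinders S>> C -> P (C `&` B) = (P C * P B)%E.
Proof.
move=> iS EB; have mB := EO EB.
pose m1 := mrestr P mB; pose m2 := mscale (NngNum (fine_ge0 (measure_ge0 P B))) P.
have m2E A : m2 A = (P A * P B)%E.
  by rewrite /m2 /mscale/= fineK ?fin_num_measure// muleC.
move=> sC; rewrite -m2E -[LHS]/(m1 C); move: C sC.
apply: (g_sigma_algebra_measure_unique (cylinders S) _ (fun=> setT)).
- by move=> A; exact: cylinder_measurable.
- move=> _; exists (fun=> setT) => //; by apply/seteqP; split.
- exact: bigcup_const.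
- move=> _ _ [A EA ->] [B' EB' ->]; exists (fun j => A j `&` B' j).
    by move=> j jS; apply: EI; [exact: EA|exact: EB'].
  by rewrite bigcapI.
- move=> _ [A EA ->]; apply: etrans _ (esym (m2E _)).
  change (P ((\bigcap_(j in [set` S]) A j) `&` B) =
    P (\bigcap_(j in [set` S]) A j) * P B)%E.
  pose A' j := if j == i then B else A j.
  have AA' j : j \in S -> A' j = A j.
    by rewrite /A'; case: eqP => // ->; rewrite (negbTE iS).
  have -> : (\bigcap_(j in [set` S]) A j) `&` B =
      \bigcap_(j in [set` (i |: S)]) A' j.
    apply/seteqP; split => w /= h.
      move=> j /=; rewrite in_setU1 /A'.
      by case: eqP => [_ _|_ /= jS]; case: h => // h1 h2; exact: h1.
    split; last by have := h i; rewrite /= in_setU1 eqxx /A' eqxx; exact.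
    by move=> j /= jS; rewrite -AA'//; apply: h; rewrite /= in_setU1 jS orbT.
  rewrite indE.
    rewrite big_setU1//= {1}/A' eqxx muleC indE//; congr (_ * _)%E.
    by apply: eq_bigr => j jS; rewrite AA'.
  move=> j; rewrite in_setU1 /A'; case: eqP => [->//|_ /=]; exact: EA.
- move=> k; change (P (setT `&` B) < +oo)%E.
  by rewrite setTI ltey_eq fin_num_measure.
Qed.

End cylinders.

(** * The stochastic oracle *)

Section integrals.
Context {R : realType} {dT : measure_display} {T : measurableType dT}.
Variable P : probability T R.

Lemma ge0_integrable_le (X : T -> R) (b : R) : measurable_fun setT X ->
  (forall w, 0 <= X w) -> (\int[P]_w (X w)%:E <= b%:E)%E ->
  P.-integrable setT (EFin \o X) /\ \int[P]_w X w <= b.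
Proof.
move=> mX X0 Xb; have iX : P.-integrable setT (EFin \o X).
  apply/integrableP; split; first exact/measurable_EFinP.
  under eq_integral do rewrite /= ger0_norm//.
  exact: le_lt_trans Xb (ltry _).
split => //; rewrite -lee_fin /Rintegral fineK//; exact: integrable_fin_num iX.
Qed.

Lemma EFin_Rintegral (X : T -> R) : P.-integrable setT (EFin \o X) ->
  (\int[P]_w (X w)%:E = (\int[P]_w X w)%:E)%E.
Proof. by move=> iX; rewrite /Rintegral fineK//; exact: integrable_fin_num iX. Qed.

Lemma integrable_le (X Y : T -> R) : measurable_fun setT X ->
  (forall w, `|X w| <= Y w) -> P.-integrable setT (EFin \o Y) ->
  P.-integrable setT (EFin \o X).
Proof.
move=> mX XY; apply: le_integrable => //; first exact/measurable_EFinP.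
by move=> w _; rewrite /= lee_fin (le_trans (XY w))// ler_norm.
Qed.

Lemma integrable_const (c : R) : P.-integrable setT (EFin \o cst c).
Proof. exact: finite_measure_integrable_cst. Qed.

Lemma integrable_add (X Y : T -> R) :
  P.-integrable setT (EFin \o X) -> P.-integrable setT (EFin \o Y) ->
  P.-integrable setT (EFin \o (fun w => X w + Y w)).
Proof.
move=> iX iY; have := integrableD measurableT iX iY.
by apply: eq_integrable => // w _.
Qed.

Lemma integrable_scale (c : R) (X : T -> R) :
  P.-integrable setT (EFin \o X) -> P.-integrable setT (EFin \o (fun w => c * X w)).
Proof.
move=> iX; have := integrableZl measurableT c iX.
by apply: eq_integrable => // w _.
Qed.

Lemma integrable_bigsum (I : Type) (r : seq I) (X : I -> T -> R) :
  (forall i, P.-integrable setT (EFin \o X i)) ->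
  P.-integrable setT (EFin \o (fun w => \sum_(i <- r) X i w)).
Proof.
move=> iX; elim: r => [|i r IH].
  by rewrite (_ : (fun w => _) = cst 0); [exact: integrable_const|
    apply/funext => w; rewrite big_nil].
rewrite (_ : (fun w => _) = (fun w => X i w + \sum_(j <- r) X j w)).
  exact: integrable_add.
by apply/funext => w; rewrite big_cons.
Qed.

Lemma Rintegral_bigsum (I : Type) (r : seq I) (X : I -> T -> R) :
  (forall i, P.-integrable setT (EFin \o X i)) ->
  \int[P]_w (\sum_(i <- r) X i w) = \sum_(i <- r) \int[P]_w X i w.
Proof.
move=> iX; elim: r => [|i r IH].
  by under eq_Rintegral do rewrite big_nil; rewrite Rintegral_cst// mul0r big_nil.
under eq_Rintegral do rewrite big_cons.
by rewrite RintegralD// ?big_cons ?IH//; exact: integrable_bigsum.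
Qed.

Lemma Rintegral_const (c : R) : \int[P]_w c = c.
Proof.
rewrite Rintegral_cst//; have := @probability_setT _ _ _ P.
by move=> /(congr1 fine)/= E; rewrite [fine _]E mulr1.
Qed.

(** Jensen's inequality from [X <= X^2 / (2 a) + a / 2]; when [X] has positive mean [e], the choice
    [a = e] leads to [e^2 <= b^2]. *)
Lemma expectation_le_sqr (X : T -> R) (b : R) : 0 <= b -> measurable_fun setT X ->
  (forall w, 0 <= X w) -> P.-integrable setT (EFin \o (fun w => X w ^+ 2)) ->
  \int[P]_w X w ^+ 2 <= b ^+ 2 ->
  P.-integrable setT (EFin \o X) /\ \int[P]_w X w <= b.
Proof.
move=> b0 mX X0 iX2 X2b.
have AM a : 0 < a -> forall w, X w <= (2 * a)^-1 * X w ^+ 2 + a / 2.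
  move=> a0 w; have := sqr_ge0 (X w - a); rewrite sqrrB => h.
  rewrite -subr_ge0 (_ : _ - _ = (2 * a)^-1 * (X w ^+ 2 - X w * a *+ 2 + a ^+ 2)).
    by rewrite mulr_ge0// invr_ge0 mulr_ge0// ltW.
  by field; rewrite gt_eqF.
have iA a : P.-integrable setT (EFin \o (fun w => (2 * a)^-1 * X w ^+ 2 + a / 2)).
  by apply: integrable_add; [exact: integrable_scale|exact: integrable_const].
have iX : P.-integrable setT (EFin \o X).
  by apply: (integrable_le mX _ (iA 1)) => w; rewrite ger0_norm//; exact: AM.
split => //; set e := (X in X <= b).
have [e0|e0] := leP e 0; first exact: le_trans b0.
have : e <= (2 * e)^-1 * b ^+ 2 + e / 2.
  apply: (@le_trans _ _ (\int[P]_w ((2 * e)^-1 * X w ^+ 2 + e / 2))).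
    by apply: le_Rintegral => // w _; exact: AM.
  rewrite RintegralD//; [|exact: integrable_scale|exact: integrable_const].
  rewrite Rintegral_const lerD2r RintegralZl//; apply: ler_wpM2l X2b.
  by rewrite invr_ge0 mulr_ge0// ltW.
have e2 : 0 < 2 * e by rewrite mulr_gt0.
move=> /(ler_wpM2l (ltW e2)).
have -> : 2 * e * ((2 * e)^-1 * b ^+ 2 + e / 2) = b ^+ 2 + e ^+ 2.
  by field; rewrite gt_eqF.
move=> h.
rewrite -(@ler_pXn2r _ 2%N) ?nnegrE//; last exact: ltW.
nra.
Qed.

End integrals.

Section vector_measurability.
Context {R : realType} {dO : measure_display} {O : measurableType dO} {n : nat}.
Implicit Types X Y : O -> 'rV[R]_n.

Lemma mvec_cst (u : 'rV[R]_n) : mvec (fun _ : O => u).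
Proof. by move=> i; exact: measurable_cst. Qed.

Lemma mvecD X Y : mvec X -> mvec Y -> mvec (fun w => X w + Y w).
Proof.
move=> mX mY i; under eq_fun do rewrite mxE.
exact: measurable_funD (mX i) (mY i).
Qed.

Lemma mvecZ (a : O -> R) X : measurable_fun setT a -> mvec X ->
  mvec (fun w => a w *: X w).
Proof.
move=> ma mX i; under eq_fun do rewrite mxE.
exact: measurable_funM ma (mX i).
Qed.

Lemma mvecB X Y : mvec X -> mvec Y -> mvec (fun w => X w - Y w).
Proof.
move=> mX mY; under eq_fun do rewrite -scaleN1r.
by apply: mvecD => //; apply: mvecZ => //; exact: measurable_cst.
Qed.

Lemma mvec_sum (I : Type) (r : seq I) (X : I -> O -> 'rV[R]_n) :
  (forall i, mvec (X i)) -> mvec (fun w => \sum_(i <- r) X i w).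
Proof.
move=> mX j; under eq_fun do rewrite summxE.
by apply: measurable_sum => i; exact: mX.
Qed.

Lemma dotp_measurable X Y : mvec X -> mvec Y ->
  measurable_fun setT (fun w => dotp (X w) (Y w)).
Proof.
by move=> mX mY; apply: measurable_sum => i; exact: measurable_funM (mX i) (mY i).
Qed.

Lemma enorm_measurable X : mvec X -> measurable_fun setT (fun w => enorm (X w)).
Proof.
move=> mX; apply: (measurableT_comp _ (dotp_measurable mX mX)).
apply: continuous_measurable_fun; exact: sqrt_continuous.
Qed.

Lemma mvec_comp d' (O' : measurableType d') (h : O' -> O) X :
  measurable_fun setT h -> mvec X -> mvec (fun w => X (h w)).
Proof. by move=> mh mX i; exact: measurableT_comp (mX i) mh. Qed.

End vector_measurability.

Section oracle.
Context {R : realType} {n d : nat}.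
Variable M : set 'rV[R]_n.
Hypothesis hM : embedded_submanifold d M.
Context {dV : measure_display} {V : measurableType dV}.
Variables (mu : probability V R) (F : 'rV[R]_n -> V -> R) (L G sigma : R).
Hypothesis hF : forall x, M x -> mu.-integrable setT (EFin \o F x).
Hypothesis hO : oracle_assumption mu M F G sigma.
Hypothesis hLip : lipschitz_assumption mu M F L.
Hypothesis G0 : 0 <= G.
Let f := objective mu F.

Lemma mvec_sgrad d' (O : measurableType d') (w : O -> 'rV[R]_n) (X : O -> V) :
  mvec w -> (forall o, M (w o)) -> measurable_fun setT X ->
  mvec (fun o => sgrad M F (w o) (X o)).
Proof.
move=> mw Mw mX i; have [ms _] := hO.
have mwX : measurable_fun setT
    (fun o => (w o, X o) : g_sigma_algebraType (@open 'rV[R]_n) * V).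
  by apply: measurable_fun_pair => //; exact: mvec_borel.
refine (@measurable_comp _ _ _ _ (g_sigma_algebraType (@open 'rV[R]_n) * V)%type _
  (M `*` setT) _ setT _ _ _ (ms i) mwX).
- apply: measurableX => //; exact: (submanifold_borel hM).
- by move=> _ [w0 _ <-]; split; first exact: Mw.
Qed.

Lemma mvec_sgrad1 x : M x -> mvec (sgrad M F x).
Proof.
by move=> Mx; apply: mvec_sgrad.
Qed.

Lemma sgrad_sqr x : M x ->
  mu.-integrable setT (EFin \o (fun v => enorm (sgrad M F x v) ^+ 2)) /\
  \int[mu]_v enorm (sgrad M F x v) ^+ 2 <= G ^+ 2.
Proof.
move=> Mx; have [_ /(_ x Mx)[_ _ _ h _]] := hO.
apply: ge0_integrable_le h => [|v]; last exact: sqr_ge0.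
by apply: measurable_funX; apply: enorm_measurable; exact: mvec_sgrad1.
Qed.

Lemma sgrad_enorm x : M x ->
  mu.-integrable setT (EFin \o (fun v => enorm (sgrad M F x v))) /\
  \int[mu]_v enorm (sgrad M F x v) <= G.
Proof.
move=> Mx; have [i2 h2] := sgrad_sqr Mx.
apply: expectation_le_sqr => //.
by apply: enorm_measurable; exact: mvec_sgrad1.
Qed.

Lemma sgrad_dotp x u : M x ->
  mu.-integrable setT (EFin \o (fun v => dotp (sgrad M F x v) u)) /\
  \int[mu]_v dotp (sgrad M F x v) u = dotp (rgrad M f x) u.
Proof.
move=> Mx; have [iE _] := sgrad_enorm Mx.
have ic i : mu.-integrable setT (EFin \o (fun v => sgrad M F x v ord0 i)).
  apply: integrable_le iE => [|v]; first exact: mvec_sgrad1.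
  exact: normr_coord_enorm.
have icu i : mu.-integrable setT (EFin \o (fun v => sgrad M F x v ord0 i * u ord0 i)).
  have := integrable_scale (u ord0 i) (ic i); apply: eq_integrable => // v _ /=.
  by rewrite mulrC.
split; first exact: integrable_bigsum.
rewrite Rintegral_bigsum//; apply: eq_bigr => i _.
rewrite RintegralZr//; congr (_ * _).
have [_ /(_ x Mx)[_ _ /(_ i) h _ _]] := hO.
by rewrite /Rintegral h.
Qed.

(** [|grad f|^2] is the mean of the pairing of the oracle with [grad f], at most [|grad f|] times
    the mean norm of the oracle. *)
Lemma rgrad_le_G x : M x -> enorm (rgrad M f x) <= G.
Proof.
move=> Mx; have [iE Eb] := sgrad_enorm Mx; set g := rgrad M f x.
have [i1 E1] := sgrad_dotp g Mx.
have [->//|g0] := eqVneq (enorm g) 0.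
have gp : 0 < enorm g by rewrite lt0r g0 enorm_ge0.
rewrite -(ler_pM2l gp) -expr2 enorm_sqr -E1.
apply: (@le_trans _ _ (\int[mu]_v (enorm g * enorm (sgrad M F x v)))).
  apply: le_Rintegral => //; first exact: integrable_scale.
  by move=> v _; rewrite mulrC; exact: dotp_le.
by rewrite RintegralZl//; apply: ler_wpM2l Eb; exact: enorm_ge0.
Qed.

(** By unbiasedness each coordinate is a partial integral of the jointly measurable oracle. *)
Lemma mvec_rgrad d' (O : measurableType d') (w : O -> 'rV[R]_n) :
  mvec w -> (forall o, M (w o)) -> mvec (fun o => rgrad M f (w o)).
Proof.
move=> mw Mw i; apply/measurable_EFinP.
pose h (z : O * V) := (sgrad M F (w z.1) z.2 ord0 i)%:E.
have mh : measurable_fun setT h.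
  apply/measurable_EFinP; have := @mvec_sgrad _ (O * V)%type (fun z => w z.1) snd.
  by apply => //; exact: mvec_comp.
have E o : (rgrad M f (w o) ord0 i)%:E =
    (fubini_F mu h^\+ o - fubini_F mu h^\- o)%E.
  have [_ /(_ _ (Mw o))[_ _ /(_ i) <- _ _]] := hO.
  rewrite integralE /fubini_F; congr (_ - _)%E; apply: eq_integral => v _.
    by rewrite !funeposE.
  by rewrite !funenegE.
rewrite (_ : _ \o _ = fun o => (fubini_F mu h^\+ o - fubini_F mu h^\- o)%E).
  apply: emeasurable_funB; apply: measurable_fun_fubini_tonelli_F => //.
    exact: measurable_funepos.
  exact: measurable_funeneg.
by apply/funext => o; rewrite -E.
Qed.

Lemma objective_rdifferentiable x : M x -> rdifferentiable M f x.
Proof. by move=> Mx; have [_ /(_ x Mx)[]] := hO. Qed.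

Lemma objective_measurable d' (O : measurableType d') (w : O -> 'rV[R]_n) :
  mvec w -> (forall o, M (w o)) -> measurable_fun setT (fun o => f (w o)).
Proof.
move=> mw Mw; apply: (cont_on_measurable _ Mw) => [W oW|x Mx e e0].
  exact: mvec_open.
exact: (rdifferentiable_cvg (objective_rdifferentiable Mx)).
Qed.

(** Only the second moment of [Lnu] is bounded; [Lnu <= Lnu^2 / (2 a) + a / 2] controls its mean for
    every [a], which is left free for [rgrad_le_L]. *)
Lemma objective_lipschitz (a : R) x y r : 0 < a -> reach M x y r -> M x -> M y ->
  `|f x - f y| <= (L ^+ 2 / a + a) / 2 * r.
Proof.
move=> a0 xy Mx My; have [Lnu [mL hL L2]] := hLip.
have [gr gfin] := reach_gdist xy.
have r0 : 0 <= fine (gdist M x y).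
  apply: fine_ge0; apply: le_ereal_inf_tmp => _ [l' h' <-].
  by rewrite lee_fin; exact: path_length_ge0 h'.
have fr : fine (gdist M x y) <= r by rewrite -lee_fin fineK.
have [i2 h2] := ge0_integrable_le (measurable_funX 2%N mL) (fun v => sqr_ge0 (Lnu v)) L2.
rewrite /f /objective -RintegralB//; [|exact: hF|exact: hF].
have iB : mu.-integrable setT (EFin \o (fun v => F x v - F y v)).
  have := integrableB measurableT (hF Mx) (hF My).
  by apply: eq_integrable => // v _.
apply: (le_trans (le_normr_Rintegral _ iB)) => //.
pose B v := (r / (2 * a)) * Lnu v ^+ 2 + (r * a / 2).
have iBB : mu.-integrable setT (EFin \o B).
  by apply: integrable_add; [exact: integrable_scale|exact: integrable_const].
apply: (@le_trans _ _ (\int[mu]_v B v)).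
  apply: le_Rintegral => //; first exact: (integrable_norm iB).
  move=> v _; apply: (le_trans (hL v x y Mx My gfin)).
  have h : Lnu v <= (2 * a)^-1 * Lnu v ^+ 2 + a / 2.
    rewrite -subr_ge0 (_ : _ - _ = (2 * a)^-1 * (Lnu v - a) ^+ 2).
      by rewrite mulr_ge0 ?sqr_ge0// invr_ge0 mulr_ge0// ltW.
    by field; rewrite gt_eqF.
  rewrite /B.
  have -> : r / (2 * a) * Lnu v ^+ 2 + r * a / 2 = ((2 * a)^-1 * Lnu v ^+ 2 + a / 2) * r.
    by field; rewrite gt_eqF.
  apply: (@le_trans _ _ (((2 * a)^-1 * Lnu v ^+ 2 + a / 2) * fine (gdist M x y))).
    exact: ler_wpM2r.
  apply: ler_wpM2l => //.
  have a1 := ltW a0; apply: addr_ge0; last exact: divr_ge0.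
  by apply: mulr_ge0 (sqr_ge0 _); rewrite invr_ge0 mulr_ge0.
rewrite RintegralD//; [|exact: integrable_scale|exact: integrable_const].
rewrite Rintegral_const RintegralZl//.
have r1 : 0 <= r by exact: le_trans r0 fr.
have -> : (L ^+ 2 / a + a) / 2 * r = r / (2 * a) * L ^+ 2 + r * a / 2.
  by field; rewrite gt_eqF.
by rewrite lerD2r; apply: ler_wpM2l h2; rewrite divr_ge0// mulr_ge0// ltW.
Qed.

End oracle.

Section uniform.
Context {R : realType}.

Lemma integral_uniform01 (h : R -> R) : measurable_fun setT h ->
  (\int[uniform_prob (@ltr01 R)]_s (h s)%:E =
   \int[lebesgue_measure]_(s in `[0%R, 1%R]) (h s)%:E)%E.
Proof.
move=> mh; have mH : measurable_fun setT (EFin \o h) by exact/measurable_EFinP.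
have c1 : ((1 - 0)^-1 : R) = 1 by rewrite subr0 invr1.
rewrite [LHS]integralE [RHS]integralE.
rewrite !(integral_uniform (@ltr01 R)) ?c1 ?mul1e//.
- exact: measurable_funeneg.
- exact: measurable_funepos.
Qed.

End uniform.

(** * One step of the algorithm *)

Section algorithm_step.
Context {R : realType} {n d : nat}.
Variable M : set 'rV[R]_n.
Hypothesis hM : embedded_submanifold d M.
Variable Retr : 'rV[R]_n -> 'rV[R]_n -> 'rV[R]_n.
Hypothesis hRetr : is_retraction M Retr.

Lemma mvec_retr d' (O : measurableType d') (X Y : O -> 'rV[R]_n) :
  mvec X -> mvec Y -> (forall w, M (X w)) -> (forall w, tangent M (X w) (Y w)) ->
  mvec (fun w => Retr (X w) (Y w)).
Proof.
move=> mX mY MX tY i; have [sR _ _ _] := hRetr.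
have ZM w : tangent_bundle M (X w, Y w) by split; [exact: MX|exact: tY].
have mZ (W : set ('rV[R]_n * 'rV[R]_n)%type) (oW : open W) := mvec_pair_open mX mY oW.
refine (@cont_on_measurable _ _ O _ _ (fun p => Retr p.1 p.2 ord0 i) _ mZ ZM _).
refine (smooth_on_cont_on i sR).
Qed.

Lemma mvec_oproj d' (O : measurableType d') (X Y : O -> 'rV[R]_n) :
  mvec X -> mvec Y -> (forall w, M (X w)) ->
  mvec (fun w => oproj (tangent M (X w)) (Y w)).
Proof.
move=> mX mY MX.
have E w : oproj (tangent M (X w)) (Y w) =
    \sum_i Y w ord0 i *: oproj (tangent M (X w)) (delta_mx 0 i).
  exact: oproj_coord (projectable_tangent hM (MX w)).
under eq_fun do rewrite E; apply: mvec_sum => i; apply: mvecZ; first exact: mY.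
move=> j; apply: (cont_on_measurable _ MX (cont_on_oproj hM _ _)) => W oW.
exact: mvec_open.
Qed.

(** Both cases of the clipping in one factor, continuous in the norm of [v] and hence measurable. *)
Lemma clipE D x v : 0 < D -> M x -> tangent M x v ->
  clip M D x v = (D / Num.max (enorm v) D) *: v.
Proof.
move=> D0 Mx tv; rewrite /clip (nearest_ballE (projectable_tangent hM Mx) (ltW D0) tv).
by case: leP => // vD; rewrite mulfV// gt_eqF.
Qed.

Lemma mvec_clip d' (O : measurableType d') D (X Y : O -> 'rV[R]_n) : 0 < D ->
  mvec X -> mvec Y -> (forall w, M (X w)) -> (forall w, tangent M (X w) (Y w)) ->
  mvec (fun w => clip M D (X w) (Y w)).
Proof.
move=> D0 mX mY MX tY.
under eq_fun do rewrite clipE//.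
apply: mvecZ => //.
have cD : continuous (fun r : R => D / Num.max r D).
  move=> r; apply: cvgM; first exact: cvg_cst.
  apply: cvgV; first by rewrite gt_eqF// lt_max D0 orbT.
  apply: (@continuous_max _ _ id (cst D)); [exact: cvg_id|exact: cvg_cst].
exact: measurableT_comp (continuous_measurable_fun cD) (enorm_measurable mY).
Qed.

Variable C' : R.
Hypothesis hRB : retraction_bounded M Retr C'.
Hypothesis C'0 : 0 <= C'.
Context {dV : measure_display} {V : measurableType dV}.
Variables (mu : probability V R) (F : 'rV[R]_n -> V -> R) (L G sigma : R).
Hypothesis hF : forall x, M x -> mu.-integrable setT (EFin \o F x).
Hypothesis hO : oracle_assumption mu M F G sigma.
Hypothesis hLip : lipschitz_assumption mu M F L.
Hypotheses (G0 : 0 <= G) (L0 : 0 <= L).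
Let f := objective mu F.

Lemma objective_retr x xi (t : R) : M x -> tangent M x xi ->
  is_derive t 1 (fun r => f (Retr x (r *: xi)))
    (dotp (rgrad M f (Retr x (t *: xi))) (derive1 (fun r => Retr x (r *: xi)) t)).
Proof.
move=> Mx txi; have cM r := retr_M hM hRetr Mx txi r.
have nM : \forall r \near t, M (Retr x (r *: xi)) by near=> r.
have H := rgrad_curve hM nM (retr_derive hM hRetr Mx txi t)
  (objective_rdifferentiable hO (cM t)).
refine H.
Unshelve. all: by end_near. Qed.

(** Move along the gradient [g] itself. With [a = |g|], [objective_lipschitz] gives
    [|g|^2 <= (L^2 + |g|^2) / 2], so no constant is lost. *)
Lemma rgrad_le_L x : M x -> enorm (rgrad M f x) <= L.
Proof.
move=> Mx; set g := rgrad M f x.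
have tg : tangent M x g by exact: (rgrad_tangent hM).
have [->//|g0] := eqVneq (enorm g) 0.
have gp : 0 < enorm g by rewrite lt0r g0 enorm_ge0.
have E0 : Retr x (0 *: g) = x := retr_0 hRetr g Mx.
have dg := objective_retr 0 Mx tg.
rewrite (retr_derive0 hRetr Mx tg) E0 -/g in dg.
have K s : 0 <= s -> `|f (Retr x (s *: g)) - f (Retr x (0 *: g))| <=
    (L ^+ 2 / enorm g + enorm g) / 2 * enorm g * s.
  move=> s0; rewrite -mulrA (mulrC _ s) distrC.
  have := reach_retr hM hRetr Mx tg hRB 0 s; rewrite subr0 (ger0_norm s0) => h.
  apply: (objective_lipschitz hF hLip gp h); exact: (retr_M hM hRetr Mx tg).
have := is_derive_lipschitz_le dg K.
rewrite -enorm_sqr (_ : _ * _ = (L ^+ 2 + enorm g ^+ 2) / 2); last by field.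
move=> h; rewrite -(@ler_pXn2r _ 2%N) ?nnegrE//; lra.
Qed.

Lemma objective_step x xi : M x -> tangent M x xi ->
  `|f (Retr x xi) - f x| <= L * enorm xi.
Proof.
move=> Mx txi; have h (s : R) (_ : s \in `[0, 1]) := objective_retr s Mx txi.
have [c _] := MVT_closed ler01 h.
rewrite scale1r scale0r subr0 mulr1.
have -> : Retr x 0 = x by case: hRetr => _ _ + _; exact.
move=> ->; apply: (le_trans (normr_dotp _ _)); apply: ler_pM => //.
  by apply: rgrad_le_L; exact: (retr_M hM hRetr Mx txi).
exact: (retr_speed Mx txi hRB).
Qed.

Lemma objective_descent x xi : M x -> tangent M x xi ->
  f (Retr x xi) - f x <=
    \int[uniform_prob (@ltr01 R)]_s dotp (rgrad M f (Retr x (s *: xi))) xi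
    + G * C' * enorm xi ^+ 2.
Proof.
move=> Mx txi; have rM (s : R) := retr_M hM hRetr Mx txi s.
set psi := fun s => dotp (rgrad M f (Retr x (s *: xi)))
  (derive1 (fun r => Retr x (r *: xi)) s).
have psiK s : `|psi s| <= L * enorm xi.
  apply: (le_trans (normr_dotp _ _)); apply: ler_pM => //.
    exact: rgrad_le_L.
  exact: (retr_speed Mx txi hRB).
have [mpsi ipsi E] := bounded_derivative_FTC (fun s => objective_retr s Mx txi) psiK.
pose h s := dotp (rgrad M f (Retr x (s *: xi))) xi.
have mw : mvec (fun s : R => Retr x (s *: xi)).
  apply: mvec_retr => //.
    by apply: mvecZ; [exact: measurable_id|exact: mvec_cst].
  by move=> s; exact: (linsubZ (projectable_tangent hM Mx)).
have mh : measurable_fun setT h.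
  by apply: dotp_measurable; [exact: (mvec_rgrad hM hO)|exact: mvec_cst].
have E' : \int[uniform_prob (@ltr01 R)]_s h s =
    \int[lebesgue_measure]_(s in `[0, 1]) h s.
  by rewrite /Rintegral integral_uniform01.
rewrite E'.
have unit_fin : (lebesgue_measure (`[0%R, 1%R]%classic : set R) < +oo)%E.
  by rewrite lebesgue_measure_itv/= lte_fin ltr01 oppr0 adde0 ltry.
have ih : lebesgue_measure.-integrable `[0, 1] (EFin \o h).
  apply: measurable_bounded_integrable => //.
  - exact: measurable_funTS.
  - exists (G * enorm xi); split; first exact: num_real.
    move=> y Gy s _; apply: (le_trans (normr_dotp _ _)); apply: le_trans (ltW Gy).
    by apply: ler_wpM2r => //; exact: (rgrad_le_G hM hO G0).
have -> : f (Retr x xi) - f x = \int[lebesgue_measure]_(s in `[0, 1]) psi s.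
  rewrite /Rintegral E/= scale1r scale0r; congr (_ - f _).
  by case: hRetr => _ _ + _ => ->.
have c1 : lebesgue_measure.-integrable `[0, 1] (EFin \o cst (G * C' * enorm xi ^+ 2)).
  by apply: measurable_bounded_integrable => //; exact: bounded_cst.
apply: (@le_trans _ _ (\int[lebesgue_measure]_(s in `[0, 1]) (h s + G * C' * enorm xi ^+ 2))).
  apply: le_Rintegral => //.
    have /(_ _)/wrap[//|] := @integrableD _ _ _ lebesgue_measure `[0%R, 1%R]%classic _ _ _ ih c1.
    by apply: eq_integrable => // s _.
  move=> s; rewrite /= in_itv/= => /andP[s0 s1].
  (* The pointwise gap is [<grad f, gamma' - xi>]; the factor [s <= 1] in [retr_deviation] is
     dropped, hence [G C'] and not half of it. *)
  rewrite -lerBlDl -dotpBr; apply: (le_trans (dotp_le _ _)).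
  rewrite -mulrA; apply: ler_pM => //; first exact: (rgrad_le_G hM hO G0).
  apply: (le_trans (retr_deviation hM hRetr Mx txi hRB s0)).
  by rewrite ler_piMr// mulr_ge0// sqr_ge0.
rewrite RintegralD// lerD2l Rintegral_cst//.
have unit_meas : (lebesgue_measure (`[0%R, 1%R]%classic : set R) = 1)%E.
  by rewrite lebesgue_measure_itv/= lte_fin ltr01 oppr0 adde0.
by rewrite [X in fine X]unit_meas mulr1.
Qed.

End algorithm_step.

(** * Epochs of the algorithm *)

Section epoch.
Context {R : realType} {n d : nat}.
Variable M : set 'rV[R]_n.
Hypothesis hM : embedded_submanifold d M.
Variable Retr : 'rV[R]_n -> 'rV[R]_n -> 'rV[R]_n.
Hypothesis hRetr : is_retraction M Retr.
Context {dV : measure_display} {V : measurableType dV}.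
Variables (F : 'rV[R]_n -> V -> R) (D eta : R).
Hypothesis D0 : 0 < D.

Local Notation state := (epoch_state M Retr F D eta).

Lemma retr_in x xi : M x -> tangent M x xi -> M (Retr x xi).
Proof. by case: hRetr => _ h _ _; exact: h. Qed.

Lemma epoch_state_inv x0 s nu t : M x0 ->
  let st := state x0 s nu t in
  [/\ M st.1, tangent M st.1 st.2 & enorm st.2 <= D].
Proof.
move=> Mx0; elim: t => [|t [Mx tx xD]] /=.
  split => //; first exact: (linsub0 (projectable_tangent hM Mx0)).
  by rewrite enorm0 ltW.
have M1 := retr_in Mx tx; have hT := projectable_tangent hM M1.
have [h1 h2] := nearest_ball_in hT (ltW D0) (oprojS hT (
  (state x0 s nu t).2 - eta *: sgrad M F (query Retr (state x0 s nu t) (s t)) (nu t))).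
by split; [exact: M1|exact: h1|exact: h2].
Qed.

Lemma query_in x0 s nu t r : M x0 -> M (query Retr (state x0 s nu t) r).
Proof.
move=> Mx0; have [Mx tx _] := epoch_state_inv s nu t Mx0.
by apply: retr_in => //; exact: (linsubZ (projectable_tangent hM Mx)).
Qed.

Section measurability.
Context {mu : probability V R} {G sigma : R}.
Hypothesis hO : oracle_assumption mu M F G sigma.
Context {dO : measure_display} {O : measurableType dO}.

Lemma epoch_state_measurable (x0 : O -> 'rV[R]_n) (s : nat -> O -> R)
    (nu : nat -> O -> V) t : mvec x0 -> (forall w, M (x0 w)) ->
  (forall t', (t' < t)%N -> measurable_fun setT (s t')) ->
  (forall t', (t' < t)%N -> measurable_fun setT (nu t')) ->
  mvec (fun w => (state (x0 w) (s ^~ w) (nu ^~ w) t).1) /\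
  mvec (fun w => (state (x0 w) (s ^~ w) (nu ^~ w) t).2).
Proof.
move=> mx0 Mx0; elim: t => [|t IH] ms mn; first by split => //; exact: mvec_cst.
have [|| m1 m2] := IH; [by move=> t' tt'; apply: ms; exact: ltnW|
  by move=> t' tt'; apply: mn; exact: ltnW|].
have inv w := epoch_state_inv (s ^~ w) (nu ^~ w) t (Mx0 w).
have Mst w : M (state (x0 w) (s ^~ w) (nu ^~ w) t).1 by case: (inv w).
have Tst w : tangent M (state (x0 w) (s ^~ w) (nu ^~ w) t).1
    (state (x0 w) (s ^~ w) (nu ^~ w) t).2 by case: (inv w).
have mR := mvec_retr hRetr m1 m2 Mst Tst.
have MR w : M (Retr (state (x0 w) (s ^~ w) (nu ^~ w) t).1
    (state (x0 w) (s ^~ w) (nu ^~ w) t).2) by exact: retr_in.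
split => //=; apply: (mvec_clip hM) => //; last first.
  by move=> w; exact: oprojS (projectable_tangent hM (MR w)) _.
apply: (mvec_oproj hM) => //; apply: mvecB => //.
apply: mvecZ; first exact: measurable_cst.
apply: (mvec_sgrad hM hO); last exact: mn.
  apply: (mvec_retr hRetr) => //; first by apply: mvecZ => //; exact: ms.
  by move=> w; exact: (linsubZ (projectable_tangent hM (Mst w))).
by move=> w; exact: query_in.
Qed.

Lemma epoch_start_in T x0 s nu k : M x0 ->
  M (epoch_start M Retr F D eta T x0 s nu k).
Proof.
by move=> Mx0; elim: k => //= k IH; case: (epoch_state_inv (s k) (nu k) T IH).
Qed.

Section run.
Variables (T b : nat) (x0 : 'rV[R]_n) (s : nat -> nat -> O -> R)
  (nu : nat -> nat -> O -> V).
Hypotheses (Mx0 : M x0)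
  (ms : forall k t, (t < T)%N -> (k * T + t < b)%N -> measurable_fun setT (s k t))
  (mn : forall k t, (t < T)%N -> (k * T + t < b)%N -> measurable_fun setT (nu k t)).

Let start k (w : O) := epoch_start M Retr F D eta T x0 (fun k t => s k t w)
  (fun k t => nu k t w) k.

Lemma epoch_start_measurable k : (k * T <= b)%N -> mvec (start k).
Proof.
elim: k => [|k IH] kb /=; first exact: mvec_cst.
have kTb : (k * T <= b)%N by apply: leq_trans kb; rewrite mulSn leq_addl.
have h t : (t < T)%N -> (k * T + t < b)%N.
  move=> tT; apply: leq_trans kb; rewrite mulSn addnC; lia.
have [//||||m1 _] := @epoch_state_measurable (start k) (s k) (nu k) T.
- exact: IH.
- by move=> w; exact: epoch_start_in.
- by move=> t tT; apply: ms => //; exact: h.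
- by move=> t tT; apply: mn => //; exact: h.
exact: m1.
Qed.

(** Measurability is assumed only for the draws of rounds before [b], so that [O] may carry the
    coarse sigma-algebra of a past. *)
Lemma run_state_measurable k t : (t <= T)%N -> (k * T + t <= b)%N ->
  mvec (fun w => (state (start k w) (s k ^~ w) (nu k ^~ w) t).1) /\
  mvec (fun w => (state (start k w) (s k ^~ w) (nu k ^~ w) t).2).
Proof.
move=> tT kb; apply: epoch_state_measurable.
- by apply: epoch_start_measurable; apply: leq_trans kb; rewrite leq_addr.
- by move=> w; exact: epoch_start_in.
- by move=> t' tt'; apply: ms; lia.
- by move=> t' tt'; apply: mn; lia.
Qed.

End run.
End measurability.

Section regret_reach.
Variable C' : R.
Hypothesis hRB : retraction_bounded M Retr C'.
Variables (x0 : 'rV[R]_n) (s : nat -> R) (nu : nat -> V).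
Hypothesis Mx0 : M x0.
Let st := state x0 s nu.
Let W t := query Retr (st t) (s t).

Lemma reach_step a b t : 0 <= a -> a <= 1 -> 0 <= b -> b <= 1 ->
  reach M (query Retr (st t) a) (query Retr (st t) b) D.
Proof.
move=> a0 a1 b0 b1; have [Mx tx xD] := epoch_state_inv s nu t Mx0.
apply: reach_le (reach_retr hM hRetr Mx tx hRB a b).
apply: (@le_trans _ _ (1 * D)); last by rewrite mul1r.
by apply: ler_pM => //; rewrite ler_norml; apply/andP; split; lra.
Qed.

Lemma query0 t : query Retr (st t) 0 = (st t).1.
Proof.
have [Mx _ _] := epoch_state_inv s nu t Mx0; rewrite /query scale0r.
by case: hRetr => _ _ + _; exact.
Qed.

Lemma query1 t : query Retr (st t) 1 = (st t.+1).1.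
Proof. by rewrite /query scale1r. Qed.

Lemma reach_forward t j : reach M (st t).1 (st (t + j)).1 (j%:R * D).
Proof.
elim: j => [|j IH].
  by rewrite addn0 mul0r; apply: reach_refl; case: (epoch_state_inv s nu t Mx0).
rewrite addnS -natr1 mulrDl mul1r; apply: reach_trans IH _.
by rewrite -query0 -query1; apply: reach_step; lra.
Qed.

Lemma reach_backward t j : reach M (st (t + j)).1 (st t).1 (j%:R * D).
Proof.
elim: j => [|j IH].
  by rewrite addn0 mul0r; apply: reach_refl; case: (epoch_state_inv s nu t Mx0).
rewrite addnS -natr1 mulrDl mul1r addrC; apply: reach_trans _ IH.
by rewrite -query1 -query0; apply: reach_step; lra.
Qed.

(** From [W t] to the end of its step, through whole steps, then into the step of [W t']: at most
    [t' - t + 1 <= T] pieces of length [D]. For [t' < t] the curves are run backwards. *)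
Lemma reach_queries (T t t' : nat) :
  (forall t, (t < T)%N -> 0 <= s t <= 1) ->
  (t < T)%N -> (t' < T)%N -> reach M (W t) (W t') (T%:R * D).
Proof.
move=> s01 tT t'T; have /andP[a0 a1] := s01 t tT; have /andP[b0 b1] := s01 t' t'T.
have [<-|/eqP tt'] := eqVneq t t'.
  apply: reach_le (reach_step t a0 a1 a0 a1); apply: ler_peMl; first exact: ltW.
  by rewrite ler1n; exact: leq_trans tT.
have [lt|] := ltnP t t'.
  have h := reach_forward t.+1 (t' - t.+1); rewrite subnKC// in h.
  have h1 : reach M (W t) (st t.+1).1 D by rewrite -query1; apply: reach_step; lra.
  have h2 : reach M (st t').1 (W t') D by rewrite -query0; apply: reach_step; lra.
  apply: reach_le (reach_trans (reach_trans h1 h) h2).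
  rewrite -{1}(mul1r D) -{3}(mul1r D) -!mulrDl; apply: ler_wpM2r; first exact: ltW.
  by rewrite -[X in X + _ + _]/(1%:R) -[X in _ + _ + X]/(1%:R) -!natrD ler_nat; lia.
rewrite leq_eqVlt => /orP[/eqP E|lt]; first by rewrite E in tt'.
have h1 : reach M (W t) (st t).1 D by rewrite -query0; apply: reach_step; lra.
have h3 : reach M (st t'.+1).1 (W t') D by rewrite -query1; apply: reach_step; lra.
have h' := reach_backward t'.+1 (t - t'.+1); rewrite subnKC// in h'.
apply: reach_le (reach_trans (reach_trans h1 h') h3).
rewrite -{1}(mul1r D) -{3}(mul1r D) -!mulrDl; apply: ler_wpM2r; first exact: ltW.
by rewrite -[X in X + _ + _]/(1%:R) -[X in _ + _ + X]/(1%:R) -!natrD ler_nat; lia.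
Qed.

Variables (kappa : R) (h : 'rV[R]_n -> 'rV[R]_n).
Hypotheses (hk : dproj_bounded (d:=d) M kappa) (k0 : 0 <= kappa) (eta0 : 0 < eta).
Let g t := sgrad M F (W t) (nu t).

Lemma tangent_lip t r a u : 0 <= r -> r <= 1 ->
  `|dotp a (oproj (tangent M (query Retr (st t) r)) u
     - oproj (tangent M (st t).1) u)| <= kappa * D * (enorm a * enorm u).
Proof.
move=> r0 r1; have [Mx tx xD] := epoch_state_inv s nu t Mx0.
apply: le_trans (oproj_retr_lip hM hRetr Mx tx hRB hk a u r0) _.
apply: ler_wpM2r; first by rewrite mulr_ge0 ?enorm_ge0.
rewrite -mulrA; apply: ler_wpM2l => //.
by rewrite -[leRHS]mulr1; apply: ler_pM.
Qed.

(* The comparator is [- D S / |S|], where S is the sum of the vectors [h]. *)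
Lemma epoch_regret (T : nat) : (forall t, (t < T)%N -> 0 <= s t <= 1) ->
  D * enorm (\sum_(t < T) h (W t)) <=
    D * enorm (\sum_(t < T) (g t - h (W t)))
    - \sum_(t < T) dotp (g t) (st t).2
    + (2 * eta)^-1 * (D ^+ 2 + \sum_(t < T)
        (eta ^+ 2 * enorm (g t) ^+ 2 + 4 * (eta * (kappa * D ^+ 2)) * enorm (g t)
         + 4 * (kappa * D ^+ 3) + (kappa * D ^+ 2) ^+ 2)).
Proof.
move=> s01; set S := \sum_(t < T) h (W t); set e := \sum_(t < T) (g t - h (W t)).
(* If [S = 0], division by zero makes [u = 0], and both claims on [u] still hold. *)
pose u := - ((D / enorm S) *: S).
have [uD uS] : enorm u <= D /\ dotp S u = - (D * enorm S).
  rewrite /u enormN enormZ dotpNr dotpZr -enorm_sqr.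
  have [->|S0] := eqVneq (enorm S) 0; first by rewrite !mulr0 expr0n/= mulr0 ltW.
  have Sp : 0 < enorm S by rewrite lt0r S0 enorm_ge0.
  by rewrite ger0_norm ?divr_ge0 ?(ltW D0)// divfK//; split => //; field.
have D1 := ltW D0.
pose dl t := enorm ((st t).2 - oproj (tangent M (st t).1) u) ^+ 2.
pose c t := eta ^+ 2 * enorm (g t) ^+ 2 + 4 * (eta * (kappa * D ^+ 2)) * enorm (g t)
         + 4 * (kappa * D ^+ 3) + (kappa * D ^+ 2) ^+ 2.
have step t : (t < T)%N ->
    2 * eta * dotp (g t) ((st t).2 - u) <= dl t - dl t.+1 + c t.
  move=> tT; have [Mx tx xD] := epoch_state_inv s nu t Mx0.
  have [Mx' tx' _] := epoch_state_inv s nu t.+1 Mx0.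
  have /andP[r0 r1] := s01 t tT; have MW := query_in s nu t (s t) Mx0.
  have P1 a b : `|dotp a (oproj (tangent M (st t.+1).1) b
      - oproj (tangent M (st t).1) b)| <= kappa * D * (enorm a * enorm b).
    by rewrite -query1; exact: tangent_lip.
  have P2 a b : `|dotp a (oproj (tangent M (W t)) b
      - oproj (tangent M (st t).1) b)| <= kappa * D * (enorm a * enorm b).
    exact: tangent_lip.
  have tg : tangent M (W t) (g t) by exact: (rgrad_tangent hM).
  have H := @regret_step _ _ _ _ _ D eta kappa (st t).2 (st t.+1).2 (g t) u
    (projectable_tangent hM Mx) (projectable_tangent hM Mx')
    (projectable_tangent hM MW) D1 eta0 k0 P1 P2 tx xD tg uD erefl.
  by apply: (le_trans H); rewrite /dl /c; lra.
have tele j : (j <= T)%N -> \sum_(t < j) (2 * eta * dotp (g t) ((st t).2 - u)) <=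
    dl 0 - dl j + \sum_(t < j) c t.
  elim: j => [|j IH] jT; first by rewrite !big_ord0 subrr addr0.
  rewrite !big_ord_recr/=; have := IH (ltnW jT); have := step j jT.
  lra.
(* [Delta] starts at 0, so the initial distance to the comparator is at most [D]: the source of the
   term [D^2]. *)
have dl0 : dl 0 <= D ^+ 2.
  rewrite /dl /= sub0r enormN lerXn2r ?nnegrE ?enorm_ge0//.
  exact: le_trans (oproj_contr (projectable_tangent hM Mx0) _) uD.
have dlT : 0 <= dl T by exact: sqr_ge0.
have e2 : 0 < 2 * eta by rewrite mulr_gt0.
have := tele T (leqnn T); rewrite -mulr_sumr.
rewrite -ler_pdivlMl// => H.
(* The step uses [g] while [S] sums the vectors [h]: the difference [e] paired with [u] costs
   [D |e|], whereas [<S, u> = - D |S|] is the quantity sought. *)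
have E1 : \sum_(t < T) dotp (g t) ((st t).2 - u) =
    \sum_(t < T) dotp (g t) (st t).2 - dotp e u - dotp S u.
  rewrite /e /S !dotp_suml -!sumrB; apply: eq_bigr => t _.
  by rewrite dotpBr dotpBl; ring.
rewrite E1 uS in H.
have h1 : dotp e u <= D * enorm e.
  by apply: (le_trans (dotp_le _ _)); rewrite mulrC ler_wpM2r.
have h2 : (2 * eta)^-1 * (dl 0 - dl T + \sum_(t < T) c t) <=
    (2 * eta)^-1 * (D ^+ 2 + \sum_(t < T) c t).
  by apply: ler_wpM2l; [rewrite invr_ge0 ltW|rewrite lerD2r; lra].
rewrite -/(c _); lra.
Qed.

End regret_reach.
End epoch.

(** * Expectations *)

Section almost_everywhere.
Context {R : realType} {dT : measure_display} {T : measurableType dT}.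
Variable P : probability T R.

Lemma Rintegral_le_ae (N : set T) (X Y : T -> R) : measurable N -> P N = 0%E ->
  P.-integrable setT (EFin \o X) -> P.-integrable setT (EFin \o Y) ->
  (forall w, ~ N w -> X w <= Y w) -> \int[P]_w X w <= \int[P]_w Y w.
Proof.
move=> mN N0 iX iY XY.
have red (Z : T -> R) : P.-integrable setT (EFin \o Z) ->
    \int[P]_w Z w = \int[P]_(w in setT `\` N) Z w.
  by move=> iZ; rewrite /Rintegral (negligible_integral mN measurableT iZ N0).
rewrite (red X)// (red Y)//; apply: le_Rintegral => //.
- exact: measurableD.
- by apply: (integrableS measurableT) => //; exact: measurableD.
- by apply: (integrableS measurableT) => //; exact: measurableD.
- by move=> w [_ Nw]; exact: XY.
Qed.

End almost_everywhere.

Section randomness.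
Context {R : realType} {dO dV : measure_display} {O : measurableType dO}
  {V : measurableType dV}.
Variables (P : probability O R) (mu : probability V R) (K T : nat).
Variables (s : nat -> nat -> {RV P >-> R}) (nu : nat -> nat -> {RV P >-> V}).
Variable J : {RV P >-> nat}.
Hypothesis K0 : (0 < K)%N.
Hypothesis hrand : algorithm_randomness mu K T s nu J.

Let I : finType := (('I_K * 'I_T) + ('I_K * 'I_T) + unit)%type.
Let E : I -> set (set O) := @draw_sigma R dO dV O V K T (fun k t => s k t)
  (fun k t => nu k t) J.

(* Position of a draw in the order in which the algorithm makes its draws. *)
Definition draw_rank (i : I) : nat :=
  match i with
  | inl (inl (k, t)) => (k * T + t).*2
  | inl (inr (k, t)) => (k * T + t).*2.+1
  | inr _ => (K * T).*2
  end.

(** A copy of the sample space carrying the sigma-algebra of the draws before rank [j], so that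
    being determined by the past is [measurable_fun] on that copy. The state at step [t] of epoch
    [k] belongs to rank [(k T + t).*2], its query point to the next rank. *)
Definition past (j : nat) := g_sigma_algebraType
  (cylinders E [set i | (draw_rank i < j)%N]).

Let E_preimage i : exists d (U : measurableType d) (X : O -> U),
  measurable_fun setT X /\ E i = preimage_set_system setT X measurable.
Proof.
case: i => [[[k t]|[k t]]|u].
- by exists _, _, (s k t); split.
- by exists _, _, (nu k t); split.
- by exists _, _, J; split.
Qed.

Let ET i : E i setT.
Proof.
have [d [U [X [_ ->]]]] := E_preimage i.
by exists setT => //; rewrite preimage_setT setTI.
Qed.

Let EI i : setI_closed (E i).
Proof.
have [d [U [X [_ ->]]]] := E_preimage i.
move=> _ _ [A mA <-] [B mB <-]; exists (A `&` B); first exact: measurableI.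
by rewrite !setTI preimage_setI.
Qed.

Let EO i A : E i A -> measurable A.
Proof.
have [d [U [X [mX ->]]]] := E_preimage i.
by move=> [B mB <-]; exact: mX.
Qed.

Lemma past_sub j (A : set (past j)) : measurable A -> measurable (A : set O).
Proof.
move=> sA; suff : <<s cylinders E [set i | (draw_rank i < j)%N] >> `<=` @measurable dO O.
  exact.
apply: smallest_sub; first exact: sigma_algebra_measurable.
by move=> B; exact: cylinder_measurable.
Qed.

Lemma past_id_measurable j : measurable_fun setT (idfun : O -> past j).
Proof. by move=> _ A mA; rewrite setTI preimage_id; exact: past_sub. Qed.

Definition past_id j : {mfun O >-> past j} := mfun_Sub (mem_set (@past_id_measurable j)).

Lemma past_preimage j (i : I) d2 (U : measurableType d2) (X : O -> U) :
  (draw_rank i < j)%N -> (forall B, measurable B -> E i (X @^-1` B)) ->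
  measurable_fun setT (X : past j -> U).
Proof.
move=> ij EX _ B mB; rewrite setTI; apply: sub_sigma_algebra.
by apply: (sub_cylinders ET (i := i)); [rewrite inE|exact: EX].
Qed.

Lemma past_s j k t : (k < K)%N -> (t < T)%N -> ((k * T + t).*2 < j)%N ->
  measurable_fun setT (s k t : past j -> R).
Proof.
move=> kK tT h.
apply: (@past_preimage j (inl (inl (Ordinal kK, Ordinal tT)))) => // B mB.
by exists B => //; rewrite setTI.
Qed.

Lemma past_nu j k t : (k < K)%N -> (t < T)%N -> ((k * T + t).*2.+1 < j)%N ->
  measurable_fun setT (nu k t : past j -> V).
Proof.
move=> kK tT h.
apply: (@past_preimage j (inl (inr (Ordinal kK, Ordinal tT)))) => // B mB.
by exists B => //; rewrite setTI.
Qed.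

Lemma past_indep (i : I) d2 (U : measurableType d2) (X : {mfun O >-> U})
    (law : probability U R) :
  (forall B, measurable B -> E i (X @^-1` B)) ->
  (forall B, measurable B -> P (X @^-1` B) = law B) ->
  forall A B, measurable A -> measurable B ->
    P (past_id (draw_rank i) @^-1` A `&` X @^-1` B) =
    (P (past_id (draw_rank i) @^-1` A) * law B)%E.
Proof.
move=> EX lawX A B mA mB; rewrite -lawX//.
have [_ _ _ indE] := hrand.
apply: (cylinders_indep ET EI EO indE (i := i) (S := [set i0 | (draw_rank i0 < draw_rank i)%N])).
- by rewrite inE ltnn.
- exact: EX.
- exact: mA.
Qed.

Lemma draw_measurableR k t : measurable_fun setT (s k t : O -> measurableTypeR R).
Proof. exact: (measurable_funPT (s k t)). Qed.

(* The uniform distribution lives on [measurableTypeR R], which differs from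
   [R] by its display. *)
Definition draw_s k t : {mfun O >-> measurableTypeR R} :=
  @mfun_Sub _ _ O (measurableTypeR R) (s k t) (mem_set (@draw_measurableR k t)).

Lemma past_indep_s k t : (k < K)%N -> (t < T)%N ->
  forall A B, measurable A -> measurable B ->
    P (past_id (k * T + t).*2 @^-1` A `&` draw_s k t @^-1` B) =
    (P (past_id (k * T + t).*2 @^-1` A) * uniform_prob (@ltr01 R) B)%E.
Proof.
move=> kK tT; have [h _ _ _] := hrand.
refine (@past_indep (inl (inl (Ordinal kK, Ordinal tT))) _ _ (draw_s k t)
  (uniform_prob (@ltr01 R)) _ _) => B mB; last exact: (h k t kK tT B mB).
by exists B => //; rewrite setTI.
Qed.

Lemma past_indep_nu k t : (k < K)%N -> (t < T)%N ->
  forall A B, measurable A -> measurable B ->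
    P (past_id (k * T + t).*2.+1 @^-1` A `&` nu k t @^-1` B) =
    (P (past_id (k * T + t).*2.+1 @^-1` A) * mu B)%E.
Proof.
move=> kK tT; have [_ h _ _] := hrand.
refine (@past_indep (inl (inr (Ordinal kK, Ordinal tT))) _ _ (nu k t) mu _ _) => B mB.
  by exists B => //; rewrite setTI.
exact: (h k t kK tT B mB).
Qed.

Lemma past_indep_J :
  forall A B, measurable A -> measurable B ->
    P (past_id (K * T).*2 @^-1` A `&` J @^-1` B) =
    (P (past_id (K * T).*2 @^-1` A) * distribution P J B)%E.
Proof.
refine (@past_indep (inr tt) _ _ J (distribution P J) _ _) => B mB //.
by exists B => //; rewrite setTI.
Qed.

(** The draws have the right laws, but pathwise estimates need the right ranges; these hold off one
    null set, common to all rounds. *)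
Lemma draw_range_null : exists2 N, measurable N /\ P N = 0%E &
  forall w, ~ N w -> (J w < K)%N /\
    forall k t, (k < K)%N -> (t < T)%N -> 0 <= s k t w <= 1.
Proof.
have [hs _ hJ _] := hrand.
pose A := J @^-1` (~` `I_K).
pose B k t := s k t @^-1` (~` `[0%R, 1%R]).
pose N := A `|` \big[setU/set0]_(k < K) \big[setU/set0]_(t < T) B k t.
have mA : measurable A by rewrite -[A]setTI; exact: measurable_funPT.
have mB k t : measurable (B k t).
  by rewrite -[B k t]setTI; apply: measurable_funPT => //; apply: measurableC.
have mJ k : measurable (J @^-1` [set k]).
  by rewrite -[J @^-1` _]setTI; exact: measurable_funPT.
have A0 : P A = 0%E.
  have AE : A = ~` \big[setU/set0]_(k < K) (J @^-1` [set nat_of_ord k]).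
    rewrite /A preimage_setC; congr (~` _).
    rewrite -(bigcup_mkord K (fun k => J @^-1` [set k])).
    apply/seteqP; split => [w /= h|w [k /= h e]]; first by exists (J w).
    by rewrite /preimage/= /mkset in e *; rewrite e.
  rewrite AE probability_setC; last by apply: bigsetU_measurable => k _.
  have tJ : trivIset setT (fun k => J @^-1` [set k]).
    by apply/trivIsetP => i j _ _ ij; apply/seteqP; split => // w [/= -> /eqP]; rewrite (negbTE ij).
  rewrite (measure_bigsetU P mJ tJ).
  rewrite (eq_bigr (fun _ => (K%:R^-1)%:E)); last by move=> k _; exact: (hJ k (ltn_ord k)).
  rewrite sumEFin sumr_const card_ord -[_ *+ _]mulr_natr mulVf; last first.
    by rewrite pnatr_eq0 -lt0n.
  by rewrite subee.
have B0 k t : (k < K)%N -> (t < T)%N -> P (B k t) = 0%E.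
  move=> kK tT.
  rewrite [LHS](hs k t kK tT (~` `[0%R, 1%R]) _); last exact: measurableC.
  pose A01 : set (measurableTypeR R) := ~` `[0%R, 1%R].
  have m01 : measurable A01 by exact: measurableC.
  have -> : uniform_prob (@ltr01 R) A01 =
      (\int[uniform_prob (@ltr01 R)]_x (\1_A01 x)%:E)%E.
    by rewrite integral_indic// setIT.
  rewrite integral_uniform//.
    by rewrite integral_indic// setICl measure0 mule0.
  exact/measurable_EFinP/measurable_indic.
have bigP (A' : nat -> set O) (n : nat) :
    (forall k, (k < n)%N -> measurable (A' k) /\ P (A' k) = 0%E) ->
    measurable (\big[setU/set0]_(k < n) A' k) /\
    P (\big[setU/set0]_(k < n) A' k) = 0%E.
  move=> h; apply: (big_ind (fun S => measurable S /\ P S = 0%E)).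
  - by split.
  - by move=> S1 S2 [m1 h1] [m2 h2]; split; [exact: measurableU|rewrite null_set_setU].
  - by move=> i _; exact: h.
have [mN N0] := bigP (fun k => \big[setU/set0]_(t < T) B k t) K
  (fun k kK => bigP (B k) T (fun t tT => conj (mB k t) (B0 k t kK tT))).
exists N; first by split; [exact: measurableU|rewrite null_set_setU].
move=> w Nw; split.
  by apply: contra_notT Nw => JK; left => /=; exact/negP.
move=> k t kK tT; apply: contra_notT Nw => st; right.
rewrite -(bigcup_mkord K (fun k => \big[setU/set0]_(t < T) B k t)).
exists k => //; rewrite -(bigcup_mkord T (B k)); exists t => //.
by move=> /=; rewrite in_itv/=; exact/negP.
Qed.

End randomness.

(** * Expectations over a run *)

Section run.
Context {R : realType} {n d : nat}.
Variable M : set 'rV[R]_n.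
Hypothesis hM : embedded_submanifold d M.
Context {dV : measure_display} {V : measurableType dV}.
Variables (mu : probability V R) (F : 'rV[R]_n -> V -> R).
Hypothesis hF : forall x, M x -> mu.-integrable setT (EFin \o F x).
Variables (C' L G sigma : R).
Hypotheses (C'0 : 0 <= C') (L0 : 0 <= L) (G0 : 0 < G) (sigma0 : 0 <= sigma).
Variable Retr : 'rV[R]_n -> 'rV[R]_n -> 'rV[R]_n.
Hypotheses (hRetr : is_retraction M Retr) (hRB : retraction_bounded M Retr C').
Hypothesis hLip : lipschitz_assumption mu M F L.
Hypothesis hO : oracle_assumption mu M F G sigma.
Variables (K T : nat) (D eta : R).
Hypotheses (K0 : (0 < K)%N) (T0 : (0 < T)%N) (D0 : 0 < D).
Variable x0 : 'rV[R]_n.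
Hypothesis Mx0 : M x0.
Context {dO : measure_display} {O : measurableType dO}.
Variables (P : probability O R) (s : nat -> nat -> {RV P >-> R})
  (nu : nat -> nat -> {RV P >-> V}) (J : {RV P >-> nat}).
Hypothesis hrand : algorithm_randomness mu K T s nu J.

Let f := objective mu F.
Let start k (w : O) := epoch_start M Retr F D eta T x0
  (fun k t => s k t w) (fun k t => nu k t w) k.
Let st k t (w : O) := epoch_state M Retr F D eta (start k w)
  (fun t => s k t w) (fun t => nu k t w) t.
Let W k t (w : O) := query Retr (st k t w) (s k t w).
Let g k t (w : O) := sgrad M F (W k t w) (nu k t w).
Local Notation pst j := (past K T s nu J j).

Let Mstart k w : M (start k w).
Proof. exact: (epoch_start_in hM hRetr). Qed.

Let st_inv k t w : [/\ M (st k t w).1, tangent M (st k t w).1 (st k t w).2 &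
  enorm (st k t w).2 <= D].
Proof. exact: (epoch_state_inv hM hRetr). Qed.

Let MW k t w : M (W k t w).
Proof. exact: (query_in hM hRetr). Qed.

Let past_run j k t : (k < K)%N -> (t <= T)%N -> ((k * T + t).*2 <= j)%N ->
  mvec ((fun w => (st k t w).1) : pst j -> _) /\
  mvec ((fun w => (st k t w).2) : pst j -> _).
Proof.
move=> kK tT kj.
pose b := (k * T + t)%N.
have kK' k' t' : (k' * T + t' < b)%N -> (t' < T)%N -> (k' < K)%N.
  by rewrite /b; nia.
apply: (@run_state_measurable _ _ _ _ hM _ hRetr _ _ _ _ _ D0 _ _ _ hO _ (pst j) T b
  x0 (fun k t => s k t) (fun k t => nu k t)) => //.
- move=> k' t' t'T h; apply: past_s => //; first exact: kK' h t'T.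
  by apply: leq_trans kj; rewrite ltn_double.
- move=> k' t' t'T h; apply: past_nu => //; first exact: kK' h t'T.
  by apply: leq_trans kj; rewrite -/b; lia.
Qed.

Let W_measurable j k t : (k < K)%N -> (t < T)%N -> ((k * T + t).*2 < j)%N ->
  mvec (W k t : pst j -> _).
Proof.
move=> kK tT kj; have [m1 m2] := past_run kK (ltnW tT) (ltnW kj).
apply: (mvec_retr hRetr m1) => [|w|w].
- by apply: mvecZ => //; exact: past_s.
- by case: (st_inv k t w).
- by case: (st_inv k t w) => Mx tx _; exact: (linsubZ (projectable_tangent hM Mx)).
Qed.

Let past_full j p (X : O -> 'rV[R]_p) : mvec (X : pst j -> _) -> mvec X.
Proof. exact: (mvec_comp (@past_id_measurable _ _ _ _ _ P K T s nu J j)). Qed.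

Let Wm k t : (k < K)%N -> (t < T)%N -> mvec (W k t).
Proof.
move=> kK tT; apply: (@past_full (k * T + t).*2.+1).
exact: W_measurable.
Qed.

Let stm k t : (k < K)%N -> (t <= T)%N -> mvec (fun w => (st k t w).1) /\
  mvec (fun w => (st k t w).2).
Proof.
move=> kK tT; have [m1 m2] := past_run kK tT (leqnn _).
by split; [exact: past_full m1|exact: past_full m2].
Qed.

Let gm k t : (k < K)%N -> (t < T)%N -> mvec (g k t).
Proof. by move=> kK tT; apply: (mvec_sgrad hM hO) => //; exact: Wm. Qed.

Let rm k t : (k < K)%N -> (t < T)%N -> mvec (fun w => rgrad M f (W k t w)).
Proof. by move=> kK tT; apply: (mvec_rgrad hM hO) => //; exact: Wm. Qed.

Local Notation "'E[ X ]" := (\int[P]_w X w) (at level 10).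

Let dotp_stD k t a w : `|dotp a (st k t w).2| <= D * enorm a.
Proof.
have [_ _ h] := st_inv k t w; apply: (le_trans (normr_dotp _ _)).
by rewrite mulrC; apply: ler_wpM2r => //; exact: enorm_ge0.
Qed.

Lemma expectation_inner k t : (k < K)%N -> (t < T)%N ->
  [/\ P.-integrable setT (EFin \o (fun w => dotp (g k t w) (st k t w).2)),
      P.-integrable setT
        (EFin \o (fun w => dotp (rgrad M f (W k t w)) (st k t w).2))
    & 'E[fun w => dotp (g k t w) (st k t w).2] =
      'E[fun w => dotp (rgrad M f (W k t w)) (st k t w).2]].
Proof.
move=> kK tT; have ind := past_indep_nu hrand kK tT.
(* Odd rank: [s k t] is already drawn, so the query point and the step are known, and [nu k t] is
   the next independent draw. *)
set j := (k * T + t).*2.+1 in ind.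
pose h (z : pst j * V) := dotp (sgrad M F (W k t z.1) z.2) (st k t z.1).2.
have mW : mvec (W k t : pst j -> _) by exact: W_measurable.
have [_ mD] := @past_run j k t kK (ltnW tT) (leqnSn _).
have mh : measurable_fun setT h.
  apply: dotp_measurable; last exact: mvec_comp mD.
  by apply: (mvec_sgrad hM hO) => //; exact: (mvec_comp _ mW).
have hB w : (\int[mu]_v `|(h (past_id K T s nu J j w, v))%:E| <= (D * G)%:E)%E.
  have [iE Eb] := sgrad_enorm hM hO (ltW G0) (MW k t w).
  apply: (@le_trans _ _ (\int[mu]_v (D * enorm (sgrad M F (W k t w) v))%:E)%E).
    by apply: ge0_le_integral_sup => v _; rewrite lee_fin//; exact: dotp_stD.
  have iE' := integrable_scale D iE.
  rewrite (EFin_Rintegral iE') lee_fin RintegralZl//.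
  by apply: ler_wpM2l Eb; exact: ltW.
have [_ i1 i2 E] := indep_integral ind mh (integrable_const P (D * G)) hB.
have inner w : \int[mu]_v h (past_id K T s nu J j w, v) =
    dotp (rgrad M f (W k t w)) (st k t w).2.
  by have [] := sgrad_dotp hM hO (ltW G0) (st k t w).2 (MW k t w).
split; first exact: i1.
- by apply: eq_integrable i2 => // w _; rewrite /= inner.
- by rewrite [LHS]E; apply: eq_Rintegral => w _; rewrite inner.
Qed.

Lemma expectation_sgrad_sqr k t : (k < K)%N -> (t < T)%N ->
  P.-integrable setT (EFin \o (fun w => enorm (g k t w) ^+ 2)) /\
  'E[fun w => enorm (g k t w) ^+ 2] <= G ^+ 2.
Proof.
move=> kK tT; have ind := past_indep_nu hrand kK tT.
set j := (k * T + t).*2.+1 in ind.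
pose h (z : pst j * V) := enorm (sgrad M F (W k t z.1) z.2) ^+ 2.
have mW : mvec (W k t : pst j -> _) by exact: W_measurable.
have mh : measurable_fun setT h.
  apply: measurable_funX; apply: enorm_measurable.
  by apply: (mvec_sgrad hM hO) => //; exact: (mvec_comp _ mW).
apply: ge0_integrable_le => [|w|].
- by apply: measurable_funX; apply: enorm_measurable; exact: gm.
- exact: sqr_ge0.
have H0 : forall z : pst j * V, (0 <= (h z)%:E)%E.
  by move=> z; rewrite lee_fin sqr_ge0.
have mH : measurable_fun setT (EFin \o h) by exact/measurable_EFinP.
rewrite [X in (X <= _)%E](indep_tonelli ind mH H0).
apply: (@le_trans _ _ (\int[P]_w (G ^+ 2)%:E)%E).
  apply: ge0_le_integral_sup => w _; first by apply: integral_ge0 => v _; exact: H0.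
  by have [_ /(_ _ (MW k t w))[]] := hO.
by rewrite integral_cst// [X in (_ * X)%E]probability_setT mule1.
Qed.

Let noise k j w := \sum_(t < j) (g k t w - rgrad M f (W k t w)).

Let noise_measurable k j : (k < K)%N -> (j <= T)%N -> mvec (noise k j).
Proof.
move=> kK jT; rewrite /noise.
elim: j jT => [|j IH] jT; first by under eq_fun do rewrite big_ord0; exact: mvec_cst.
under eq_fun do rewrite big_ord_recr/=.
by apply: mvecD; [exact: IH (ltnW jT)|apply: mvecB; [exact: gm|exact: rm]].
Qed.

(** With [e] the noise accumulated so far, the cross term has mean 0 by unbiasedness. *)
Lemma sgrad_noise_sqr x e : M x ->
  (\int[mu]_v (enorm (e + (sgrad M F x v - rgrad M f x)) ^+ 2)%:E <=
   (enorm e ^+ 2 + sigma ^+ 2)%:E)%E.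
Proof.
move=> Mx; set r := rgrad M f x.
have mxi : mvec (fun v => sgrad M F x v - r).
  by apply: mvecB; [exact: (mvec_sgrad1 hM hO)|exact: mvec_cst].
have [i2 E2] : mu.-integrable setT (EFin \o (fun v => enorm (sgrad M F x v - r) ^+ 2)) /\
    \int[mu]_v (enorm (sgrad M F x v - r) ^+ 2) <= sigma ^+ 2.
  apply: ge0_integrable_le => [|v|].
  - by apply: measurable_funX; exact: enorm_measurable.
  - exact: sqr_ge0.
  - by have [_ /(_ x Mx)[]] := hO.
have [i1 E1] := sgrad_dotp hM hO (ltW G0) e Mx.
have E v : enorm (e + (sgrad M F x v - r)) ^+ 2 =
    (enorm (sgrad M F x v - r) ^+ 2 + 2 * dotp (sgrad M F x v) e)
    + (enorm e ^+ 2 - 2 * dotp r e).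
  move: (sgrad M F x v) (r) => y z; rewrite !enorm_sqr.
  by rewrite !(dotpDl, dotpDr, dotpNl, dotpNr) (dotpC e y) (dotpC e z) (dotpC z y); ring.
have i3 := integrable_add i2 (integrable_scale 2 i1).
have i4 := integrable_add i3 (integrable_const mu (enorm e ^+ 2 - 2 * dotp r e)).
under eq_integral do rewrite E.
rewrite (EFin_Rintegral i4) lee_fin RintegralD//; last exact: integrable_const.
rewrite RintegralD//; last exact: integrable_scale.
rewrite RintegralZl// E1 Rintegral_const -/r; lra.
Qed.

Lemma expectation_noise_sqr k j : (k < K)%N -> (j <= T)%N ->
  P.-integrable setT (EFin \o (fun w => enorm (noise k j w) ^+ 2)) /\
  'E[fun w => enorm (noise k j w) ^+ 2] <= j%:R * sigma ^+ 2.
Proof.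
move=> kK; elim: j => [|t IH] tT.
  have E : (fun w => enorm (noise k 0 w) ^+ 2) = cst 0.
    by apply/funext => w; rewrite /noise big_ord0 enorm0 expr0n.
  by rewrite E; split; [exact: integrable_const|rewrite Rintegral_const mul0r].
have [IH1 IH2] := IH (ltnW tT); have ind := past_indep_nu hrand kK tT.
set j := (k * T + t).*2.+1 in ind.
have mg t' : (t' < t)%N -> mvec (g k t' : pst j -> _).
  move=> t't; apply: (mvec_sgrad hM hO) => //.
    by apply: W_measurable => //; [exact: ltn_trans tT|rewrite /j; lia].
  by apply: past_nu => //; [exact: ltn_trans tT|rewrite /j; lia].
have mr t' : (t' <= t)%N -> mvec ((fun w => rgrad M f (W k t' w)) : pst j -> _).
  move=> t't; apply: (mvec_rgrad hM hO) => //.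
  by apply: W_measurable => //; [exact: leq_ltn_trans tT|rewrite /j; lia].
have mN : mvec (noise k t : pst j -> _).
  move=> i; rewrite (_ : (fun w => _) = (fun w =>
    \sum_(t' < t) (g k t' w - rgrad M f (W k t' w)) ord0 i)); last first.
    by apply/funext => w; rewrite summxE.
  apply: measurable_sum => t'.
  exact: (mvecB (mg t' (ltn_ord t')) (mr t' (ltnW (ltn_ord t'))) i).
pose h (z : pst j * V) := enorm (noise k t z.1 +
  (sgrad M F (W k t z.1) z.2 - rgrad M f (W k t z.1))) ^+ 2.
have mh : measurable_fun setT h.
  apply: measurable_funX; apply: enorm_measurable; apply: mvecD.
    exact: (mvec_comp _ mN).
  apply: mvecB; last exact: (mvec_comp _ (mr t (leqnn t))).
  have mW : mvec (W k t : pst j -> _) by exact: W_measurable.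
  by apply: (mvec_sgrad hM hO) => //; exact: (mvec_comp _ mW).
have NE w : enorm (noise k t.+1 w) ^+ 2 = h (past_id K T s nu J j w, nu k t w).
  by rewrite /noise big_ord_recr.
have H0 : forall z : pst j * V, (0 <= (h z)%:E)%E.
  by move=> z; rewrite lee_fin sqr_ge0.
have mH : measurable_fun setT (EFin \o h) by exact/measurable_EFinP.
have iS : P.-integrable setT (EFin \o (fun w => enorm (noise k t w) ^+ 2 + sigma ^+ 2)).
  by apply: integrable_add => //; exact: integrable_const.
apply: ge0_integrable_le => [|w|].
- by apply: measurable_funX; apply: enorm_measurable; exact: noise_measurable.
- exact: sqr_ge0.
under eq_integral do rewrite NE.
rewrite [X in (X <= _)%E](indep_tonelli ind mH H0).
apply: (@le_trans _ _ (\int[P]_w (enorm (noise k t w) ^+ 2 + sigma ^+ 2)%:E)%E).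
  apply: ge0_le_integral_sup => w _; first by apply: integral_ge0 => v _; exact: H0.
  refine (@sgrad_noise_sqr (W k t w) (noise k t w) (MW k t w)).
rewrite (EFin_Rintegral iS) lee_fin (RintegralD measurableT IH1); last exact: integrable_const.
by rewrite Rintegral_const -natr1 mulrDl mul1r lerD2r.
Qed.

(** [f] may be unbounded on [M], but each step changes it by at most [L D]; after finitely many
    steps it is bounded along the run, hence integrable. *)
Let f_step k t w : `|f (st k t.+1 w).1 - f (st k t w).1| <= L * D.
Proof.
have [Mx tx xD] := st_inv k t w.
apply: (le_trans (objective_step hM hRetr hRB hF hO hLip L0 Mx tx)).
exact: ler_wpM2l.
Qed.

Let f_state_bound k t w : `|f (st k t w).1 - f (start k w)| <= t%:R * (L * D).
Proof.
elim: t => [|t IH]; first by rewrite subrr normr0 mul0r.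
rewrite -natr1 mulrDl mul1r [leRHS]addrC.
apply: (le_trans (ler_distD (f (st k t w).1) _ _)).
by apply: lerD IH; exact: f_step.
Qed.

Let f_start_bound k w : `|f (start k w) - f x0| <= (k * T)%:R * (L * D).
Proof.
elim: k => [|k IH]; first by rewrite subrr normr0 mul0r.
rewrite mulSn natrD mulrDl.
apply: (le_trans (ler_distD (f (start k w)) _ _)).
by apply: lerD IH; exact: f_state_bound.
Qed.

Let f_integrable k t : (k < K)%N -> (t <= T)%N ->
  P.-integrable setT (EFin \o (fun w => f (st k t w).1)).
Proof.
move=> kK tT; have [m1 _] := stm kK tT.
have M1 w : M (st k t w).1 by case: (st_inv k t w).
have mf := objective_measurable hO m1 M1.
apply: (integrable_le mf _ (integrable_const P
  (t%:R * (L * D) + ((k * T)%:R * (L * D) + `|f x0|)))) => w /=.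
rewrite -[X in `|X|](subrK (f (start k w))); apply: (le_trans (ler_normD _ _)).
apply: lerD; first exact: f_state_bound.
rewrite -[X in `|X|](subrK (f x0)); apply: (le_trans (ler_normD _ _)).
by rewrite lerD2r; exact: f_start_bound.
Qed.

Lemma expectation_descent k t : (k < K)%N -> (t < T)%N ->
  'E[fun w => f (st k t.+1 w).1] - 'E[fun w => f (st k t w).1] <=
  'E[fun w => dotp (g k t w) (st k t w).2] + G * C' * D ^+ 2.
Proof.
move=> kK tT; have [_ _ ->] := expectation_inner kK tT; have ind := past_indep_s hrand kK tT.
(* Even rank: the state is known and [s k t] comes next; integrating it against the uniform law
   produces the integral in [objective_descent]. *)
set j := (k * T + t).*2 in ind.
have [m1 m2] := @past_run j k t kK (ltnW tT) (leqnn _).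
pose h (z : pst j * measurableTypeR R) :=
  dotp (rgrad M f (query Retr (st k t z.1) z.2)) (st k t z.1).2.
have Mq (w : O) (r : R) : M (query Retr (st k t w) r) by exact: (query_in hM hRetr).
have tr (w : O) (r : R) : tangent M (st k t w).1 (r *: (st k t w).2).
  by have [Mx tx _] := st_inv k t w; exact: (linsubZ (projectable_tangent hM Mx)).
have mfst : measurable_fun setT (fst : pst j * measurableTypeR R -> pst j).
  exact: measurable_fst.
have msnd : measurable_fun setT (snd : pst j * measurableTypeR R -> R).
  exact: measurable_snd.
have mq : mvec (fun z : pst j * measurableTypeR R => query Retr (st k t z.1) z.2).
  apply: (mvec_retr hRetr).
  - exact: (mvec_comp mfst m1).
  - by apply: (mvecZ msnd); exact: (mvec_comp mfst m2).
  - by move=> z; case: (st_inv k t z.1).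
  - by move=> z; exact: tr.
have mh : measurable_fun setT h.
  apply: dotp_measurable; last exact: (mvec_comp mfst m2).
  by apply: (mvec_rgrad hM hO) => // z; exact: Mq.
have hB w : (\int[uniform_prob (@ltr01 R)]_r `|(h (past_id K T s nu J j w, r))%:E| <=
    (D * G)%:E)%E.
  apply: (@le_trans _ _ (\int[uniform_prob (@ltr01 R)]_r (D * G)%:E)%E).
    apply: ge0_le_integral_sup => r _ //; rewrite lee_fin.
    apply: (le_trans (dotp_stD _ _ _ _)); apply: ler_wpM2l; first exact: ltW.
    exact: (rgrad_le_G hM hO (ltW G0)).
  by rewrite integral_cst// [X in (_ * X)%E]probability_setT mule1.
have [_ i1 i2 E] := indep_integral ind mh (integrable_const P (D * G)) hB.
have i3 : P.-integrable setT
    (EFin \o (fun w => \int[uniform_prob (@ltr01 R)]_r h (w, r))) by exact: i2.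
have E' : 'E[fun w => dotp (rgrad M f (W k t w)) (st k t w).2] =
    'E[fun w => \int[uniform_prob (@ltr01 R)]_r h (w, r)] by exact: E.
rewrite E' -RintegralB//; [|exact: f_integrable|exact: f_integrable (ltnW tT)].
rewrite -[X in _ <= _ + X](Rintegral_const P) -RintegralD//; last exact: integrable_const.
apply: le_Rintegral => //.
- have := integrableB measurableT (f_integrable kK tT) (f_integrable kK (ltnW tT)).
  by apply: eq_integrable => // w _.
- by apply: integrable_add => //; exact: integrable_const.
move=> w _; have [Mx tx xD] := st_inv k t w.
apply: (le_trans (objective_descent hM hRetr hRB C'0 hF hO hLip (ltW G0) L0 Mx tx)).
rewrite lerD2l; apply: ler_wpM2l; first by rewrite mulr_ge0// ltW.
by rewrite lerXn2r ?nnegrE ?enorm_ge0// ltW.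
Qed.

Variable kappa : R.
Hypotheses (hk : dproj_bounded (d:=d) M kappa) (k0 : 0 <= kappa) (eta0 : 0 < eta).
Let S k w := \sum_(t < T) rgrad M f (W k t w).

(** The pathwise bound [epoch_regret] is integrated term by term; the inner products [<g, Delta>]
    are bounded below by [expectation_descent], whose sum over the epoch telescopes to the change of
    [f]. *)
Lemma expectation_epoch k : (k < K)%N ->
  P.-integrable setT (EFin \o (fun w => enorm (S k w))) /\
  D * 'E[fun w => enorm (S k w)] <=
    D * (sigma * Num.sqrt T%:R)
    + ('E[fun w => f (start k w)] - 'E[fun w => f (start k.+1 w)]
       + T%:R * (G * C' * D ^+ 2))
    + (2 * eta)^-1 * (D ^+ 2 + T%:R *
        (eta ^+ 2 * G ^+ 2 + 4 * (eta * (kappa * D ^+ 2)) * G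
         + 4 * (kappa * D ^+ 3) + (kappa * D ^+ 2) ^+ 2)).
Proof.
move=> kK.
have mS : mvec (S k).
  move=> i; rewrite (_ : (fun w => _) = (fun w =>
    \sum_(t < T) rgrad M f (W k t w) ord0 i)); last first.
    by apply/funext => w; rewrite summxE.
  by apply: measurable_sum => t; exact: (rm kK (ltn_ord t)).
have iS : P.-integrable setT (EFin \o (fun w => enorm (S k w))).
  apply: (integrable_le (enorm_measurable mS) _ (integrable_const P (\sum_(t < T) G))).
  move=> w; rewrite ger0_norm ?enorm_ge0//; apply: (le_trans (enorm_sum _ _ _)).
  by apply: ler_sum => t _; exact: (rgrad_le_G hM hO (ltW G0)).
split => //.
have [iN2 N2] := expectation_noise_sqr kK (leqnn T).
have [iN EN] : P.-integrable setT (EFin \o (fun w => enorm (noise k T w))) /\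
    'E[fun w => enorm (noise k T w)] <= sigma * Num.sqrt T%:R.
  apply: expectation_le_sqr => //; first by rewrite mulr_ge0 ?sqrtr_ge0.
    by apply: enorm_measurable; exact: noise_measurable.
  by rewrite exprMn sqr_sqrtr// mulrC.
have ig2 (t : 'I_T) := (expectation_sgrad_sqr kK (ltn_ord t)).1.
have Eg2 (t : 'I_T) := (expectation_sgrad_sqr kK (ltn_ord t)).2.
have g1 (t : 'I_T) : P.-integrable setT (EFin \o (fun w => enorm (g k t w))) /\
    'E[fun w => enorm (g k t w)] <= G.
  apply: expectation_le_sqr => //; first exact: ltW.
  by apply: enorm_measurable; exact: gm.
pose q := 4 * (kappa * D ^+ 3) + (kappa * D ^+ 2) ^+ 2.
pose c (t : 'I_T) w := (eta ^+ 2 * enorm (g k t w) ^+ 2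
  + 4 * (eta * (kappa * D ^+ 2)) * enorm (g k t w)) + q.
have D1 := ltW D0; have e1 := ltW eta0.
have a0 : 0 <= 4 * (eta * (kappa * D ^+ 2)) by rewrite !mulr_ge0// exprn_ge0.
have ic t : P.-integrable setT (EFin \o c t).
  apply: integrable_add; last exact: integrable_const.
  by apply: integrable_add; apply: integrable_scale => //; exact: (g1 t).1.
have Ec t : 'E[c t] <= eta ^+ 2 * G ^+ 2 + 4 * (eta * (kappa * D ^+ 2)) * G + q.
  rewrite /c RintegralD//; last exact: integrable_const.
    rewrite Rintegral_const lerD2r RintegralD//.
    - rewrite !RintegralZl//; last exact: (g1 t).1.
      apply: lerD; first by apply: ler_wpM2l (Eg2 t); exact: sqr_ge0.
      exact: ler_wpM2l (g1 t).2.
    - exact: integrable_scale.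
    - by apply: integrable_scale; exact: (g1 t).1.
  by apply: integrable_add; apply: integrable_scale => //; exact: (g1 t).1.
pose ip w := \sum_(t < T) dotp (g k t w) (st k t w).2.
have iip : P.-integrable setT (EFin \o ip).
  by apply: integrable_bigsum => t; have [] := expectation_inner kK (ltn_ord t).
have Eip : 'E[fun w => f (start k.+1 w)] - 'E[fun w => f (start k w)]
    - T%:R * (G * C' * D ^+ 2) <= 'E[ip].
  rewrite /ip Rintegral_bigsum; last first.
    by move=> t; have [] := expectation_inner kK (ltn_ord t).
  have tele j : (j <= T)%N -> 'E[fun w => f (st k j w).1] - 'E[fun w => f (start k w)]
      <= \sum_(t < j) ('E[fun w => dotp (g k t w) (st k t w).2] + G * C' * D ^+ 2).
    elim: j => [|j IH] jT; first by rewrite big_ord0 subrr.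
    rewrite big_ord_recr/=; have := IH (ltnW jT); have := expectation_descent kK jT.
    lra.
  have := tele T (leqnn T); rewrite big_split/= sumr_const card_ord -[_ *+ T]mulr_natl.
  by rewrite -lerBlDr.
pose Z w := (D * enorm (noise k T w) + (-1) * ip w) +
  (2 * eta)^-1 * (D ^+ 2 + \sum_(t < T) c t w).
have iA : P.-integrable setT (EFin \o (fun w => D * enorm (noise k T w) + (-1) * ip w)).
  by apply: integrable_add; exact: integrable_scale.
have iC : P.-integrable setT (EFin \o (fun w => D ^+ 2 + \sum_(t < T) c t w)).
  by apply: integrable_add; [exact: integrable_const|exact: integrable_bigsum].
have iC' := integrable_scale (2 * eta)^-1 iC.
have iZ : P.-integrable setT (EFin \o Z) by exact: integrable_add.
have [Nul [mNul Nul0] hNul] := draw_range_null K0 hrand.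
rewrite -RintegralZl//.
apply: (@le_trans _ _ (\int[P]_w Z w)).
  apply: (Rintegral_le_ae mNul Nul0 _ iZ); first exact: integrable_scale.
  move=> w /hNul[_ s01].
  have s01' t : (t < T)%N -> 0 <= s k t w <= 1 by move=> tT; exact: s01.
  have := @epoch_regret _ _ _ _ hM _ hRetr _ _ F D eta D0 C' hRB (start k w)
    (fun t => s k t w) (fun t => nu k t w) (Mstart k w) kappa (rgrad M f) hk k0 eta0 T s01'.
  move/le_trans; apply; rewrite /Z mulN1r.
  rewrite lerD2l; apply: ler_wpM2l; first by rewrite invr_ge0 mulr_ge0.
  by rewrite lerD2l; apply: ler_sum => t _; rewrite /c /q addrA.
rewrite /Z RintegralD//; apply: lerD.
  rewrite RintegralD//; [|exact: integrable_scale|exact: integrable_scale].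
  rewrite !RintegralZl//; apply: lerD; first exact: ler_wpM2l.
  by move: Eip; lra.
rewrite RintegralZl//; apply: ler_wpM2l; first by rewrite invr_ge0 mulr_ge0.
rewrite RintegralD//; [|exact: integrable_const|exact: integrable_bigsum].
rewrite Rintegral_const lerD2l Rintegral_bigsum//.
apply: (@le_trans _ _ (\sum_(t < T)
  (eta ^+ 2 * G ^+ 2 + 4 * (eta * (kappa * D ^+ 2)) * G + q))).
  by apply: ler_sum => t _; exact: Ec.
by rewrite sumr_const card_ord -[_ *+ T]mulr_natl /q addrA.
Qed.

Variables (C delta : R).
Hypotheses (C0 : 0 <= C) (hC : dproj_bounded (d:=d) M C)
  (deltaE : T%:R * D = delta)
  (hgeo : forall x y, M x -> M y -> (gdist M x y <= delta%:E)%E ->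
     exists c, min_geodesic M x y c).

Let S_measurable j k : (k < K)%N -> ((K * T).*2 <= j)%N -> mvec (S k : pst j -> _).
Proof.
move=> kK Kj i; rewrite (_ : (fun w => _) = (fun w =>
  \sum_(t < T) rgrad M f (W k t w) ord0 i)); last first.
  by apply/funext => w; rewrite summxE.
apply: measurable_sum => t; apply: (mvec_rgrad hM hO) => //.
apply: W_measurable => //; apply: leq_trans Kj; rewrite ltn_double.
apply: (@leq_trans (k.+1 * T)); first by rewrite mulSnr ltn_add2l.
by rewrite leq_mul2r kK orbT.
Qed.

(** The index [J] is drawn last, so it is independent of the run, and averaging over it gives the
    uniform mean over epochs. Any two queries of an epoch are within [T D = delta] of each other. *)
Lemma expectation_goldstein :
  (\int[P]_w goldstein_norm M delta f (W (J w) T./2 w) <=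
   (K%:R^-1 * \sum_(k < K) ((\int[P]_w enorm (S k w)) / T%:R) + delta * L * C)%:E)%E.
Proof.
have dl0 : 0 <= delta by rewrite -deltaE mulr_ge0// ltW.
have [Nul [mNul Nul0] hNul] := draw_range_null K0 hrand.
pose Y k w := T%:R^-1 * enorm (S k w) + delta * L * C.
have Y0 k w : 0 <= Y k w by rewrite addr_ge0 ?mulr_ge0 ?enorm_ge0 ?invr_ge0.
have iY k : (k < K)%N -> P.-integrable setT (EFin \o Y k).
  move=> kK; apply: integrable_add; last exact: integrable_const.
  by apply: integrable_scale; have [] := expectation_epoch kK.
have bound w : ~ Nul w ->
    (goldstein_norm M delta f (W (J w) T./2 w) <= (Y (J w) w)%:E)%E.
  move=> /hNul[JK s01].
  have s01' t : (t < T)%N -> 0 <= s (J w) t w <= 1 by move=> tT; exact: s01.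
  have T2 : (T./2 < T)%N by rewrite -divn2 ltn_Pdiv.
  have reachW t t' : (t < T)%N -> (t' < T)%N -> reach M (W (J w) t w) (W (J w) t' w) delta.
    move=> tT t'T; rewrite -deltaE.
    refine (@reach_queries _ _ _ _ hM _ hRetr _ _ F D eta D0 C' hRB (start (J w) w)
      (fun t => s (J w) t w) (fun t => nu (J w) t w) (Mstart (J w) w) T t t' s01' tT t'T).
  have H := @goldstein_norm_le _ _ _ _ hM f C L delta C0 hC
    (fun x => objective_rdifferentiable hO (x := x))
    (fun x => rgrad_le_L hM hRetr hRB hF hO hLip L0 (x := x)) hgeo T
    (fun t : 'I_T => W (J w) t w) (W (J w) T./2 w) T0 (MW _ _ _) (fun t => MW _ _ _)
    (fun t => reachW _ _ (ltn_ord t) T2) (fun t => reachW _ _ T2 (ltn_ord t)).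
  by rewrite /Y mulrC; exact: H.
have ind := past_indep_J hrand.
set j := (K * T).*2 in ind.
(* [Y (J w) w] as a function of path and index: a finite sum of indicators, so joint measurability
   is immediate. *)
pose h (z : pst j * nat) := \sum_(k < K) Y k z.1 * \1_[set nat_of_ord k] z.2.
have mY (k : 'I_K) : measurable_fun setT (Y k : pst j -> R).
  apply: measurable_funD; last exact: measurable_cst.
  apply: measurable_funM; first exact: measurable_cst.
  by apply: enorm_measurable; exact: S_measurable.
have mh : measurable_fun setT h.
  apply: measurable_sum => k; apply: measurable_funM.
    exact: measurableT_comp (mY k) measurable_fst.
  have m1 : measurable_fun setT (\1_[set nat_of_ord k] : nat -> R).
    exact: measurable_indic.
  exact: measurableT_comp m1 measurable_snd.
have h0 z : 0 <= h z by apply: sumr_ge0 => k _; rewrite mulr_ge0.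
have hJ w : (J w < K)%N -> h (w, J w) = Y (J w) w.
  move=> JK; rewrite /h (bigD1 (Ordinal JK))//= indicE mem_set// mulr1 big1 ?addr0//.
  move=> k kJ; rewrite indicE memNset ?mulr0// => /= E; move: kJ.
  by rewrite -val_eqE/= E eqxx.
have mH : measurable_fun setT (EFin \o h) by exact/measurable_EFinP.
have H0 z : (0 <= (h z)%:E)%E by rewrite lee_fin.
have mhJ : measurable_fun setT (fun w => (h (w, J w))%:E).
  have mp : measurable_fun setT (fun w => (past_id K T s nu J j w, J w)).
    exact: measurable_fun_pair.
  exact: measurableT_comp mH mp.
have iYs : P.-integrable setT (EFin \o (fun w => K%:R^-1 * \sum_(k < K) Y k w)).
  by apply: integrable_scale; apply: integrable_bigsum => k; exact: iY.
have inner w : (\int[distribution P J]_i (h (w, i))%:E =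
    (K%:R^-1 * \sum_(k < K) Y k w)%:E)%E.
  have i1 (k : 'I_K) : (distribution P J).-integrable setT
      (EFin \o (\1_[set nat_of_ord k] : nat -> R)).
    apply: (integrable_le _ _ (integrable_const _ 1)) => [|i].
      exact: measurable_indic.
    by rewrite /= indicE; case: (_ \in _); rewrite ?normr1 ?normr0.
  have i2 (k : 'I_K) := integrable_scale (Y k w) (i1 k).
  have i3 := integrable_bigsum (index_enum 'I_K) i2.
  rewrite (EFin_Rintegral i3); congr EFin.
  rewrite Rintegral_bigsum// mulr_sumr; apply: eq_bigr => k _.
  rewrite RintegralZl// mulrC; congr (_ * _).
  rewrite /Rintegral integral_indic// setIT.
  have [_ _ lawJ _] := hrand; exact: (congr1 fine (lawJ k (ltn_ord k))).
(* Adding [+oo] on the null set makes the bound valid at every point, so that [ge0_le_integral_sup]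
   applies to the Goldstein norm itself. *)
apply: (@le_trans _ _ (\int[P]_w ((h (w, J w))%:E + ((cst +oo) \_ Nul) w))%E).
  apply: ge0_le_integral_sup => w _.
    by apply: le_ereal_inf_tmp => _ [v _ <-]; rewrite lee_fin enorm_ge0.
  have [wN|wN] := pselect (Nul w).
    by rewrite patchT ?inE// addey ?leey// -ltNye (lt_le_trans _ (H0 _)).
  rewrite patchN ?adde0; last by apply/negP; rewrite inE.
  by have [JK _] := hNul _ wN; rewrite hJ//; exact: bound.
rewrite ge0_integralD//.
- rewrite -integral_mkcond (@null_set_integral _ _ _ P Nul (cst +oo%E))// adde0.
  have -> : (\int[P]_w (h (w, J w))%:E)%E =
      (\int[P]_w \int[distribution P J]_i (h (w, i))%:E)%E.
    exact: (indep_tonelli ind mH H0).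
  under eq_integral do rewrite inner.
  rewrite (EFin_Rintegral iYs) lee_fin RintegralZl//; last first.
    by apply: integrable_bigsum => k; exact: iY.
  rewrite Rintegral_bigsum; last by move=> k; exact: iY.
  have EY (k : 'I_K) : \int[P]_w Y k w =
      (\int[P]_w enorm (S k w)) / T%:R + delta * L * C.
    have [iS _] := expectation_epoch (ltn_ord k).
    rewrite /Y RintegralD//; [|exact: integrable_scale|exact: integrable_const].
    by rewrite (RintegralZl _ _ iS)// Rintegral_const mulrC.
  under eq_bigr do rewrite EY.
  have Kn0 : K%:R != 0 :> R by rewrite pnatr_eq0 -lt0n.
  rewrite big_split/= sumr_const card_ord -[delta * L * C *+ K]mulr_natl mulrDr.
  by rewrite mulKf.
- by move=> w _; rewrite /patch; case: ifPn => // _; exact: leey.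
- apply/(measurable_restrictT _ mNul); exact: measurable_cst.
Qed.

End run.

(** * Parameter choices and the final rate *)

Lemma step_sizes (R : realType) (delta : R) (K T : nat) : 0 < delta ->
  (0 < K)%N -> T%:R = (delta * (K * T)%N%:R) `^ (2 / 3) :> R -> (0 < T)%N ->
  exists c : R, [/\ 0 < c, c ^+ 2 = T%:R, delta * K%:R = c,
    (delta * (K * T)%N%:R) `^ (- (1 / 3)) = c^-1 &
    delta `^ (1 / 3) * (K * T)%N%:R `^ (- (2 / 3)) = delta / c ^+ 2].
Proof.
move=> d0 K0 TE T0; have N0 : 0 < (K * T)%N%:R :> R by rewrite ltr0n muln_gt0 K0.
set q := delta * _ in TE *; have q0 : 0 < q by exact: mulr_gt0.
have c0 : 0 < q `^ (1 / 3) by exact: powR_gt0.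
have c2 : (q `^ (1 / 3)) ^+ 2 = q `^ (2 / 3).
  by rewrite -powR_mulrn ?ltW// -powRrM; congr (_ `^ _); lra.
have c3 : (q `^ (1 / 3)) ^+ 3 = q.
  by rewrite -powR_mulrn ?ltW// -powRrM (_ : _ * _ = 1) ?powRr1 ?ltW//; lra.
have Tn0 : T%:R != 0 :> R by rewrite pnatr_eq0 -lt0n.
exists (q `^ (1 / 3)); split => //.
- by rewrite c2.
- apply: (mulIf Tn0); rewrite -mulrA -natrM -/q -[in LHS]c3 exprS c2 -TE.
  by [].
- by rewrite powRN.
rewrite c2 powRN; have dN : q `^ (2 / 3) = delta `^ (2 / 3) * (K * T)%N%:R `^ (2 / 3).
  by rewrite /q powRM ?ltW.
have d1 : delta `^ (1 / 3) * delta `^ (2 / 3) = delta.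
  rewrite -powRD; last by rewrite gt_eqF ?implybT.
  by rewrite (_ : _ + _ = 1) ?powRr1 ?ltW//; lra.
have p1 : delta `^ (2 / 3) != 0 by rewrite gt_eqF ?powR_gt0.
by rewrite dN invfM mulrA; congr (_ * _); apply: (canRL (mulfK p1)).
Qed.

Lemma rate_bound (R : realFieldType) (c delta kappa G sigma C' D eta : R) :
  1 <= c -> 0 < delta -> delta <= 1 -> 0 <= kappa -> 0 < G ->
  D = delta / c ^+ 2 -> eta = D / (G * c) ->
  (D * (sigma * c) + c ^+ 2 * (G * C' * D ^+ 2) + (2 * eta)^-1 *
     (D ^+ 2 + c ^+ 2 * (eta ^+ 2 * G ^+ 2 + 4 * (eta * (kappa * D ^+ 2)) * G
        + 4 * (kappa * D ^+ 3) + (kappa * D ^+ 2) ^+ 2))) / delta <=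
  (sigma + G + 4 * kappa * G) / c
    + (2 * kappa * G + G * C' + 2 * kappa ^+ 2 * G) * (delta / c ^+ 2).
Proof.
move=> c1 d0 d1 k0 G0 -> ->; have c0 : 0 < c by exact: lt_le_trans c1.
rewrite -subr_ge0.
(* Term by term: the noise gives [sigma / c]; [D^2] and [eta^2 G^2] give [G / (2 c)] each, by the
   choice of [eta]; the [C'] term and the one linear in [|g|] are matched exactly. The remaining two
   are [2 kappa G delta / c] and [kappa^2 G delta^2 / (2 c^3)]; the slack is thus the displayed sum,
   nonnegative as [delta <= 1 <= c]. *)
rewrite (_ : _ - _ = kappa * G / c * (4 - 2 * delta)
  + kappa ^+ 2 * G * delta / c ^+ 2 * (2 - delta / (2 * c))); last first.
  by field; rewrite !gt_eqF.
have cV : 0 <= c^-1 by rewrite invr_ge0 ltW.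
have dc : delta / (2 * c) <= 2.
  rewrite ler_pdivrMr ?mulr_gt0//; lra.
have h1 : 0 <= 4 - 2 * delta by lra.
have h2 : 0 <= 2 - delta / (2 * c) by lra.
by rewrite addr_ge0// !mulr_ge0// ?exprn_ge0 ?invr_ge0 ?exprn_ge0// ltW.
Qed.

Theorem theorem3p3 (R : realType)
  (n d : nat) (M : set 'rV[R]_n)
  (hM : embedded_submanifold d M) (hcomplete : complete_submanifold M)
  (* the objective f(x) = E[F(x, nu)] *)
  (dV : measure_display) (V : measurableType dV) (mu : probability V R)
  (F : 'rV[R]_n -> V -> R)
  (hF : forall x, M x -> mu.-integrable setT (EFin \o F x))
  (C C' L G sigma : R)
  (hC : 0 <= C) (hC' : 0 <= C') (hL : 0 <= L) (hG : 0 < G) (hsigma : 0 <= sigma)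
  (hII : second_ff_bounded M C)
  (Retr : 'rV[R]_n -> 'rV[R]_n -> 'rV[R]_n)
  (hRetr : is_retraction M Retr) (hRetrC : retraction_bounded M Retr C')
  (hLip : lipschitz_assumption mu M F L)
  (hinf : exists b : R, forall x, M x -> b <= objective mu F x)
  (hO : oracle_assumption mu M F G sigma)
  (delta epsilon : R)
  (hdelta : 0 < delta < 1) (hepsilon : 0 < epsilon < 1)
  (K T N : nat) (hK : (0 < K)%N) (hT : (0 < T)%N)
  (hN : N = (K * T)%N) (hTN : T%:R = (delta * N%:R) `^ (2 / 3))
  (D eta : R) (hD : D = delta / T%:R) (heta : eta = D / (G * Num.sqrt T%:R))
  (* parallel transport between points at distance at most delta is well
     defined *)
  (hgeo : forall x y, M x -> M y -> (gdist M x y <= delta%:E)%E ->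
     unique_min_geodesic M x y)
  (x0 : 'rV[R]_n) (hx0 : M x0)
  (dO : measure_display) (Omega : measurableType dO) (P : probability Omega R)
  (s : nat -> nat -> {RV P >-> R}) (nu : nat -> nat -> {RV P >-> V})
  (J : {RV P >-> nat})
  (hrand : algorithm_randomness mu K T s nu J) :
  let f := objective mu F in
  let m : R := (n - d)%:R in
  let xKT (w : Omega) : 'rV[R]_n :=
    epoch_start M Retr F D eta T x0 (fun k t => s k t w) (fun k t => nu k t w)
      K in
  let wout (w : Omega) : 'rV[R]_n :=
    epoch_output M Retr F D eta T x0 (fun k t => s k t w) (fun k t => nu k t w)
      (J w) in
  let theta := f x0 - \int[P]_w f (xKT w) in
  let C3 := theta + sigma + G + 4 * m * G * C in
  let C4 := 2 * m * G * C + G * C' + 2 * m ^+ 2 * G * C ^+ 2 in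
  (\int[P]_w goldstein_norm M delta f (wout w)
   <= (C3 * (delta * N%:R) `^ (- (1 / 3))
       + C4 * delta `^ (1 / 3) * N%:R `^ (- (2 / 3))
       + delta * L * C)%:E)%E.
Proof.
pose f := objective mu F; pose m : R := (n - d)%:R.
pose xKT (w : Omega) : 'rV[R]_n :=
  epoch_start M Retr F D eta T x0 (fun k t => s k t w) (fun k t => nu k t w) K.
pose theta := f x0 - \int[P]_w f (xKT w).
pose C3 := theta + sigma + G + 4 * m * G * C.
pose C4 := 2 * m * G * C + G * C' + 2 * m ^+ 2 * G * C ^+ 2.
cbv zeta; rewrite -/f -/m -/xKT -/theta -/C3 -/C4.
have [d0 d1] := andP hdelta; have G0 := ltW hG.
rewrite hN in hTN *.
have [c [c0 c2 Kc E1 E2]] := step_sizes d0 hK hTN hT.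
have Tp : 0 < T%:R :> R by rewrite ltr0n.
have c1 : 1 <= c.
  rewrite -(@ler_pXn2r _ 2%N) ?nnegrE//; last exact: ltW.
  by rewrite expr1n c2 ler1n.
have sqrtT : Num.sqrt T%:R = c by rewrite -c2 sqrtr_sqr gtr0_norm.
have D0 : 0 < D by rewrite hD divr_gt0.
have eta0 : 0 < eta by rewrite heta sqrtT divr_gt0// mulr_gt0.
have DE : D = delta / c ^+ 2 by rewrite c2.
have etaE : eta = D / (G * c) by rewrite heta sqrtT.
have deltaE : T%:R * D = delta by rewrite hD mulrC divfK// gt_eqF.
(* [kappa] drives the iteration and so the rate; the transport term is bounded with [C] itself. *)
pose kappa := m * C.
have k0 : 0 <= kappa by rewrite mulr_ge0.
have hk : dproj_bounded (d:=d) M kappa := dproj_bounded_codim hM hC hII.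
have hgeo' x y : M x -> M y -> (gdist M x y <= delta%:E)%E ->
    exists c, min_geodesic M x y c.
  by move=> Mx My xy; have [] := hgeo x y Mx My xy.
apply: (le_trans (expectation_goldstein hM hF hC' hL hG hsigma hRetr hRetrC hLip
  hO hK hT D0 hx0 hrand hk k0 eta0 hC (dproj_bounded_second_ff hM hC hII) deltaE hgeo')).
rewrite lee_fin E1 -(mulrA C4) E2 lerD2r.
pose start k w := epoch_start M Retr F D eta T x0 (fun k t => s k t w)
  (fun k t => nu k t w) k.
pose a k := \int[P]_w f (start k w).
pose S (k : nat) w := \sum_(t < T) rgrad M f (query Retr (epoch_state M Retr F D eta
  (start k w) (fun t => s k t w) (fun t => nu k t w) t) (s k t w)).
pose B := D * (sigma * c) + c ^+ 2 * (G * C' * D ^+ 2) + (2 * eta)^-1 *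
  (D ^+ 2 + c ^+ 2 * (eta ^+ 2 * G ^+ 2 + 4 * (eta * (kappa * D ^+ 2)) * G
     + 4 * (kappa * D ^+ 3) + (kappa * D ^+ 2) ^+ 2)).
have epoch (k : 'I_K) : (\int[P]_w enorm (S k w)) / T%:R <= (B + (a k - a k.+1)) / delta.
  have [_] := expectation_epoch hM hF hC' hL hG hsigma hRetr hRetrC
    hLip hO hK hT D0 hx0 hrand hk k0 eta0 (ltn_ord k).
  rewrite -/f -/(S k) -/(a k) -/(a k.+1) sqrtT -c2 => h.
  have -> : delta^-1 = D^-1 * (c ^+ 2)^-1 by rewrite -invfM -deltaE -c2 mulrC.
  rewrite mulrA; apply: ler_wpM2r.
    by rewrite invr_ge0 exprn_ge0// ltW.
  rewrite ler_pdivlMr// mulrC.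
  by apply: (le_trans h); rewrite /B; lra.
have tele : \sum_(k < K) (a k - a k.+1) = theta.
  rewrite -(big_mkord xpredT (fun k => a k - a k.+1)).
  rewrite (@telescope_sumr_eq _ 0 K (fun k => - a k))//; last first.
    by move=> k _; rewrite opprK addrC.
  have a0 : a 0%N = f x0 := Rintegral_const P (f x0).
  by rewrite opprK addrC a0.
have Kp : 0 < K%:R :> R by rewrite ltr0n.
(* Averaged over [K] epochs and divided by [delta], the telescoped decrease of [f] becomes
   [theta / (K delta) = theta / c]. *)
apply: (@le_trans _ _ (B / delta + theta / c)).
  apply: (@le_trans _ _ (K%:R^-1 * \sum_(k < K) ((B + (a k - a k.+1)) / delta))).
    apply: ler_wpM2l; first by rewrite invr_ge0 ltW.
    by apply: ler_sum => k _; exact: epoch.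
  rewrite -mulr_suml big_split/= tele sumr_const card_ord -[B *+ K]mulr_natl -Kc.
  by rewrite le_eqVlt; apply/orP; left; apply/eqP; field; rewrite !gt_eqF.
have := rate_bound sigma C' c1 d0 (ltW d1) k0 hG DE etaE.
rewrite -/B => h; rewrite /C3 /C4.
apply: (@le_trans _ _ ((sigma + G + 4 * kappa * G) / c
  + (2 * kappa * G + G * C' + 2 * kappa ^+ 2 * G) * (delta / c ^+ 2) + theta / c)).
  by rewrite lerD2r.
rewrite /kappa le_eqVlt; apply/orP; left; apply/eqP; field; rewrite gt_eqF//.
Qed.
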